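(* Let $k\ge1$. The stable range with respect to the genus of the spaces $\mathfrak h_{g,1}(2k)^{\mathrm{Sp}}$ is given by: $$\dim\mathfrak h_{k,1}(2k)^{\mathrm{Sp}}=\dim\mathfrak h_{k+1,1}(2k)^{\mathrm{Sp}}=\cdots\quad\text{if $k$ is odd,}$$ $$\dim\mathfrak h_{k-1,1}(2k)^{\mathrm{Sp}}=\dim\mathfrak h_{k,1}(2k)^{\mathrm{Sp}}=\cdots\quad\text{if $k$ is even.}$$ That is, $\dim\mathfrak h_{g,1}(2k)^{\mathrm{Sp}}$ is independent of $g$ for $g\ge k$ when $k$ is odd, and for $g\ge k-1$ when $k$ is even. Furthermore, for every odd $k\ge3$, $$\dim\mathfrak h_{k,1}(2k)^{\mathrm{Sp}}=\dim\mathfrak h_{k-1,1}(2k)^{\mathrm{Sp}}+1.$$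
   Context: $H_{\mathbb Q}$ is the first rational homology of a compact oriented surface of genus $g\ge1$ with one boundary component, with its intersection form; it is the standard representation of $\mathrm{Sp}=\mathrm{Sp}(2g,\mathbb Q)$. $\mathcal L_{g,1}=\bigoplus_{k\ge1}\mathcal L_{g,1}(k)$ is the free graded Lie algebra on $H_{\mathbb Q}$. $\mathfrak h_{g,1}$ is the graded Lie algebra of symplectic derivations of $\mathcal L_{g,1}$ (those killing the symplectic element); its degree $k$ part is $\mathfrak h_{g,1}(k)=\mathrm{Ker}\big(H_{\mathbb Q}\otimes\mathcal L_{g,1}(k+1)\xrightarrow{[\ ,\ ]}\mathcal L_{g,1}(k+2)\big)$. The superscript $\mathrm{Sp}$ denotes the $\mathrm{Sp}(2g,\mathbb Q)$-invariant part. *)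

(* Defs.v *)
From HB Require Import structures.
From mathcomp Require Import all_boot all_order all_algebra.
From mathcomp Require Import boolp.

Set Implicit Arguments.
Unset Strict Implicit.
Unset Printing Implicit Defensive.

Import GRing.Theory.

Local Open Scope ring_scope.
Local Open Scope quotient_scope.

HB.mixin Record Lmodule_isLieAlgebra (R : comNzRingType) L of GRing.Lmodule R L
  := {
  lie : L -> L -> L;
  lie_linearl : forall (c : R) (x y z : L),
    lie (c *: x + y) z = c *: lie x z + lie y z;
  lie_linearr : forall (c : R) (x y z : L),
    lie x (c *: y + z) = c *: lie x y + lie x z;
  liexx : forall x : L, lie x x = 0;
  lie_jacobi : forall x y z : L,
    lie x (lie y z) + lie y (lie z x) + lie z (lie x y) = 0
}.

#[short(type="lieAlgType")]
HB.structure Definition LieAlgebra (R : comNzRingType) :=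
  { L of Lmodule_isLieAlgebra R L & GRing.Lmodule R L }.

Section FreeLie.
Variables (R : comNzRingType) (V : lmodType R).

Inductive lie_term : Type :=
| LGen of V
| LZero
| LAdd of lie_term & lie_term
| LScale of R & lie_term
| LBr of lie_term & lie_term.

Inductive lie_eqv : lie_term -> lie_term -> Prop :=
| lie_eqv_refl t : lie_eqv t t
| lie_eqv_sym s t : lie_eqv s t -> lie_eqv t s
| lie_eqv_trans s t u : lie_eqv s t -> lie_eqv t u -> lie_eqv s u
| lie_eqv_add s s' t t' :
    lie_eqv s s' -> lie_eqv t t' -> lie_eqv (LAdd s t) (LAdd s' t')
| lie_eqv_scale c t t' : lie_eqv t t' -> lie_eqv (LScale c t) (LScale c t')
| lie_eqv_br s s' t t' :
    lie_eqv s s' -> lie_eqv t t' -> lie_eqv (LBr s t) (LBr s' t')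
| lie_eqv_addA s t u : lie_eqv (LAdd s (LAdd t u)) (LAdd (LAdd s t) u)
| lie_eqv_addC s t : lie_eqv (LAdd s t) (LAdd t s)
| lie_eqv_add0 t : lie_eqv (LAdd LZero t) t
| lie_eqv_addN t : lie_eqv (LAdd (LScale (-1) t) t) LZero
| lie_eqv_scaleA b c t :
    lie_eqv (LScale b (LScale c t)) (LScale (b * c) t)
| lie_eqv_scale1 t : lie_eqv (LScale 1 t) t
| lie_eqv_scaleDr c s t :
    lie_eqv (LScale c (LAdd s t)) (LAdd (LScale c s) (LScale c t))
| lie_eqv_scaleDl b c t :
    lie_eqv (LScale (b + c) t) (LAdd (LScale b t) (LScale c t))
| lie_eqv_brl c s t u :
    lie_eqv (LBr (LAdd (LScale c s) t) u)
            (LAdd (LScale c (LBr s u)) (LBr t u))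
| lie_eqv_brr c s t u :
    lie_eqv (LBr s (LAdd (LScale c t) u))
            (LAdd (LScale c (LBr s t)) (LBr s u))
| lie_eqv_brxx t : lie_eqv (LBr t t) LZero
| lie_eqv_jacobi s t u :
    lie_eqv (LAdd (LAdd (LBr s (LBr t u)) (LBr t (LBr u s))) (LBr u (LBr s t)))
            LZero
| lie_eqv_gen c v w :
    lie_eqv (LGen (c *: v + w)) (LAdd (LScale c (LGen v)) (LGen w)).

HB.instance Definition _ := gen_eqMixin lie_term.
HB.instance Definition _ := gen_choiceMixin lie_term.

Definition lie_eqvb (s t : lie_term) : bool := `[< lie_eqv s t >].

Fact lie_eqvb_refl : reflexive lie_eqvb.
Proof. by move=> t; apply/asboolP; exact: lie_eqv_refl. Qed.

Fact lie_eqvb_sym : symmetric lie_eqvb.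
Proof. by move=> s t; apply/asboolP/asboolP; exact: lie_eqv_sym. Qed.

Fact lie_eqvb_trans : transitive lie_eqvb.
Proof.
by move=> t s u /asboolP st /asboolP tu; apply/asboolP/(lie_eqv_trans st tu).
Qed.

Canonical lie_eqvb_equiv :=
  EquivRel lie_eqvb lie_eqvb_refl lie_eqvb_sym lie_eqvb_trans.

(* Formal Lie expressions in elements of V, modulo the smallest congruence
   containing the Lie algebra axioms and the linearity of V -> FreeLie; the
   universal property is flie_lift_gen, flie_lift_lie and flie_lift_uniq *)
Definition FreeLie : Type := {eq_quot lie_eqvb}.
HB.instance Definition _ := Choice.on FreeLie.
HB.instance Definition _ := EqQuotient.on FreeLie.

Lemma flie_eqP (s t : lie_term) : lie_eqv s t <-> \pi_FreeLie s = \pi_FreeLie t.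
Proof. by split=> [st|/eqmodP/asboolP//]; apply/eqmodP/asboolP. Qed.

Let reprP (t : lie_term) : lie_eqv (repr (\pi_FreeLie t)) t.
Proof. by apply/flie_eqP; rewrite reprK. Qed.

Definition flie_zero : FreeLie := \pi_FreeLie LZero.
Definition flie_add (x y : FreeLie) : FreeLie :=
  \pi_FreeLie (LAdd (repr x) (repr y)).
Definition flie_scale (c : R) (x : FreeLie) : FreeLie :=
  \pi_FreeLie (LScale c (repr x)).
Definition flie_opp (x : FreeLie) : FreeLie := flie_scale (-1) x.
Definition flie_br (x y : FreeLie) : FreeLie :=
  \pi_FreeLie (LBr (repr x) (repr y)).
Definition flie_gen (v : V) : FreeLie := \pi_FreeLie (LGen v).

Let piD s t : flie_add (\pi_FreeLie s) (\pi_FreeLie t) = \pi_FreeLie (LAdd s t).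
Proof. by apply/flie_eqP/lie_eqv_add; exact: reprP. Qed.
Let piZ c t : flie_scale c (\pi_FreeLie t) = \pi_FreeLie (LScale c t).
Proof. by apply/flie_eqP/lie_eqv_scale; exact: reprP. Qed.
Let piB s t : flie_br (\pi_FreeLie s) (\pi_FreeLie t) = \pi_FreeLie (LBr s t).
Proof. by apply/flie_eqP/lie_eqv_br; exact: reprP. Qed.

Fact flie_addA : associative flie_add.
Proof.
elim/quotW=> s; elim/quotW=> t; elim/quotW=> u.
rewrite (piD t u) (piD s t) !piD.
apply/flie_eqP; exact: lie_eqv_addA.
Qed.

Fact flie_addC : commutative flie_add.
Proof.
by elim/quotW=> s; elim/quotW=> t; rewrite !piD; apply/flie_eqP; exact: lie_eqv_addC.
Qed.

Fact flie_add0 : left_id flie_zero flie_add.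
Proof. by elim/quotW=> t; rewrite piD; apply/flie_eqP; exact: lie_eqv_add0. Qed.

Fact flie_addN : left_inverse flie_zero flie_opp flie_add.
Proof.
by elim/quotW=> t; rewrite /flie_opp piZ piD; apply/flie_eqP; exact: lie_eqv_addN.
Qed.

HB.instance Definition _ :=
  GRing.isZmodule.Build FreeLie flie_addA flie_addC flie_add0 flie_addN.

Fact flie_scaleA b c x : flie_scale b (flie_scale c x) = flie_scale (b * c) x.
Proof.
by elim/quotW: x => t; rewrite (piZ c t) !piZ; apply/flie_eqP; exact: lie_eqv_scaleA.
Qed.

Fact flie_scale1 : left_id 1 flie_scale.
Proof. by elim/quotW=> t; rewrite piZ; apply/flie_eqP; exact: lie_eqv_scale1. Qed.

Fact flie_scaleDr : right_distributive flie_scale +%R.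
Proof.
move=> c; elim/quotW=> s; elim/quotW=> t; rewrite /GRing.add /=.
rewrite (piD s t) (piZ c s) (piZ c t) piZ piD.
apply/flie_eqP; exact: lie_eqv_scaleDr.
Qed.

Fact flie_scaleDl x : {morph flie_scale^~ x : b c / b + c}.
Proof.
elim/quotW: x => t b c; rewrite [in RHS]/GRing.add /=.
rewrite (piZ b t) (piZ c t) piZ piD.
apply/flie_eqP; exact: lie_eqv_scaleDl.
Qed.

HB.instance Definition _ := GRing.Zmodule_isLmodule.Build R FreeLie
  flie_scaleA flie_scale1 flie_scaleDr flie_scaleDl.

Fact flie_pi_add s t : \pi_FreeLie (LAdd s t) = \pi_FreeLie s + \pi_FreeLie t.
Proof. by rewrite /GRing.add /= piD. Qed.

Fact flie_pi_scale c t : \pi_FreeLie (LScale c t) = c *: \pi_FreeLie t.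
Proof. by rewrite /GRing.scale /= piZ. Qed.

Fact flie_br_linearl (c : R) (x y z : FreeLie) :
  flie_br (c *: x + y) z = c *: flie_br x z + flie_br y z.
Proof.
elim/quotW: x => s; elim/quotW: y => t; elim/quotW: z => u.
rewrite (piB s u) (piB t u) -!flie_pi_scale -!flie_pi_add piB.
apply/flie_eqP; exact: lie_eqv_brl.
Qed.

Fact flie_br_linearr (c : R) (x y z : FreeLie) :
  flie_br x (c *: y + z) = c *: flie_br x y + flie_br x z.
Proof.
elim/quotW: x => s; elim/quotW: y => t; elim/quotW: z => u.
rewrite (piB s t) (piB s u) -!flie_pi_scale -!flie_pi_add piB.
apply/flie_eqP; exact: lie_eqv_brr.
Qed.

Fact flie_brxx (x : FreeLie) : flie_br x x = 0.
Proof. by elim/quotW: x => t; rewrite piB; apply/flie_eqP; exact: lie_eqv_brxx. Qed.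

Fact flie_jacobi (x y z : FreeLie) :
  flie_br x (flie_br y z) + flie_br y (flie_br z x) + flie_br z (flie_br x y)
  = 0.
Proof.
elim/quotW: x => s; elim/quotW: y => t; elim/quotW: z => u.
rewrite (piB t u) (piB u s) (piB s t) !piB -!flie_pi_add.
apply/flie_eqP; exact: lie_eqv_jacobi.
Qed.

HB.instance Definition _ := Lmodule_isLieAlgebra.Build R FreeLie
  flie_br_linearl flie_br_linearr flie_brxx flie_jacobi.

Fact flie_pi_br s t : \pi_FreeLie (LBr s t) = lie (\pi_FreeLie s) (\pi_FreeLie t).
Proof. by rewrite /lie /= piB. Qed.

Fact flie_gen_is_linear : linear flie_gen.
Proof.
move=> c v w; rewrite -flie_pi_scale -flie_pi_add.
apply/flie_eqP; exact: lie_eqv_gen.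
Qed.

HB.instance Definition _ :=
  GRing.isLinear.Build R V FreeLie *:%R flie_gen flie_gen_is_linear.

(* Grading by bracket length, with flie_gen V in degree 1. *)
Inductive flie_deg : nat -> FreeLie -> Prop :=
| flie_deg_gen v : flie_deg 1 (flie_gen v)
| flie_deg0 n : flie_deg n 0
| flie_degD n x y : flie_deg n x -> flie_deg n y -> flie_deg n (x + y)
| flie_degZ n c x : flie_deg n x -> flie_deg n (c *: x)
| flie_deg_br m n x y :
    flie_deg m x -> flie_deg n y -> flie_deg (m + n) (lie x y).

Section Lift.
Variables (L : lieAlgType R) (f : {linear V -> L}).

Fixpoint lie_eval (t : lie_term) : L :=
  match t with
  | LGen v => f v
  | LZero => 0
  | LAdd s t => lie_eval s + lie_eval t
  | LScale c t => c *: lie_eval t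
  | LBr s t => lie (lie_eval s) (lie_eval t)
  end.

Definition flie_lift (x : FreeLie) : L := lie_eval (repr x).

Lemma lie_eval_eqv s t : lie_eqv s t -> lie_eval s = lie_eval t.
Proof.
elim=> //=.
- by move=> {}s {}t u _ -> _ ->.
- by move=> s0 s' t0 t' _ -> _ ->.
- by move=> c t0 t' _ ->.
- by move=> s0 s' t0 t' _ -> _ ->.
- by move=> *; rewrite addrA.
- by move=> *; rewrite addrC.
- by move=> *; rewrite add0r.
- by move=> *; rewrite scaleN1r addNr.
- by move=> *; rewrite scalerA.
- by move=> *; rewrite scale1r.
- by move=> *; rewrite scalerDr.
- by move=> *; rewrite scalerDl.
- by move=> *; rewrite lie_linearl.
- by move=> *; rewrite lie_linearr.
- by move=> *; rewrite liexx.
- by move=> *; rewrite lie_jacobi.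
- by move=> *; rewrite linearP.
Qed.

Lemma flie_lift_pi t : flie_lift (\pi_FreeLie t) = lie_eval t.
Proof. exact/lie_eval_eqv/reprP. Qed.

Lemma flie_lift_gen v : flie_lift (flie_gen v) = f v.
Proof. exact: flie_lift_pi. Qed.

Lemma flie_lift_lie x y :
  flie_lift (lie x y) = lie (flie_lift x) (flie_lift y).
Proof.
elim/quotW: x => s; elim/quotW: y => t.
by rewrite -flie_pi_br !flie_lift_pi.
Qed.

Fact flie_lift_is_linear : linear flie_lift.
Proof.
move=> c; elim/quotW=> s; elim/quotW=> t.
by rewrite -flie_pi_scale -flie_pi_add !flie_lift_pi.
Qed.

HB.instance Definition _ :=
  GRing.isLinear.Build R FreeLie L *:%R flie_lift flie_lift_is_linear.

Lemma flie_lift_uniq (h : {linear FreeLie -> L}) :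
    (forall x y, h (lie x y) = lie (h x) (h y)) ->
    (forall v, h (flie_gen v) = f v) ->
  h =1 flie_lift.
Proof.
move=> hM hf; elim/quotW=> t; rewrite flie_lift_pi.
elim: t => //= [|s IHs t IHt|c t IHt|s IHs t IHt].
- exact: linear0.
- by rewrite flie_pi_add linearD IHs IHt.
- by rewrite flie_pi_scale linearZ IHt.
- by rewrite flie_pi_br hM IHs IHt.
Qed.

End Lift.

End FreeLie.

(* W is a linear subspace of V of finite dimension d. *)
Definition has_dim (F : fieldType) (V : lmodType F) (W : V -> Prop) (d : nat) :
    Prop :=
  exists b : 'I_d -> V,
    (forall c : 'I_d -> F, \sum_i c i *: b i = 0 -> forall i, c i = 0) /\
    (forall x, W x <-> exists c : 'I_d -> F, x = \sum_i c i *: b i).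

Lemma has_dim_uniq (F : fieldType) (V : lmodType F) (W : V -> Prop) m n :
  has_dim W m -> has_dim W n -> m = n.
Proof.
suff le p q : has_dim W p -> has_dim W q -> (p <= q)%N.
  by move=> Wm Wn; apply/eqP; rewrite eqn_leq !le.
move=> [b [bfree bW]] [b' [_ b'W]].
have /choice[A AE] i : exists c : 'I_q -> F, b i = \sum_j c j *: b' j.
  apply/b'W/bW; exists (fun j => (j == i)%:R).
  rewrite (bigD1 i) //= eqxx scale1r big1 ?addr0// => j /negPf ->.
  by rewrite scale0r.
pose M := \matrix_(i, j) A i j.
suff /eqP <- : row_free M by exact: rank_leq_col.
apply/inj_row_free => v vM; apply/rowP => i; rewrite mxE.
apply: (bfree (v 0)) => {i}.
under eq_bigr do rewrite AE scaler_sumr.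
rewrite exchange_big /= big1// => j _.
under eq_bigr do rewrite scalerA.
rewrite -scaler_suml.
have /rowP/(_ j) := vM; rewrite !mxE.
by under eq_bigr do rewrite mxE; move=> ->; rewrite scale0r.
Qed.

Section Symplectic.
Variable g : nat.

(* H_Q, written in a symplectic basis x_1, ..., x_g, y_1, ..., y_g *)
Definition HQ : lmodType rat := 'cV[rat]_(g + g).

Definition Hbasis (i : 'I_(g + g)) : HQ := delta_mx i 0.

(* Gram matrix of the intersection form in this basis *)
Definition Jmx : 'M[rat]_(g + g) := block_mx 0 1%:M (- 1%:M) 0.

Definition in_Sp (A : 'M[rat]_(g + g)) : Prop := A^T *m Jmx *m A = Jmx.

Definition FL : lieAlgType rat := FreeLie HQ.

(* H_Q (x) FL: the family (u_i)_i stands for \sum_i Hbasis i (x) u_i. *)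
Definition HtensorL : lmodType rat := {ffun 'I_(g + g) -> FL}.

Definition tensor_bracket (u : HtensorL) : FL :=
  \sum_i lie (flie_gen (Hbasis i) : FL) (u i).

Definition Sp_actL (A : 'M[rat]_(g + g)) : FL -> FL :=
  flie_lift (@flie_gen rat HQ \o mulmx A).

(* A (e_j (x) u_j) = \sum_i A i j e_i (x) A u_j *)
Definition Sp_actHL (A : 'M[rat]_(g + g)) (u : HtensorL) : HtensorL :=
  [ffun i => \sum_j A i j *: Sp_actL A (u j)].

Definition hg1 (k : nat) (u : HtensorL) : Prop :=
  (forall i, flie_deg k.+1 (u i)) /\ tensor_bracket u = 0.

Definition hg1_Sp (k : nat) (u : HtensorL) : Prop :=
  hg1 k u /\ forall A, in_Sp A -> Sp_actHL A u = u.

End Symplectic.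

(* Main.v *)
(* Expanding Lie elements into words and projecting back with the Dynkin map turns
   h_(g,1)(n)^Sp into the space of Sp-invariant tensors of length n + 2 that are
   fixed by rotation and are eigenvectors of the Dynkin operator on the last n + 1
   places. Every invariant of genus g is the restriction of one of genus g + 1:
   the Casimir operator, split off at the first place, is injective and writes an
   invariant in terms of its contractions, which lift by induction. The Dynkin
   operators are idempotent up to a scalar, so a lift can be corrected to satisfy the
   other two conditions, and passing from g to g + 1 adds the dimension of the
   kernel of the restriction.

   A tensor in the kernel vanishes on the words that miss a letter. Hence the kernel
   is 0 if 2(g + 1) > n + 2, and if 2(g + 1) = n + 2 its elements are alternating,
   which is incompatible with invariance under a rotation of even length. In the
   remaining case g + 1 = k, n = 2k, summing t(w) times the volume form on the places
   other than a and b, over the words w with w_a = l and w_b the dual letter, gives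
   a function phi(a,b) that determines t. The signs of the volume form turn the
   Dynkin condition into the one for odd letters, which fixes phi up to a scalar;
   its symmetry and its rotation rule then force phi = 0 for k even. For k odd, an
   identity in the free Lie superalgebra on two odd letters x, y, in bidegree
   (2k, 2), provides a nonzero element. *)
From HB Require Import structures.
From mathcomp Require Import all_boot all_order all_algebra all_fingroup.
From mathcomp Require Import boolp functions.
From mathcomp Require Import zify ring lra.
Require Import Defs.

Set Implicit Arguments.
Unset Strict Implicit.
Unset Printing Implicit Defensive.

Import Order.TTheory GRing.Theory Num.Theory.

Local Open Scope ring_scope.

(** Surjectivity of the restriction could be drawn from the first fundamental theorem for Sp.
    Instead, infinitesimal invariance rewrites the split Casimir operator of gl(2g) as a sum of
    contractions reinserted with the form, and these live two places lower. The operator is 2g + 1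
    plus the sum of the transpositions of the first place with the others, a Jucys-Murphy element;
    its eigenvalues are contents of Young diagrams with at most 2g rows, so they are at least 1 -
    2g. Hence injectivity holds in every genus and every length.

    The parity of k enters by comparing two coefficients. For odd letters, a Lie element with one y
    and 2k letters x is a multiple of (ad x)^(2k) y = (ad x^2)^k y, whose coefficients at x^(2k) y
    and y x^(2k) are 1 and (-1)^k. One rotation and the symmetry of phi identify the two values up
    to the sign -1, so the scalar c satisfies c = -(-1)^k c. For k odd this is no constraint, and
    the symmetry [Z_k, Z_0] = [Z_0, Z_k] of the bracket of two odd elements supplies an element with
    c nonzero. *)

(** * Noncommutative series with their commutator bracket *)

Section Series.
Variable A : Type.

(* Noncommutative formal power series in the letters of A. *)
Definition series := seq A -> rat^o.
HB.instance Definition _ := GRing.Lmodule.copy series (seq A -> rat^o).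

Implicit Types f g h : series.

Definition shift (x : A) f : series := fun w => f (x :: w).

(** The concatenation product. Recursion through the left derivative [shift] replaces the sum over
    all factorisations of a word, so that identities become inductions on the word. *)
Fixpoint conv f g (w : seq A) : rat :=
  f [::] * g w + (if w is x :: w' then conv (shift x f) g w' else 0).

Lemma shiftP x (c : rat) f g :
  shift x (c *: f + g) = c *: shift x f + shift x g.
Proof. by []. Qed.

Lemma convPl (c : rat) f g h w :
  conv (c *: f + g) h w = c * conv f h w + conv g h w.
Proof.
elim: w f g => [|x w IHw] f g /=; rewrite ?shiftP ?IHw;
  rewrite -[(c *: f + g) [::]]/(c * f [::] + g [::]); ring.
Qed.

Lemma convPr (c : rat) f g h w :
  conv f (c *: g + h) w = c * conv f g w + conv f h w.
Proof.
elim: w f => [|x w IHw] f /=; rewrite ?IHw.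
  by rewrite -[(c *: g + h) [::]]/(c * g [::] + h [::]); ring.
by rewrite -[(c *: g + h) (x :: w)]/(c * g (x :: w) + h (x :: w)); ring.
Qed.

Lemma shift_conv x f g :
  shift x (conv f g) = f [::] *: shift x g + conv (shift x f) g.
Proof. by []. Qed.

Lemma convA f g h : conv f (conv g h) = conv (conv f g) h.
Proof.
apply/funext => w; elim: w f g => [|x w IHw] f g /=; first by ring.
by rewrite shift_conv convPl IHw /=; ring.
Qed.

Definition series_lie f g : series := conv f g - conv g f.

Lemma series_lieE f g w : series_lie f g w = conv f g w - conv g f w.
Proof. by []. Qed.

Fact series_lie_linearl (c : rat) f g h :
  series_lie (c *: f + g) h = c *: series_lie f h + series_lie g h.
Proof.
apply/funext => w; rewrite series_lieE convPl convPr.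
rewrite -[RHS]/(c * (conv f h w - conv h f w) + (conv g h w - conv h g w)).
by ring.
Qed.

Fact series_lie_linearr (c : rat) f g h :
  series_lie f (c *: g + h) = c *: series_lie f g + series_lie f h.
Proof.
apply/funext => w; rewrite series_lieE convPl convPr.
rewrite -[RHS]/(c * (conv f g w - conv g f w) + (conv f h w - conv h f w)).
by ring.
Qed.

Fact series_liexx f : series_lie f f = 0.
Proof. by apply/funext => w; rewrite series_lieE subrr. Qed.

Lemma convBl f g h w : conv (f - g) h w = conv f h w - conv g h w.
Proof. by rewrite addrC -scaleN1r convPl mulN1r addrC. Qed.

Lemma convBr f g h w : conv f (g - h) w = conv f g w - conv f h w.
Proof. by rewrite addrC -scaleN1r convPr mulN1r addrC. Qed.

Fact series_jacobi f g h :
  series_lie f (series_lie g h) + series_lie g (series_lie h f)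
  + series_lie h (series_lie f g) = 0.
Proof.
apply/funext => w.
rewrite -[LHS]/(series_lie f (series_lie g h) w + series_lie g (series_lie h f) w
  + series_lie h (series_lie f g) w) !series_lieE !convBl !convBr !convA.
by rewrite -[RHS]/(0 : rat); ring.
Qed.

HB.instance Definition _ := Lmodule_isLieAlgebra.Build rat series
  series_lie_linearl series_lie_linearr series_liexx series_jacobi.

Definition homog n f := forall w, size w != n -> f w = 0.

Lemma homog_shift n x f : homog n.+1 f -> homog n (shift x f).
Proof. by move=> hf w wn; apply: hf; rewrite eqSS. Qed.

Lemma conv_const f g w : (forall x u, f (x :: u) = 0) ->
  conv f g w = f [::] * g w.
Proof.
move=> f0; elim: w f f0 => [|x w IHw] f f0 /=; first by rewrite addr0.
by rewrite IHw ?/shift ?f0 ?mul0r ?addr0// => y u; rewrite /shift f0.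
Qed.

Lemma homog_conv m n f g : homog m f -> homog n g -> homog (m + n)%N (conv f g).
Proof.
elim: m f => [|m IHm] f hf hg w.
  move=> wn; have {}wn : size w != n by [].
  by rewrite conv_const ?hg ?mulr0// => x u; apply: hf.
case: w => [|x w] wn /=; first by rewrite hf// mul0r addr0.
rewrite hf// mul0r add0r; exact: (IHm _ (homog_shift x hf) hg).
Qed.

End Series.

Arguments homog {A} n f.

Section LetterSeries.
Variable d : nat.
Local Notation I := 'I_d.

Definition lin_series (v : 'cV[rat]_d) : series I :=
  fun w => if w is [:: x] then v x 0 else 0.

Fact lin_series_is_linear : linear lin_series.
Proof.
move=> c v v'; apply/funext => -[|x [|y w]] //=; last 2 first.
- by rewrite !mxE.
- by rewrite -[RHS]/(c * 0 + 0) mulr0 addr0.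
by rewrite -[RHS]/(c * 0 + 0) mulr0 addr0.
Qed.

HB.instance Definition _ := GRing.isLinear.Build rat 'cV[rat]_d (series I) *:%R
  lin_series lin_series_is_linear.

Lemma conv_linl v (f : series I) x w : conv (lin_series v) f (x :: w) = v x 0 * f w.
Proof. by rewrite /= mul0r add0r conv_const. Qed.

Lemma conv_linr v (f : series I) w x :
  conv f (lin_series v) (rcons w x) = f w * v x 0.
Proof.
elim: w f => [|y w IHw] f /=; first by rewrite mulr0 addr0.
by rewrite IHw; case: (w) => [|z u] /=; rewrite mulr0 add0r.
Qed.

End LetterSeries.

Lemma flie_ind (R : comNzRingType) (V : lmodType R) (P : FreeLie V -> Prop) :
  (forall v, P (flie_gen v)) -> P 0 -> (forall x y, P x -> P y -> P (x + y)) ->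
  (forall c x, P x -> P (c *: x)) -> (forall x y, P x -> P y -> P (lie x y)) ->
  forall x, P x.
Proof.
move=> Pg P0 PD PZ PB; elim/quotW => t.
elim: t => [v||s IHs t IHt|c t IHt|s IHs t IHt].
- exact: Pg.
- exact: P0.
- by rewrite flie_pi_add; apply: PD.
- by rewrite flie_pi_scale; apply: PZ.
- by rewrite flie_pi_br; apply: PB.
Qed.

Section LieLin.
Variables (R : comNzRingType) (L : lieAlgType R).
Implicit Types x y z : L.

Lemma lieDl x y z : lie (x + y) z = lie x z + lie y z.
Proof. by have := lie_linearl 1 x y z; rewrite !scale1r. Qed.
Lemma lieDr x y z : lie x (y + z) = lie x y + lie x z.
Proof. by have := lie_linearr 1 x y z; rewrite !scale1r. Qed.
Lemma lie0x x : lie 0 x = 0.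
Proof. by apply: (@addrI _ (lie 0 x)); rewrite -lieDl !addr0. Qed.
Lemma liex0 x : lie x 0 = 0.
Proof. by apply: (@addrI _ (lie x 0)); rewrite -lieDr !addr0. Qed.
Lemma lieZl c x y : lie (c *: x) y = c *: lie x y.
Proof. by have := lie_linearl c x 0 y; rewrite lie0x !addr0. Qed.
Lemma lieZr c x y : lie x (c *: y) = c *: lie x y.
Proof. by have := lie_linearr c x y 0; rewrite liex0 !addr0. Qed.
Lemma lieNr x y : lie x (- y) = - lie x y.
Proof. by rewrite -!scaleN1r lieZr. Qed.
Lemma lieC x y : lie x y = - lie y x.
Proof.
apply/eqP; rewrite -addr_eq0; apply/eqP.
by have := liexx (x + y); rewrite lieDl !lieDr !liexx add0r addr0.
Qed.
Lemma lie_leibniz x y z : lie (lie x y) z = lie x (lie y z) - lie y (lie x z).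
Proof.
have /eqP := lie_jacobi x y z; rewrite addr_eq0 => /eqP E.
by rewrite [LHS]lieC -E [lie z x]lieC lieNr.
Qed.
Lemma lie_suml (J : Type) (r : seq J) (F : J -> L) y :
  lie (\sum_(j <- r) F j) y = \sum_(j <- r) lie (F j) y.
Proof.
by elim: r => [|j r IHr]; rewrite ?big_nil ?lie0x// !big_cons lieDl IHr.
Qed.
End LieLin.

Section FreeLieDegree.
Variables (R : comNzRingType) (V : lmodType R).

Lemma flie_deg_eq0 (x : FreeLie V) : flie_deg 0 x -> x = 0.
Proof.
move En: 0%N => n dx.
elim: dx En => [v|n' _//|n' {}x y _ IHx _ IHy En|n' c {}x _ IHx En|m n' {}x y _ IHx _ IHy En] //.
- by rewrite IHx ?IHy ?addr0.
- by rewrite IHx ?scaler0.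
- by rewrite IHx ?lie0x//; lia.
Qed.

Lemma flie_deg_sum n (J : finType) (F : J -> FreeLie V) :
  (forall j, flie_deg n (F j)) -> flie_deg n (\sum_j F j).
Proof.
by move=> dF; elim/big_ind: _ => *; [exact: flie_deg0|exact: flie_degD|].
Qed.

End FreeLieDegree.

(** * The Dynkin map on the free Lie algebra *)

Section Dynkin.
Variable d : nat.
Local Notation I := 'I_d.
Local Notation FLd := (FreeLie 'cV[rat]_d : lieAlgType rat).
Local Notation gen i := (flie_gen (delta_mx i 0 : 'cV[rat]_d) : FLd).
Implicit Types f g : series I.

Definition emb : FLd -> series I := flie_lift (lin_series (d := d)).

Lemma emb_gen v : emb (flie_gen v) = lin_series v.
Proof. exact: flie_lift_gen. Qed.
Lemma emb_lie x y : emb (lie x y) = lie (emb x) (emb y).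
Proof. exact: flie_lift_lie. Qed.
Lemma embD x y : emb (x + y) = emb x + emb y.
Proof. exact: linearD. Qed.
Lemma embZ c x : emb (c *: x) = c *: emb x.
Proof. exact: linearZ. Qed.
Lemma emb0 : emb 0 = 0.
Proof. exact: linear0. Qed.

Lemma emb_deg n x : flie_deg n x -> homog n (emb x).
Proof.
elim=> {n x} [v|n|n x y _ hx _ hy|n c x _ hx|m n x y _ hx _ hy] w wn.
- by rewrite emb_gen; case: w wn => [|a [|b w]].
- by rewrite emb0.
- by rewrite embD -[LHS]/(emb x w + emb y w) hx ?hy ?addr0.
- by rewrite embZ -[LHS]/(c * emb x w) hx ?mulr0.
- rewrite emb_lie -[LHS]/(conv (emb x) (emb y) w - conv (emb y) (emb x) w).
  rewrite (homog_conv hx hy wn) (homog_conv hy hx); first by rewrite subrr.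
  by rewrite addnC.
Qed.

(** The homogeneous part of degree [n] of the algebra morphism from words to endomorphisms that
    extends ad on the letters. *)
Fixpoint Ad (n : nat) f (y : FLd) : FLd :=
  if n is n'.+1 then \sum_i lie (gen i) (Ad n' (shift i f) y)
  else f [::] *: y.

(* The Dynkin map x_1 ... x_n |-> [x_1, [x_2, ... [x_(n-1), x_n]]] *)
Fixpoint Dyn (n : nat) f : FLd :=
  match n with
  | 0 => 0
  | 1 => \sum_i f [:: i] *: gen i
  | n'.+1 => \sum_i lie (gen i) (Dyn n' (shift i f))
  end.

Lemma DynSS n f : Dyn n.+2 f = \sum_i lie (gen i) (Dyn n.+1 (shift i f)).
Proof. by []. Qed.

Lemma AdPf n c f g y : Ad n (c *: f + g) y = c *: Ad n f y + Ad n g y.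
Proof.
elim: n f g => [|n IHn] f g /=.
  by rewrite -[(c *: f + g) [::]]/(c * f [::] + g [::]) scalerDl scalerA.
rewrite scaler_sumr -big_split /=; apply: eq_bigr => i _.
by rewrite shiftP IHn lie_linearr.
Qed.

Lemma DynP n c f g : Dyn n (c *: f + g) = c *: Dyn n f + Dyn n g.
Proof.
elim: n f g => [|[|n] IHn] f g; first by rewrite /= scaler0 addr0.
  rewrite /= scaler_sumr -big_split /=; apply: eq_bigr => i _.
  by rewrite -[(c *: f + g) [:: i]]/(c * f [:: i] + g [:: i]) scalerDl scalerA.
rewrite !DynSS scaler_sumr -big_split.
by apply: eq_bigr => i _; rewrite shiftP IHn lie_linearr.
Qed.

Lemma shift_conv0 i f g : f [::] = 0 -> shift i (conv f g) = conv (shift i f) g.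
Proof. by move=> f0; rewrite shift_conv f0 scale0r add0r. Qed.

Lemma conv0_const f g : homog 0 f -> conv f g = f [::] *: g.
Proof.
move=> f0; apply/funext => w; rewrite conv_const// => x u; exact: f0.
Qed.

Lemma Ad_conv m n f g y : homog m f -> homog n g ->
  Ad (m + n)%N (conv f g) y = Ad m f (Ad n g y).
Proof.
elim: m f => [|m IHm] f hf hg.
  rewrite add0n conv0_const//= -[f [::] *: g]addr0 AdPf.
  suff -> : Ad n 0 y = 0 by rewrite addr0.
  by have := AdPf n (-1) 0 0 y; rewrite scaler0 addr0 scaleN1r addNr.
rewrite addSn /=; apply: eq_bigr => i _.
by rewrite shift_conv0 ?hf// IHm//; apply: homog_shift.
Qed.

Lemma Dyn_conv m n f g : homog m f -> homog n.+1 g ->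
  Dyn (m + n.+1)%N (conv f g) = Ad m f (Dyn n.+1 g).
Proof.
elim: m f => [|m IHm] f hf hg.
  rewrite add0n conv0_const// -[f [::] *: g]addr0 DynP.
  suff -> : Dyn n.+1 0 = 0 by rewrite addr0.
  by have := DynP n.+1 (-1) 0 0; rewrite scaler0 addr0 scaleN1r addNr.
rewrite addSn addnS DynSS [RHS]/=; apply: eq_bigr => i _.
rewrite shift_conv0 ?hf// -addnS IHm//; exact: homog_shift.
Qed.

Lemma gen_expand (v : 'cV[rat]_d) :
  (flie_gen v : FLd) = \sum_i v i 0 *: gen i.
Proof.
transitivity (flie_gen (\sum_i v i 0 *: (delta_mx i 0 : 'cV[rat]_d)) : FLd).
  congr flie_gen; rewrite [LHS]matrix_sum_delta; apply: eq_bigr => i _.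
  by rewrite big_ord1.
by rewrite linear_sum; apply: eq_bigr => i _; rewrite linearZ.
Qed.

(** The extension of ad to words sends commutators to commutators ([Ad_conv]), and ad does the same
    with brackets by the Jacobi identity ([lie_leibniz]); they agree on generators. *)
Lemma Ad_emb n x y : flie_deg n x -> Ad n (emb x) y = lie x y.
Proof.
move=> dx; elim: dx y => {n x} [v|n|n x x' dx IHx _ IHx'|n c x _ IHx|
  m n x x' dx IHx dx' IHx'] y.
- rewrite emb_gen gen_expand lie_suml; apply: eq_bigr => i _ /=.
  by rewrite /shift /= lieZr lieZl.
- rewrite emb0 lie0x.
  by have := AdPf n (-1) 0 0 y; rewrite scaler0 addr0 scaleN1r addNr.
- by rewrite embD lieDl -[emb x]scale1r AdPf scale1r IHx IHx'.
- rewrite embZ -[c *: _]addr0 AdPf IHx lieZl.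
  by have := AdPf n (-1) 0 0 y; rewrite scaler0 addr0 scaleN1r addNr => ->; rewrite addr0.
- rewrite emb_lie.
  have -> : lie (emb x) (emb x') = -1 *: (conv (emb x') (emb x) : series I) + (conv (emb x) (emb x') : series I).
    by rewrite scaleN1r addrC.
  rewrite AdPf (Ad_conv y (emb_deg dx) (emb_deg dx')).
  rewrite addnC (Ad_conv y (emb_deg dx') (emb_deg dx)).
  by rewrite !IHx !IHx' scaleN1r lie_leibniz addrC.
Qed.

(** The Dynkin-Specht-Wever identity. For Lie elements u, v, [Dyn_conv] and [Ad_emb] give Dyn(u v) =
    [u, Dyn v], so the two products in a commutator contribute the two degrees. *)
Lemma Dyn_emb n x : flie_deg n x -> Dyn n (emb x) = n%:R *: x.
Proof.
have D0 n' : Dyn n' 0 = 0.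
  by have := DynP n' (-1) 0 0; rewrite scaler0 addr0 scaleN1r addNr.
elim=> {n x} [v|n|n x x' dx IHx _ IHx'|n c x _ IHx|m n x x' dx IHx dx' IHx'].
- by rewrite emb_gen scale1r gen_expand.
- by rewrite emb0 scaler0 D0.
- by rewrite embD scalerDr -[emb x]scale1r DynP scale1r IHx IHx'.
- by rewrite embZ -[c *: _]addr0 DynP D0 addr0 IHx !scalerA mulrC.
case: m dx IHx => [|m] dx IHx.
  by rewrite (flie_deg_eq0 dx) lie0x emb0 scaler0 D0.
case: n dx' IHx' => [|n] dx' IHx'.
  by rewrite (flie_deg_eq0 dx') liex0 emb0 scaler0 D0.
have -> : emb (lie x x') = -1 *: (conv (emb x') (emb x) : series I) + (conv (emb x) (emb x') : series I).
  by rewrite emb_lie scaleN1r addrC.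
rewrite DynP (Dyn_conv (emb_deg dx) (emb_deg dx')).
rewrite addnC (Dyn_conv (emb_deg dx') (emb_deg dx)).
rewrite IHx IHx' !Ad_emb// !lieZr scaleN1r [lie x' x]lieC scalerN opprK.
by rewrite -scalerDl -natrD addnC.
Qed.

(** In characteristic 0 the Dynkin map is a left inverse up to the scalar [n], so no basis of the
    free Lie algebra is required. *)
Lemma emb_inj n x : (0 < n)%N -> flie_deg n x -> emb x = 0 -> x = 0.
Proof.
move=> n_gt0 dx ex; have := Dyn_emb dx; rewrite ex.
have -> : Dyn n 0 = 0.
  by have := DynP n (-1) 0 0; rewrite scaler0 addr0 scaleN1r addNr.
by move/esym/eqP; rewrite scaler_eq0 pnatr_eq0 => /orP[/eqP n0|/eqP//]; lia.
Qed.

Lemma Dyn_deg n f : flie_deg n (Dyn n f).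
Proof.
elim: n f => [|[|n] IHn] f; first exact: flie_deg0.
  by apply: flie_deg_sum => i; apply: flie_degZ; apply: flie_deg_gen.
rewrite DynSS; apply: flie_deg_sum => i; apply: (@flie_deg_br _ _ 1); [exact: flie_deg_gen|exact: IHn].
Qed.

Lemma eq_Dyn n f g : (forall w, size w = n -> f w = g w) -> Dyn n f = Dyn n g.
Proof.
elim: n f g => [|[|n] IHn] f g fg //.
  by apply: eq_bigr => i _; rewrite fg.
rewrite !DynSS; apply: eq_bigr => i _.
by rewrite (IHn _ (shift i g))// => w wn; apply: fg; rewrite /= wn.
Qed.

End Dynkin.

(** * The Dynkin operator as a product of rotations of places *)

Section DynkinOperator.
Variable T : Type.
Implicit Types (rot : nat -> T -> T) (s : rat).

(* With rot r the rotation of the places r, r + 1, ... of a word of length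
   n + r + 1, this is (1 - s^n rot_r) (1 - s^(n-1) rot_(r+1)) ... (1 - s rot_(n+r-1)):
   for s = 1 the Dynkin operator on the last n + 1 places, for s = -1 its
   analogue for odd letters. *)
Fixpoint dyn rot s (n r : nat) (f : T -> rat) (w : T) : rat :=
  if n is n'.+1 then
    dyn rot s n' r.+1 f w - s ^+ n * dyn rot s n' r.+1 f (rot r w)
  else f w.

Lemma dynP rot s n r (c : rat) (f f' : T -> rat) w :
  dyn rot s n r (fun v => c * f v + f' v) w
  = c * dyn rot s n r f w + dyn rot s n r f' w.
Proof. by elim: n r w => [|n IHn] r w //=; rewrite !IHn; ring. Qed.

Lemma eq_dyn rot s n r f f' w : f =1 f' -> dyn rot s n r f w = dyn rot s n r f' w.
Proof. by move=> ff'; elim: n r w => [|n IHn] r w //=; rewrite !IHn. Qed.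

End DynkinOperator.

Lemma dyn_val (T T' : Type) (v : T -> T') rot rot' s n r f w :
  (forall i x, v (rot i x) = rot' i (v x)) ->
  dyn rot s n r (f \o v) w = dyn rot' s n r f (v w).
Proof. by move=> vr; elim: n r w => [|n IHn] r w //=; rewrite !IHn vr. Qed.

(** The last letter moves to the place [r]. Thus evaluating x u at [rt 0 w] gives the value of u x
    at [w]. *)
Definition rt (A : Type) (r : nat) (w : seq A) := take r w ++ rotr 1 (drop r w).

Lemma size_rt A r (w : seq A) : size (rt r w) = size w.
Proof. by rewrite size_cat size_rotr -size_cat cat_take_drop. Qed.

Lemma rtS A r x (w : seq A) : rt r.+1 (x :: w) = x :: rt r w.
Proof. by []. Qed.

Lemma dyn_shift A s n r x (f : series A) w :
  dyn (@rt A) s n r.+1 f (x :: w) = dyn (@rt A) s n r (shift x f) w.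
Proof. by elim: n r w => [|n IHn] r w //=; rewrite -!IHn rtS. Qed.

Lemma rt_tupleP A r N (w : N.-tuple A) : size (rt r w) == N.
Proof. by rewrite size_rt size_tuple. Qed.
Definition rott A N r (w : N.-tuple A) : N.-tuple A := Tuple (rt_tupleP r w).

Section EmbDynkin.
Variable d : nat.
Local Notation I := 'I_d.
Local Notation FLd := (FreeLie 'cV[rat]_d : lieAlgType rat).
Local Notation gen i := (flie_gen (delta_mx i 0 : 'cV[rat]_d) : FLd).

Definition consF (u : I -> series I) : series I :=
  fun w => if w is x :: w' then u x w' else 0.

Lemma lin_delta (i x : I) : (delta_mx i 0 : 'cV[rat]_d) x 0 = (i == x)%:R.
Proof. by rewrite mxE eqxx andbT eq_sym. Qed.

(** In x u - u x the first term reads off the first letter of [w] and the second the last one. The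
    kernel of the bracket thus becomes the space of rotation-invariant tensors. *)
Lemma emb_bracket (u : I -> FLd) w : (0 < size w)%N ->
  emb (\sum_i lie (gen i) (u i)) w
  = consF (fun i => emb (u i)) w - consF (fun i => emb (u i)) (rt 0 w).
Proof.
move=> w0; have -> : emb (\sum_i lie (gen i) (u i)) w =
    \sum_i (conv (lin_series (delta_mx i 0)) (emb (u i)) w
      - conv (emb (u i)) (lin_series (delta_mx i 0)) w).
  rewrite (_ : emb _ = \sum_i emb (lie (gen i) (u i))).
    by rewrite fct_sumE; apply: eq_bigr => i _; rewrite emb_lie emb_gen.
  by rewrite /emb linear_sum.
rewrite sumrB; congr (_ - _).
  case: w w0 => [//|x w] _.
  under eq_bigr do rewrite conv_linl lin_delta.
  by rewrite (bigD1 x)//= eqxx mul1r big1 ?addr0// => i /negPf ->; rewrite mul0r.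
case/lastP: w w0 => [//|w x] _.
under eq_bigr do rewrite conv_linr lin_delta.
rewrite (bigD1 x)//= eqxx mulr1 big1 ?addr0; last first.
  by move=> i /negPf ->; rewrite mulr0.
by rewrite /rt take0 drop0 rotr1_rcons.
Qed.

Lemma emb_Dyn n (f : series I) w : size w = n.+1 ->
  emb (Dyn n.+1 f) w = dyn (@rt I) 1 n 0 f w.
Proof.
elim: n f w => [|n IHn] f w wn.
  case: w wn => [|x [|y w]]//= _.
  rewrite (_ : emb _ = \sum_i f [:: i] *: emb (gen i)); last first.
    by rewrite /emb linear_sum; apply: eq_bigr => i _; rewrite linearZ.
  rewrite fct_sumE (bigD1 x)//= big1 ?addr0.
    by rewrite emb_gen -[LHS]/(f [:: x] * delta_mx x 0 x 0) lin_delta eqxx mulr1.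
  move=> i /negPf ix; rewrite emb_gen.
  by rewrite -[LHS]/(f [:: i] * delta_mx i 0 x 0) lin_delta ix mulr0.
have IH' v : size v = n.+2 ->
    consF (fun i => emb (Dyn n.+1 (shift i f))) v = dyn (@rt I) 1 n 1 f v.
  by case: v => [//|x v] [vn] /=; rewrite IHn// dyn_shift.
by rewrite DynSS emb_bracket ?wn// !IH' ?size_rt//= expr1n mul1r.
Qed.

End EmbDynkin.

(** * The symplectic action on words, and the passage to invariant tensors *)

Section SpAction.
Variable g : nat.
Local Notation I := 'I_(g + g).
Implicit Types (A : 'M[rat]_(g + g)) (f : series I).

Fixpoint actS A f (w : seq I) : rat :=
  if w is x :: w' then \sum_y A x y * actS A (shift y f) w' else f [::].

Lemma actSP A c f f' w : actS A (c *: f + f') w = c * actS A f w + actS A f' w.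
Proof.
elim: w f f' => [//|x w IHw] f f' /=.
rewrite mulr_sumr -big_split /=; apply: eq_bigr => y _.
by rewrite shiftP IHw; ring.
Qed.

Lemma actS_conv A f f' w :
  actS A (conv f f') w = conv (actS A f) (actS A f') w.
Proof.
elim: w f f' => [|x w IHw] f f' //=.
have -> : shift x (actS A f) = \sum_y A x y *: (actS A (shift y f) : series I).
  by apply/funext => v; rewrite fct_sumE.
have -> : conv (\sum_y A x y *: (actS A (shift y f) : series I)) (actS A f') w
    = \sum_y A x y * conv (actS A (shift y f)) (actS A f') w.
  elim: (index_enum _) => [|y r IHr]; last by rewrite !big_cons convPl IHr.
  by rewrite !big_nil; have := convPl (-1) 0 (0 : series I) (actS A f') w;
     rewrite scaler0 addr0 mulN1r addNr.
rewrite mulr_sumr -big_split /=; apply: eq_bigr => y _.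
by rewrite shift_conv actSP IHw; ring.
Qed.

Lemma actS0 A w : actS A 0 w = 0.
Proof. by have := actSP A (-1) 0 0 w; rewrite scaler0 addr0 mulN1r addNr. Qed.

Lemma emb_Sp_actL A (x : FL g) : emb (Sp_actL A x) = actS A (emb x).
Proof.
have actD u v : Sp_actL A (u + v) = Sp_actL A u + Sp_actL A v := linearD _ u v.
have actZ c u : Sp_actL A (c *: u) = c *: Sp_actL A u := linearZ_LR _ c u.
have act0 : Sp_actL A (0 : FL g) = 0 := linear0 _.
elim/flie_ind: x => [v||x y IHx IHy|c x IHx|x y IHx IHy].
- rewrite /Sp_actL flie_lift_gen !emb_gen; apply/funext => -[|x [|y w]] //=.
    by rewrite mxE.
  rewrite big1// => z _; rewrite big1 ?mulr0// => t _.
  by rewrite (_ : shift t _ = 0) ?actS0 ?mulr0//; apply/funext => -[].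
- by rewrite act0 !emb0; apply/funext => w; rewrite actS0.
- rewrite actD !embD IHx IHy; apply/funext => w.
  by rewrite -[emb x]scale1r actSP mul1r scale1r.
- rewrite actZ !embZ IHx; apply/funext => w.
  by rewrite -[c *: emb x]addr0 actSP actS0 addr0.
- rewrite /Sp_actL flie_lift_lie -/(Sp_actL A x) -/(Sp_actL A y) !emb_lie IHx IHy.
  apply/funext => w.
  have -> : lie (emb x) (emb y)
      = -1 *: (conv (emb y) (emb x) : series I) + (conv (emb x) (emb y) : series I).
    by rewrite scaleN1r addrC.
  by rewrite actSP !actS_conv mulN1r addrC.
Qed.

Lemma Sp_actL_deg A n (x : FL g) : flie_deg n x -> flie_deg n (Sp_actL A x).
Proof.
elim=> {n x} [v|n|n x y _ hx _ hy|n c x _ hx|m n x y _ hx _ hy].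
- by rewrite /Sp_actL flie_lift_gen; exact: flie_deg_gen.
- by rewrite [Sp_actL A 0]linear0; exact: flie_deg0.
- by rewrite [Sp_actL A _]linearD; exact: flie_degD.
- by rewrite [Sp_actL A _]linearZ; exact: flie_degZ.
- by rewrite /Sp_actL flie_lift_lie; exact: flie_deg_br.
Qed.

Definition actT (I' : finType) (A : I' -> I' -> rat) N (t : N.-tuple I' -> rat)
    (w : N.-tuple I') : rat :=
  \sum_(v : N.-tuple I') (\prod_(i < N) A (tnth w i) (tnth v i)) * t v.

End SpAction.

Lemma sum_cons_tuple (I : finType) N (F : N.+1.-tuple I -> rat) :
  \sum_v F v = \sum_x \sum_(v : N.-tuple I) F (cons_tuple x v).
Proof.
rewrite pair_big /= (reindex (fun p : I * N.-tuple I => cons_tuple p.1 p.2)) //=.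
exists (fun v : N.+1.-tuple I => (thead v, behead_tuple v)) => [[x v] _|v _] /=.
  by congr (_, _); apply: val_inj.
by case/tupleP: v => x v; apply: val_inj; rewrite /= theadE.
Qed.

Lemma actT_val (g N : nat) (A : 'M[rat]_(g + g)) (f : series 'I_(g + g))
    (w : N.-tuple 'I_(g + g)) :
  actT A (f \o val) w = actS A f w.
Proof.
elim: N f w => [|N IHN] f w.
  rewrite /actT (big_pred1 [tuple]) => [|v]; last by rewrite [v]tuple0; apply/esym/eqP.
  by rewrite big_ord0 mul1r (tuple0 w).
case/tupleP: w => x w; rewrite /actT sum_cons_tuple /=.
apply: eq_bigr => y _; rewrite -IHN /actT mulr_sumr; apply: eq_bigr => v _.
rewrite big_ord_recl !tnth0 -mulrA; congr (_ * (_ * _)).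
by apply: eq_bigr => i _; rewrite !tnthS.
Qed.

Lemma has_dim_transfer (F : fieldType) (V W : lmodType F) (P : V -> Prop)
    (Q : W -> Prop) (f : {linear W -> V}) (h : V -> W) n :
  (forall y, Q y -> P (f y)) -> (forall x, P x -> Q (h x)) ->
  (forall x, P x -> f (h x) = x) -> (forall y, Q y -> f y = 0 -> y = 0) ->
  has_dim Q n -> has_dim P n.
Proof.
move=> QP PQ hK f0 [b [bfree bQ]]; exists (f \o b); split=> [c|x].
  move=> cb0; apply: bfree; apply: f0; first by apply/bQ; exists c.
  by rewrite linear_sum -[RHS]cb0; apply: eq_bigr => i _; rewrite linearZ.
split=> [Px|[c ->]].
  have [c hc] := (bQ (h x)).1 (PQ _ Px); exists c.
  by rewrite -[LHS]hK// hc linear_sum; apply: eq_bigr => i _; rewrite linearZ.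
have -> : \sum_i c i *: (f \o b) i = f (\sum_i c i *: b i).
  by rewrite linear_sum; apply: eq_bigr => i _; rewrite linearZ.
by apply: QP; apply/bQ; exists c.
Qed.

Definition tensor (I : finType) N := {ffun N.-tuple I -> rat^o}.

Section Transfer.
Variables (g n : nat).
Local Notation I := 'I_(g + g).
Local Notation N := n.+2.
Implicit Types (u v : HtensorL g) (t : tensor I N).

(* For T = rott this is the image of h_(g,1)(n) in the tensor power n + 2. *)
Definition cyclie (T : nat -> N.-tuple I -> N.-tuple I) (t : N.-tuple I -> rat) :=
  (forall w, t (T 0%N w) = t w) /\
  (forall w, dyn T 1 n 1 t w = n.+1%:R * t w).

Definition Sp_inv (M : nat) (t : M.-tuple I -> rat) :=
  forall A, in_Sp A -> forall w, actT A t w = t w.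

Definition toT (u : HtensorL g) : tensor I N :=
  [ffun w => emb (u (thead w)) (behead w)].

(** Division by [n.+1] turns the Dynkin map into a left inverse of [emb]. The value 0 on words of
    another length is a default that [Dyn n.+1] never reads. *)
Definition ofT_fun (t : tensor I N) : HtensorL g :=
  [ffun l => n.+1%:R^-1 *: Dyn n.+1 (fun s => oapp t 0 (insub (l :: s)))].

Fact ofT_is_linear : linear ofT_fun.
Proof.
move=> c t t'; apply/ffunP => l; rewrite !ffunE scalerA mulrC -scalerA -scalerDr.
congr (_ *: _); rewrite -DynP; apply: eq_Dyn => w wn.
have wN : size (l :: w) == N by rewrite /= wn.
rewrite -[RHS]/(c * oapp t 0 (insub (l :: w)) + oapp t' 0 (insub (l :: w))).
by rewrite insubT/= !ffunE.
Qed.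
HB.instance Definition _ := GRing.isLinear.Build rat (tensor I N) (HtensorL g)
  *:%R ofT_fun ofT_is_linear.

Definition consT (u : HtensorL g) : series I :=
  consF (fun i => emb (u i)).

Lemma toTE u (w : N.-tuple I) : toT u w = consT u w.
Proof. by rewrite ffunE; case/tupleP: w => x w /=; rewrite theadE. Qed.

Lemma toT_val u : toT u =1 consT u \o val.
Proof. by move=> w; rewrite toTE. Qed.

Definition good (t : tensor I N) := cyclie (@rott I N) t /\ Sp_inv t.

Lemma dyn_consT u (w : N.-tuple I) : (forall i, flie_deg n.+1 (u i)) ->
  dyn (@rott I N) 1 n 1 (toT u) w = n.+1%:R * toT u w.
Proof.
move=> du; rewrite (eq_dyn _ _ _ _ _ (toT_val u)).
rewrite (dyn_val (rot' := @rt I))// toTE; case/tupleP: w => x w /=.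
rewrite dyn_shift (_ : shift x (consT u) = emb (u x))//.
by rewrite -emb_Dyn ?size_tuple// Dyn_emb// embZ.
Qed.

Lemma bracket_consT u (w : N.-tuple I) :
  emb (tensor_bracket u) w = toT u w - toT u (rott 0 w).
Proof. by rewrite emb_bracket ?size_tuple// !toTE. Qed.

Lemma bracket_deg u : (forall i, flie_deg n.+1 (u i)) ->
  flie_deg N (tensor_bracket u).
Proof.
move=> du; apply: flie_deg_sum => i.
by apply: (@flie_deg_br _ _ 1 n.+1); [exact: flie_deg_gen|].
Qed.

Lemma toT_Sp A u : toT (Sp_actHL A u) =1 actT A (toT u).
Proof.
move=> w; rewrite toTE.
have -> : actT A (toT u) w = actT A (consT u \o val) w.
  by apply: eq_bigr => v _; rewrite toTE.
rewrite actT_val; case/tupleP: w => x w /=.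
rewrite ffunE (_ : emb _ = \sum_j A x j *: emb (Sp_actL A (u j))); last first.
  by rewrite /emb linear_sum; apply: eq_bigr => j _; rewrite linearZ.
by rewrite fct_sumE; apply: eq_bigr => j _; rewrite emb_Sp_actL.
Qed.

Lemma toT_inj u v : (forall i, flie_deg n.+1 (u i)) ->
  (forall i, flie_deg n.+1 (v i)) -> toT u = toT v -> u = v.
Proof.
move=> du dv uv; apply/ffunP => i; apply/eqP; rewrite -subr_eq0; apply/eqP.
have dw : flie_deg n.+1 (u i - v i).
  by rewrite -[- v i]scaleN1r; apply: flie_degD => //; exact: flie_degZ.
apply: (emb_inj _ dw) => //; apply/funext => w.
have [/eqP wn|] := eqVneq (size w) n.+1; last by move/(emb_deg dw).
rewrite (_ : emb _ = emb (u i) - emb (v i)); last exact: linearB.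
have wN : size (i :: w) == N by rewrite /= eqSS.
have /ffunP/(_ (Tuple wN)) := uv; rewrite !toTE /= => E.
by rewrite -[LHS]/(emb (u i) w - emb (v i) w) E subrr.
Qed.

Lemma ofTK t : good t -> toT (ofT_fun t) = t.
Proof.
case=> -[_ tl] _; apply/ffunP => w; rewrite toTE.
case/tupleP: w => x w /=; rewrite ffunE embZ.
rewrite -[LHS]/(n.+1%:R^-1 * emb _ (tval w)) emb_Dyn ?size_tuple//.
set f := fun s => _.
rewrite (_ : f = shift x (fun s => oapp t 0 (insub s))) // -dyn_shift.
pose v := cons_tuple x w.
transitivity (n.+1%:R^-1 * dyn (@rt I) 1 n 1 (fun s => oapp t 0 (insub s)) (val v)).
  by [].
rewrite -(dyn_val (rot := @rott I N))//.
rewrite (@eq_dyn _ _ _ _ _ _ t); last by move=> v' /=; rewrite valK.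
by rewrite tl mulKf ?pnatr_eq0//; congr (t _); exact: val_inj.
Qed.

Lemma ofT_deg t i : flie_deg n.+1 (ofT_fun t i).
Proof. by rewrite ffunE; apply: flie_degZ; exact: Dyn_deg. Qed.

Lemma toT_good u : hg1_Sp n u -> good (toT u).
Proof.
case=> -[du bu] Au; split; first split.
- move=> w; apply/eqP; rewrite eq_sym -subr_eq0 -bracket_consT bu.
  by rewrite [emb 0]linear0.
- by move=> w; exact: dyn_consT.
- by move=> A /Au Au' w; rewrite -toT_Sp Au'.
Qed.

Lemma ofT_good t : good t -> hg1_Sp n (ofT_fun t).
Proof.
move=> gt; have tK := ofTK gt; case: gt => -[tc tl] ts.
have dt i := ofT_deg t i.
split; first split=> //.
  apply: (emb_inj _ (bracket_deg dt)) => //; apply/funext => w.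
  have [/eqP wN|] := eqVneq (size w) N; last by move/(emb_deg (bracket_deg dt)).
  by have /= -> := bracket_consT (ofT_fun t) (Tuple wN); rewrite tK tc subrr.
move=> A sA; apply: toT_inj => //.
  move=> i; rewrite ffunE; apply: flie_deg_sum => j; apply: flie_degZ.
  exact: Sp_actL_deg.
by rewrite tK; apply/ffunP => w; rewrite toT_Sp tK ts.
Qed.

Lemma has_dim_good dd : has_dim good dd -> has_dim (@hg1_Sp g n) dd.
Proof.
apply: (@has_dim_transfer _ _ _ _ _ ofT_fun toT).
- exact: ofT_good.
- exact: toT_good.
- move=> u hu; apply: toT_inj; [exact: ofT_deg|by case: hu => -[]|].
  by rewrite ofTK//; exact: toT_good.
- move=> t gt t0; rewrite -[t]ofTK// t0; apply/ffunP => w.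
  by rewrite !ffunE emb0.
Qed.

End Transfer.

(** * Permutations of places and the derivation action of matrices *)

Section PlaceOps.
Variable I : finType.

Definition permT N (p : 'S_N) (w : N.-tuple I) : N.-tuple I :=
  [tuple tnth w (p i) | i < N].

Definition upd N (w : N.-tuple I) (i : 'I_N) (m : I) : N.-tuple I :=
  [tuple if j == i then m else tnth w j | j < N].

Lemma tnth_permT N (p : 'S_N) w i : tnth (permT p w) i = tnth w (p i).
Proof. by rewrite tnth_mktuple. Qed.

Lemma tnth_upd N (w : N.-tuple I) i m j :
  tnth (upd w i m) j = if j == i then m else tnth w j.
Proof. by rewrite tnth_mktuple. Qed.

Lemma permTM N (p q : 'S_N) w : permT p (permT q w) = permT (p * q)%g w.
Proof. by apply: eq_from_tnth => i; rewrite !tnth_permT permM. Qed.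

Lemma permT1 N (w : N.-tuple I) : permT 1%g w = w.
Proof. by apply: eq_from_tnth => i; rewrite tnth_permT perm1. Qed.

Lemma permTK N (p : 'S_N) : cancel (@permT N p) (permT p^-1%g).
Proof. by move=> w; rewrite permTM mulVg permT1. Qed.

Lemma permTVK N (p : 'S_N) : cancel (@permT N p^-1%g) (permT p).
Proof. by move=> w; rewrite permTM mulgV permT1. Qed.

Lemma reindex_permT N (p : 'S_N) (F : N.-tuple I -> rat) :
  \sum_v F v = \sum_v F (permT p v).
Proof.
by rewrite (reindex_inj (can_inj (@permTK _ p))).
Qed.

Lemma actT_permT (A : I -> I -> rat) N (p : 'S_N) t w :
  actT A (t \o permT p) w = actT A t (permT p w).
Proof.
rewrite /actT [RHS](reindex_permT p); apply: eq_bigr => v _ /=; congr (_ * _).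
rewrite (reindex_inj (@perm_inj _ p)) /=.
by apply: eq_bigr => i _; rewrite !tnth_permT.
Qed.

Lemma permT_upd N (p : 'S_N) w i m :
  permT p (upd w i m) = upd (permT p w) (p^-1%g i) m.
Proof.
apply: eq_from_tnth => j; rewrite tnth_permT !tnth_upd tnth_permT.
by rewrite -(inj_eq (@perm_inj _ p) j) permKV.
Qed.

Lemma upd_id N (w : N.-tuple I) i : upd w i (tnth w i) = w.
Proof.
by apply: eq_from_tnth => j; rewrite tnth_upd; case: eqP => [->|].
Qed.

Lemma upd_upd N (w : N.-tuple I) i m m' : upd (upd w i m) i m' = upd w i m'.
Proof. by apply: eq_from_tnth => j; rewrite !tnth_upd; case: (j == i). Qed.

(* The action of the elementary matrix E_lm as a derivation of the tensor power. *)
Definition Eop N (l m : I) (t : N.-tuple I -> rat) (w : N.-tuple I) : rat :=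
  \sum_(i | tnth w i == l) t (upd w i m).

Lemma Eop_permT N (p : 'S_N) l m t w :
  Eop l m (t \o permT p) w = Eop l m t (permT p w).
Proof.
rewrite /Eop (reindex_inj (@perm_inj _ p)) /=.
apply: eq_big => [i|i _]; first by rewrite tnth_permT.
by rewrite permT_upd permK.
Qed.

Lemma EopP N l m (c : rat) t t' (w : N.-tuple I) :
  Eop l m (fun v => c * t v + t' v) w = c * Eop l m t w + Eop l m t' w.
Proof. by rewrite /Eop mulr_sumr -big_split. Qed.

Lemma Eop_diag N l (t : N.-tuple I -> rat) w :
  Eop l l t w = (count_mem l w)%:R * t w.
Proof.
rewrite /Eop (eq_bigr (fun=> t w)) => [|i /eqP wi]; last by rewrite -wi upd_id.
rewrite sumr_const -sum1_count big_tuple sum1_card mulr_natl.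
by congr (_ *+ _); apply: eq_card => i.
Qed.

End PlaceOps.

Lemma deriv_bigprod (R : comNzRingType) (J : finType) (F : J -> {poly R}) :
  (\prod_j F j)^`() = \sum_j (F j)^`() * \prod_(i | i != j) F i.
Proof.
pose P (r : seq J) := uniq r -> (\prod_(j <- r) F j)^`()
   = \sum_(j <- r) (F j)^`() * \prod_(i <- r | i != j) F i.
suff H r : P r by apply: H; exact: index_enum_uniq.
elim: r => [|j r IHr] /=; first by rewrite /P !big_nil derivC.
move=> /= /andP[jr ur]; rewrite big_cons derivM IHr// [in RHS]big_cons.
rewrite [in X in _ = X + _]big_cons eqxx /=; congr (_ * _ + _).
  by rewrite [RHS]big_seq_cond [LHS]big_seq; apply: eq_bigl => i;
     case ir: (i \in r) => //=; apply/esym; apply: contraNneq jr => <-.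
rewrite mulr_sumr !big_seq; apply: eq_bigr => i ir.
have ji : j != i by apply: contraNneq jr => ->.
by rewrite big_cons ji mulrCA.
Qed.

(** * Elements of Sp and infinitesimal invariance *)

Section SpLie.
Variable g : nat.
Local Notation I := 'I_(g + g).
Implicit Types (l m : I).

Definition star l : I :=
  match fintype.split l with inl i => rshift g i | inr i => lshift g i end.
Definition sg l : rat := if fintype.split l is inl _ then 1 else -1.

Lemma starK : involutive star.
Proof.
by move=> l; rewrite -[in RHS](fintype.splitK l) /star; case: (fintype.split l) => i /=;
  rewrite (fintype.unsplitK (inl _)) || rewrite (fintype.unsplitK (inr _)).
Qed.

Lemma star_inj : injective star. Proof. exact: inv_inj starK. Qed.

Lemma star_neq l : star l != l.
Proof.
rewrite -{2}(fintype.splitK l) /star; case: (fintype.split l) => i /=.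
  by rewrite eq_rlshift.
by rewrite eq_lrshift.
Qed.

Lemma sg_star l : sg (star l) = - sg l.
Proof.
rewrite /sg /star; case: (fintype.split l) => i.
  by rewrite (fintype.unsplitK (inr i)).
by rewrite (fintype.unsplitK (inl i)) opprK.
Qed.

Lemma sg2 l : sg l * sg l = 1.
Proof. by rewrite /sg; case: (fintype.split l); rewrite ?mulr1// mulrNN mulr1. Qed.

Lemma sg_neq0 l : sg l != 0.
Proof. by apply/eqP => s0; have := sg2 l; rewrite s0 mul0r => /esym/eqP; rewrite oner_eq0. Qed.

Lemma JE l m : Jmx g l m = sg l * (m == star l)%:R.
Proof.
rewrite -(fintype.splitK l) -(fintype.splitK m) /star /sg.
case: (fintype.split l) => i; case: (fintype.split m) => j /=.
- by rewrite block_mxEul (fintype.unsplitK (inl i)) eq_lrshift mxE mulr0.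
- by rewrite block_mxEur (fintype.unsplitK (inl i)) eq_rshift mxE mul1r eq_sym.
- by rewrite block_mxEdl (fintype.unsplitK (inr i)) eq_lshift !mxE mulN1r eq_sym.
- by rewrite block_mxEdr (fintype.unsplitK (inr i)) eq_rlshift mxE mulr0.
Qed.

Lemma sum_J l (F : I -> rat) : \sum_m Jmx g l m * F m = sg l * F (star l).
Proof.
rewrite (bigD1 (star l))//= big1 ?addr0 => [|m /negPf ml]; last first.
  by rewrite JE ml mulr0 mul0r.
by rewrite JE eqxx mulr1.
Qed.

Lemma J_sym l m : Jmx g m l = - Jmx g l m.
Proof.
rewrite !JE; have -> : (l == star m) = (m == star l).
  by apply/eqP/eqP => ->; rewrite starK.
by case: eqP => [->|_]; rewrite ?mulr0 ?oppr0// sg_star mulNr.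
Qed.

Lemma JJ : Jmx g *m Jmx g = - 1%:M.
Proof.
apply/matrixP => l m; rewrite !mxE sum_J JE starK sg_star mulrA mulrN sg2.
by rewrite mulN1r eq_sym.
Qed.

Lemma in_SpE A : in_Sp A <->
  forall l m, \sum_p \sum_q A p l * Jmx g p q * A q m = Jmx g l m.
Proof.
have E l m : (A^T *m Jmx g *m A) l m = \sum_p \sum_q A p l * Jmx g p q * A q m.
  rewrite mxE exchange_big; apply: eq_bigr => q _; rewrite mxE mulr_suml.
  by apply: eq_bigr => p _; rewrite mxE.
split=> [sA l m|sA]; first by rewrite -E sA.
by apply/matrixP => l m; rewrite E.
Qed.

Lemma in_Sp_tr A : in_Sp A -> A *m Jmx g *m A^T = Jmx g.
Proof.
move=> sA.
have h : (- (Jmx g *m A^T *m Jmx g)) *m A = 1%:M.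
  by rewrite mulNmx -!mulmxA (mulmxA A^T) sA JJ opprK.
have := congr1 (fun X => X *m Jmx g) (mulmx1C h).
rewrite mulmxN mulNmx -!mulmxA JJ mul1mx !mulmxN mulmx1 opprK.
by rewrite !mulmxA.
Qed.

Lemma in_Sp_trE A l m : in_Sp A ->
  \sum_p \sum_q Jmx g p q * A l p * A m q = Jmx g l m.
Proof.
move=> /in_Sp_tr/matrixP/(_ l m); rewrite mxE => <-.
rewrite exchange_big; apply: eq_bigr => q _; rewrite !mxE mulr_suml.
by apply: eq_bigr => p _; rewrite [A l p * _]mulrC.
Qed.

Section MonomialElements.
Variables (pi : I -> I) (eps : I -> rat).
Hypothesis pi_inj : injective pi.
Hypothesis piJ : forall l m, eps l * eps m * Jmx g (pi l) (pi m) = Jmx g l m.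

(** For a monomial matrix the sum over words in [actT] has a single term. This covers the torus, the
    permutations of the symplectic pairs and the signed exchange of the two letters of a pair. *)
Lemma Sp_inv_mono N (t : N.-tuple I -> rat) : Sp_inv t ->
  forall v, (\prod_(i < N) eps (tnth v i)) * t v = t (map_tuple pi v).
Proof.
pose A : 'M[rat]_(g + g) := \matrix_(p, q) (eps q * (p == pi q)%:R).
have AE p q : A p q = eps q * (p == pi q)%:R by rewrite mxE.
have sA : in_Sp A.
  apply/in_SpE => l m; rewrite (bigD1 (pi l))//= (bigD1 (pi m))//= !AE !eqxx.
  rewrite !mulr1 big1 => [|q /negPf qm]; last by rewrite !AE qm !mulr0.
  rewrite addr0 big1 => [|p /negPf pl]; last first.
    by rewrite big1// => q _; rewrite !AE pl mulr0 !mul0r.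
  by rewrite addr0 -[RHS]piJ; ring.
move=> /(_ A sA) tA v; rewrite -[RHS]tA /actT [RHS](bigD1 v)//= [X in _ = _ + X]big1 ?addr0 => [|u uv].
  by congr (_ * _); apply: eq_bigr => i _; rewrite mxE tnth_map eqxx mulr1.
have [i ui] : exists i, tnth u i != tnth v i.
  apply/existsP; apply: contraNT uv; rewrite negb_exists => /forallP uv.
  by apply/eqP/eq_from_tnth => i; apply/eqP; rewrite -[_ == _]negbK.
rewrite (bigD1 i)//= mxE tnth_map (inj_eq pi_inj) eq_sym (negPf ui).
by rewrite mulr0 !mul0r.
Qed.

End MonomialElements.

Lemma Sp_inv_weight N (t : N.-tuple I -> rat) w l : Sp_inv t -> t w != 0 ->
  count_mem l w = count_mem (star l) w.
Proof.
move=> ti tw.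
(* A torus element: 2 is not a root of unity, so invariance forces the two exponents to agree. *)
pose eps m : rat := if m == l then 2 else if m == star l then 2^-1 else 1.
have h p q : eps p * eps q * Jmx g p q = Jmx g p q.
  rewrite JE; case: eqP => [->|_]; last by rewrite !mulr0.
  rewrite /eps (inj_eq star_inj); case: (eqVneq p l) => [->|pl].
    by rewrite (negPf (star_neq l)) divff ?mul1r// pnatr_eq0.
  case: (eqVneq p (star l)) => [->|pl']; first by rewrite starK eqxx mulVf ?mul1r// pnatr_eq0.
  have -> : (star p == l) = false.
    by apply/negP => /eqP e; rewrite -e starK eqxx in pl'.
  by rewrite !mul1r.
have := Sp_inv_mono (pi := id) (@inj_id _) h ti w.
have -> : map_tuple id w = w by apply: eq_from_tnth => i; rewrite tnth_map.
move=> /(congr1 (fun x => x / t w)); rewrite -mulrA divff// mulr1.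
have -> : \prod_(i < N) eps (tnth w i) = 2 ^+ count_mem l w * 2^-1 ^+ count_mem (star l) w.
  rewrite -(big_tuple _ _ w xpredT eps).
  elim: (tval w) => [|x s IHs]; first by rewrite big_nil mulr1.
  rewrite big_cons IHs /= /eps; case: (eqVneq x l) => [->|xl].
    by rewrite eq_sym (negPf (star_neq l)) add0n exprS mulrA.
  by case: eqP => _; rewrite /= ?mul1r// exprS; ring.
rewrite exprVn => e2.
have : 2 ^+ count_mem l w = 2 ^+ count_mem (star l) w :> rat.
  have nz : 2 ^+ count_mem (star l) w != 0 :> rat by rewrite expf_neq0// pnatr_eq0.
  by apply: (mulIf (invr_neq0 nz)); rewrite e2 divff.
by move/eqP; rewrite -!natrX eqr_nat eqn_exp2l// => /eqP.
Qed.

Lemma in_Sp_nilp (X : 'M[rat]_(g + g)) (s : rat) : X *m X = 0 ->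
  X^T *m Jmx g + Jmx g *m X = 0 -> in_Sp (1%:M + s *: X).
Proof.
move=> X2 XJ; rewrite /in_Sp.
have -> : (1%:M + s *: X)^T = 1%:M + s *: X^T.
  by apply/matrixP => i j; rewrite !mxE eq_sym.
rewrite mulmxDl mul1mx.
rewrite mulmxDr mulmx1 mulmxDl -scalemxAl -!scalemxAr -scalemxAl.
have -> : X^T *m Jmx g = - (Jmx g *m X) by apply/eqP; rewrite -addr_eq0 XJ.
rewrite mulNmx -mulmxA X2 mulmx0 oppr0 !scaler0 addr0 scalerN.
by rewrite -addrA addNr addr0.
Qed.

Lemma Sp_inv_nilp N (t : N.-tuple I -> rat) (X : 'M[rat]_(g + g)) w :
  Sp_inv t -> X *m X = 0 -> X^T *m Jmx g + Jmx g *m X = 0 ->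
  \sum_i \sum_m X (tnth w i) m * t (upd w i m) = 0.
Proof.
move=> ti X2 XJ.
pose B i (v : N.-tuple I) : {poly rat} :=
  (tnth w i == tnth v i)%:R%:P + X (tnth w i) (tnth v i) *: 'X.
pose P : {poly rat} := \sum_(v : N.-tuple I) t v *: \prod_i B i v.
have Ps s : P.[s] = t w.
  rewrite -(ti _ (in_Sp_nilp s X2 XJ)) /actT horner_sum; apply: eq_bigr => v _.
  rewrite hornerZ mulrC horner_prod; congr (_ * _); apply: eq_bigr => i _.
  by rewrite hornerD hornerZ hornerX hornerC !mxE [s * _]mulrC.
(* The difference vanishes at as many integers as it has coefficients. *)
have PC : P = (t w)%:P.
  apply/eqP; rewrite -subr_eq0; apply/eqP.
  apply: (@roots_geq_poly_eq0 _ _ (map (fun n : nat => n%:R) (iota 0 (size (P - (t w)%:P))))).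
  - by apply/allP => s _; rewrite rootE hornerD hornerN hornerC Ps subrr.
  - rewrite map_inj_uniq ?iota_uniq//.
    by move=> a b /eqP; rewrite eqr_nat => /eqP.
  - by rewrite size_map size_iota.
have : (P^`()).[0] = 0 by rewrite PC derivC horner0.
rewrite /P linear_sum horner_sum /= => P0; rewrite -[RHS]P0.
under [RHS]eq_bigr => v _.
  rewrite derivZ hornerZ deriv_bigprod horner_sum mulr_sumr; over.
rewrite [RHS]exchange_big /=; apply: eq_bigr => i _.
(* At 0 each undifferentiated factor is 1 or 0 according as [v] agrees with [w] at its place; only
   the words [upd w i m] survive. *)
rewrite [RHS](partition_big (fun v : N.-tuple I => tnth v i) predT)//=.
apply: eq_bigr => m _; rewrite [RHS](bigD1 (upd w i m)) ?tnth_upd ?eqxx//=.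
rewrite [X in _ = _ + X]big1 ?addr0 => [|v /andP[/eqP vi vw]].
  rewrite hornerM /B tnth_upd eqxx horner_prod big1 => [|j /negPf ji].
    by rewrite derivD derivC derivZ derivX add0r alg_polyC hornerC mulr1 mulrC.
  by rewrite tnth_upd ji eqxx hornerD hornerZ hornerX mulr0 addr0 hornerC.
have [j vj] : exists j, tnth v j != tnth (upd w i m) j.
  apply/existsP; apply: contraNT vw; rewrite negb_exists => /forallP h.
  by apply/eqP/eq_from_tnth => j; apply/eqP; rewrite -[_ == _]negbK.
move: vj; rewrite tnth_upd; case: (eqVneq j i) => [->|ji] vj.
  by rewrite vi eqxx in vj.
rewrite hornerM horner_prod (bigD1 j)//= /B hornerD hornerZ hornerX mulr0 addr0.
by rewrite hornerC [tnth w j == _]eq_sym (negPf vj) !(mul0r, mulr0).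
Qed.

(* X = E_{l,m} - sg l sg m E_{star m,star l} is in sp, and X ^+ 2 = 0 for l != m, so
   1 + c X is in Sp for all c and the invariance is a polynomial identity in c. *)
Lemma Sp_inv_Eop N (t : N.-tuple I -> rat) l m w : Sp_inv t ->
  Eop l m t w = sg l * sg m * Eop (star m) (star l) t w.
Proof.
move=> ti; have [<-|lm] := eqVneq l m.
  rewrite sg2 mul1r !Eop_diag; have [->|tw] := eqVneq (t w) 0; first by rewrite !mulr0.
  by rewrite (Sp_inv_weight l ti tw).
pose X : 'M[rat]_(g + g) := delta_mx l m - (sg l * sg m) *: delta_mx (star m) (star l).
have dd (a b c e : I) : b != c -> delta_mx a b *m delta_mx c e = 0 :> 'M[rat]_(g + g).
  by move=> bc; rewrite mul_delta_mx_cond (negPf bc).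
have X2 : X *m X = 0.
  have ml : m != l by rewrite eq_sym.
  rewrite /X mulmxBl !mulmxBr -!scalemxAl -!scalemxAr.
  rewrite !dd ?scaler0 ?subr0// ?(inj_eq star_inj)// ?star_neq// eq_sym.
  by rewrite star_neq.
have JX (a b : I) : Jmx g *m delta_mx a b = - sg a *: delta_mx (star a) b :> 'M[rat]_(g + g).
  apply/matrixP => p q; rewrite mxE (sum_J p (delta_mx a b ^~ q)) !mxE.
  rewrite -[p == star a](inj_eq star_inj) starK.
  case: eqP => [<-|_]; last by rewrite !mulr0.
  by rewrite sg_star opprK.
have XJ : X^T *m Jmx g + Jmx g *m X = 0.
  have -> : X^T *m Jmx g = - (Jmx g *m X)^T.
    rewrite trmx_mul -mulmxN; congr (_ *m _); apply/matrixP => p q.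
    by rewrite J_sym [RHS]mxE; congr (- _); rewrite [RHS]mxE.
  apply/eqP; rewrite addrC subr_eq0; apply/eqP.
  rewrite /X mulmxBr -scalemxAr !JX starK sg_star opprK scalerA.
  have -> : sg l * sg m * sg m = sg l by rewrite -mulrA sg2 mulr1.
  by rewrite linearB !linearZ /= !trmx_delta !scaleNr !scalerN addrC.
have := Sp_inv_nilp w ti X2 XJ.
have -> : \sum_i \sum_p X (tnth w i) p * t (upd w i p)
    = Eop l m t w - sg l * sg m * Eop (star m) (star l) t w.
  have S a b : \sum_i \sum_p (delta_mx a b : 'M[rat]_(g + g)) (tnth w i) p * t (upd w i p)
      = Eop a b t w.
    rewrite /Eop [RHS]big_mkcond; apply: eq_bigr => i _.
    rewrite (bigD1 b)//= big1 => [|p /negPf pb]; last by rewrite mxE pb andbF mul0r.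
    by rewrite addr0 mxE eqxx andbT; case: eqP => _; rewrite ?mul1r ?mul0r.
  rewrite -!S mulr_sumr -sumrB; apply: eq_bigr => i _.
  rewrite mulr_sumr -sumrB; apply: eq_bigr => p _.
  have -> : X (tnth w i) p = (delta_mx l m : 'M[rat]_(g + g)) (tnth w i) p
      - sg l * sg m * (delta_mx (star m) (star l) : 'M[rat]_(g + g)) (tnth w i) p.
    by rewrite !mxE.
  by rewrite mulrBl mulrA.
by move/eqP; rewrite subr_eq0 => /eqP.
Qed.

End SpLie.

Lemma actT_cons (I : finType) (A : I -> I -> rat) N (t : N.+1.-tuple I -> rat) x w :
  actT A t (cons_tuple x w) = \sum_y A x y * actT A (fun v => t (cons_tuple y v)) w.
Proof.
rewrite /actT sum_cons_tuple; apply: eq_bigr => y _.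
rewrite mulr_sumr; apply: eq_bigr => v _.
rewrite big_ord_recl !tnth0 -mulrA; congr (_ * (_ * _)).
by apply: eq_bigr => i _; rewrite !tnthS.
Qed.

Lemma actTP (I : finType) (A : I -> I -> rat) N (c : rat) t t' (w : N.-tuple I) :
  actT A (fun v => c * t v + t' v) w = c * actT A t w + actT A t' w.
Proof.
by rewrite /actT mulr_sumr -big_split /=; apply: eq_bigr => v _; ring.
Qed.

Lemma eq_actT (I : finType) (A : I -> I -> rat) N t t' (w : N.-tuple I) :
  t =1 t' -> actT A t w = actT A t' w.
Proof. by move=> tt'; apply: eq_bigr => v _; rewrite tt'. Qed.

Lemma actT_suml (I J : finType) (A : I -> I -> rat) N (c : J -> rat)
    (F : J -> N.-tuple I -> rat) w :
  actT A (fun v => \sum_j c j * F j v) w = \sum_j c j * actT A (F j) w.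
Proof.
rewrite /actT; under eq_bigr do rewrite mulr_sumr.
rewrite exchange_big; apply: eq_bigr => j _; rewrite mulr_sumr.
by apply: eq_bigr => v _; rewrite mulrCA.
Qed.

(** * Linear predicates in finite dimension, and the Casimir operator *)

Section FiniteDimension.
Variables (F : fieldType) (V : vectType F).

(** Take a subspace inside [P] of maximal dimension: adjoining a vector of [P] cannot enlarge it. *)
Lemma vspace_of_pred (P : V -> Prop) : P 0 ->
  (forall c x y, P x -> P y -> P (c *: x + y)) ->
  exists U : {vspace V}, forall x, x \in U <-> P x.
Proof.
move=> P0 PP.
pose Q n := `[< exists U : {vspace V}, (forall x, x \in U -> P x) /\ \dim U = n >].
have Q0 : Q 0%N.
  by apply/asboolP; exists 0%VS; split=> [x|]; rewrite ?dimv0// memv0 => /eqP ->.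
have Qle n : Q n -> (n <= \dim {: V})%N.
  by move=> /asboolP[U [_ <-]]; rewrite dimvS// subvf.
have exQ : exists n, Q n by exists 0%N.
case: (ex_maxnP exQ Qle) => n /asboolP[U [UP Un]] nmax.
exists U => x; split=> [/UP//|Px].
have UxP y : y \in (U + <[x]>)%VS -> P y.
  by move=> /memv_addP[u uU [v /vlineP[c ->] ->]]; rewrite addrC; apply: PP => //; exact: UP.
have Ule : (\dim (U + <[x]>) <= \dim U)%N.
  by rewrite Un; apply: nmax; apply/asboolP; exists (U + <[x]>)%VS.
have /eqP -> : U == (U + <[x]>)%VS.
  by rewrite eqEdim addvSl.
by rewrite memvE addvSr.
Qed.

(** An injective map that sends a finite-dimensional subspace into itself sends it onto itself. With
    [Cas] as [f], a property of [Cas t] passes to [t] without a formula for the inverse. *)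
Lemma pred_inj_back (P : V -> Prop) (f : {linear V -> V}) : P 0 ->
  (forall c x y, P x -> P y -> P (c *: x + y)) -> (forall x, f x = 0 -> x = 0) ->
  (forall x, P x -> P (f x)) -> forall x, P (f x) -> P x.
Proof.
move=> P0 PP f0 Pf x Pfx; have [U UP] := vspace_of_pred P0 PP.
have fU : (linfun f @: U)%VS = U.
  apply/eqP; rewrite eqEdim; apply/andP; split.
    by apply/subvP => y /memv_imgP[u /UP Pu ->]; rewrite lfunE; apply/UP/Pf.
  rewrite limg_dim_eq//; apply/eqP; rewrite -subv0; apply/subvP => y.
  by rewrite memv_cap memv_ker lfunE memv0 => /andP[_ /eqP /f0 ->].
have : f x \in U by apply/UP.
rewrite -fU => /memv_imgP[u /UP Pu]; rewrite lfunE => fxu.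
suff -> : x = u by [].
by apply/eqP; rewrite -subr_eq0; apply/eqP/f0; rewrite linearB fxu subrr.
Qed.

End FiniteDimension.

Section CasimirInjectivity.
Variable d N : nat.
Local Notation I := 'I_d.
Implicit Types (t : N.+1.-tuple I -> rat) (w : N.+1.-tuple I).

Lemma permT_tperm_upd w (i j : 'I_N.+1) :
  permT (tperm j i) w = upd (upd w j (tnth w i)) i (tnth w j).
Proof.
apply: eq_from_tnth => k; rewrite tnth_permT !tnth_upd.
by case: tpermP => [->|->|/eqP/negPf -> /eqP/negPf ->//]; rewrite ?eqxx//;
  case: eqP => [->|].
Qed.

Lemma Eop_upd0 t w m :
  Eop m (tnth w ord0) t (upd w ord0 m)
  = t w + \sum_(i | (i != ord0) && (tnth w i == m)) t (permT (tperm ord0 i) w).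
Proof.
rewrite /Eop (bigD1 ord0) ?tnth_upd ?eqxx//= upd_upd upd_id; congr (_ + _).
apply: eq_big => [i|i /andP[]].
  by rewrite tnth_upd; case: (i == ord0); rewrite ?andbF ?andbT.
rewrite tnth_upd => + i0; rewrite (negPf i0) => /eqP wi.
by rewrite permT_tperm_upd wi.
Qed.

(** The split Casimir operator of gl(d) at the first place, plus the identity ([Cas_Eop]). The added
    unit cancels, on symplectic invariants, the action of the first place on itself; see
    [Casimir]. *)
Definition Cas t w : rat :=
  d.+1%:R * t w + \sum_(i | i != ord0) t (permT (tperm ord0 i) w).

Lemma Cas_Eop t w :
  Cas t w = t w + \sum_m Eop m (tnth w ord0) t (upd w ord0 m).
Proof.
under eq_bigr do rewrite Eop_upd0.
rewrite big_split /= sumr_const card_ord -(mulr_natl (t w)) addrA.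
rewrite -[in X in X + _ + _](mul1r (t w)) -mulrDl -[1]/(1%:R) -natrD add1n.
congr (_ + _); rewrite (partition_big (tnth w) predT)//=.
Qed.

Lemma Cas_Eop_comm l m t w : Cas (Eop l m t) w = Eop l m (Cas t) w.
Proof.
rewrite /Cas; have -> : Eop l m (fun v => d.+1%:R * t v
    + \sum_(i | i != ord0) t (permT (tperm ord0 i) v)) w
  = d.+1%:R * Eop l m t w + Eop l m (fun v =>
      \sum_(i | i != ord0) t (permT (tperm ord0 i) v)) w by rewrite EopP.
congr (_ + _); rewrite [RHS]exchange_big; apply: eq_bigr => i _.
by rewrite -Eop_permT.
Qed.

(* Highest weight argument: at a word with t w != 0 of minimal letter sum the
   raising operators vanish, so that [Cas t w = (1 + positive integer) t w] as
   soon as the first letter is maximal. *)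
Lemma Cas_inj t : (forall w, Cas t w = 0) -> forall w, t w = 0.
Proof.
pose S w := (\sum_i tnth w i)%N.
suff H n : forall t, (forall w, Cas t w = 0) -> forall w, S w = n -> t w = 0.
  by move=> t0 w; exact: (H (S w)).
elim/ltn_ind: n => n IHn {}t t0 w wn.
move E: (d - tnth w ord0)%N => k; elim/ltn_ind: k => k IHk in w wn E *.
have := t0 w; rewrite Cas_Eop.
pose c (m : I) : nat := if (tnth w ord0 < m)%N then 1%N else
  if m == tnth w ord0 then (#|[pred i | (i != ord0) && (tnth w i == m)]|).+1 else 0%N.
have -> : \sum_m Eop m (tnth w ord0) t (upd w ord0 m) = \sum_m (c m)%:R * t w.
  apply: eq_bigr => m _; rewrite /c; case: ltnP => [lm|ml].
    rewrite Eop_upd0 mul1r big1 ?addr0// => i /andP[i0 /eqP wi].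
    apply: (IHk (d - m)%N); last 2 first.
    - rewrite -wn /S (reindex_inj (@perm_inj _ (tperm ord0 i))) /=.
      by apply: eq_bigr => j _; rewrite tnth_permT tpermK.
    - by rewrite tnth_permT tpermL wi.
    by rewrite -E; have := ltn_ord m; lia.
  case: eqVneq => [ml'|ml'].
    rewrite Eop_upd0 (eq_bigr (fun=> t w)) => [|i /andP[_ /eqP wi]]; last first.
      by rewrite permT_tperm_upd wi ml' upd_id -{1}ml' -wi upd_id.
    by rewrite sumr_const [RHS]mulr_natl mulrS; congr (_ + _ *+ _).
  rewrite mul0r; apply: (IHn (S (upd w ord0 m))) => //; last first.
    move=> v; rewrite Cas_Eop_comm /Eop big1// => i _; exact: t0.
  rewrite -wn /S (bigD1 ord0)//= [in X in (_ < X)%N](bigD1 ord0)//= tnth_upd eqxx.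
  rewrite (eq_bigr (fun i => nat_of_ord (tnth w i))) => [|i /negPf i0].
    by rewrite ltn_add2r ltn_neqAle ml andbT.
  by rewrite tnth_upd i0.
rewrite -mulr_suml -natr_sum -{1}[t w]mul1r -mulrDl -[1]/(1%:R) -natrD.
by move/eqP; rewrite mulf_eq0 pnatr_eq0 add1n => /orP[//|/eqP].
Qed.

End CasimirInjectivity.

(** * Contractions of invariant tensors *)

Section InvariantTensors.
Variable g : nat.
Local Notation I := 'I_(g + g).

Lemma Sp_inv0 N : Sp_inv (fun _ : N.-tuple I => 0).
Proof. by move=> A _ w; rewrite /actT big1// => v _; rewrite mulr0. Qed.

Lemma Sp_invP N (c : rat) (t t' : N.-tuple I -> rat) :
  Sp_inv t -> Sp_inv t' -> Sp_inv (fun v => c * t v + t' v).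
Proof. by move=> ti ti' A sA w; rewrite actTP ti// ti'. Qed.

Lemma eq_Sp_inv N (t t' : N.-tuple I -> rat) : t =1 t' -> Sp_inv t -> Sp_inv t'.
Proof. by move=> tt' ti A sA w; rewrite -(eq_actT _ _ tt') ti. Qed.

Lemma Sp_inv_permT N (p : 'S_N) (t : N.-tuple I -> rat) :
  Sp_inv t -> Sp_inv (t \o permT p).
Proof. by move=> ti A sA w; rewrite actT_permT ti. Qed.

Lemma Sp_inv_sum (J : finType) (P : pred J) N (F : J -> N.-tuple I -> rat) :
  (forall j, P j -> Sp_inv (F j)) -> Sp_inv (fun v => \sum_(j | P j) F j v).
Proof.
move=> Fi A sA w; rewrite /actT; under eq_bigr do rewrite mulr_sumr.
by rewrite exchange_big; apply: eq_bigr => j Pj; exact: Fi.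
Qed.

Definition ctr N (t : N.+2.-tuple I -> rat) (u : N.-tuple I) : rat :=
  \sum_p \sum_q Jmx g p q * t (cons_tuple p (cons_tuple q u)).

Definition rest2 N (w : N.+2.-tuple I) : N.-tuple I :=
  behead_tuple (behead_tuple w).

Definition JT N (c : N.-tuple I -> rat) (w : N.+2.-tuple I) : rat :=
  Jmx g (tnth w ord0) (tnth w (lift ord0 ord0)) * c (rest2 w).

Lemma rest2_cons N p q (u : N.-tuple I) : rest2 (cons_tuple p (cons_tuple q u)) = u.
Proof. exact: val_inj. Qed.

Lemma JT_cons N c p q (u : N.-tuple I) :
  JT c (cons_tuple p (cons_tuple q u)) = Jmx g p q * c u.
Proof. by rewrite /JT rest2_cons tnth0 tnthS tnth0. Qed.

Lemma cons2P N (w : N.+2.-tuple I) :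
  exists p q u, w = cons_tuple p (cons_tuple q u).
Proof.
case/tupleP: w => p w; case/tupleP: w => q u; exists p, q, u.
exact: val_inj.
Qed.

Lemma JT_inv N (c : N.-tuple I -> rat) : Sp_inv c -> Sp_inv (JT c).
Proof.
move=> ci A sA w; have [p [q [u ->]]] := cons2P w.
rewrite actT_cons JT_cons -(in_Sp_trE p q sA) mulr_suml.
apply: eq_bigr => p' _; rewrite actT_cons mulr_sumr mulr_suml.
apply: eq_bigr => q' _.
rewrite (@eq_actT _ _ _ _ (fun v => Jmx g p' q' * c v + 0)); last first.
  by move=> v; rewrite JT_cons addr0.
by rewrite actTP ci// (Sp_inv0 sA) addr0; ring.
Qed.

Lemma ctr_inv N (t : N.+2.-tuple I -> rat) : Sp_inv t -> Sp_inv (ctr t).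
Proof.
move=> ti A sA u.
pose T p q v := t (cons_tuple p (cons_tuple q v)).
have -> : actT A (ctr t) u = \sum_p \sum_q Jmx g p q * actT A (T p q) u.
  rewrite (@eq_actT _ _ _ _
      (fun v => \sum_p 1 * (fun p v => \sum_q Jmx g p q * T p q v) p v)).
    by rewrite actT_suml; apply: eq_bigr => p _; rewrite mul1r actT_suml.
  by move=> v; apply: eq_bigr => p _; rewrite mul1r.
rewrite /ctr.
have tE p q : t (cons_tuple p (cons_tuple q u))
    = \sum_p' \sum_q' A p p' * A q q' * actT A (T p' q') u.
  rewrite -[LHS](ti A sA) actT_cons; apply: eq_bigr => p' _.
  rewrite actT_cons mulr_sumr; apply: eq_bigr => q' _.
  by rewrite mulrA.
under [RHS]eq_bigr => p _ do under eq_bigr => q _ do rewrite tE mulr_sumr.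
under [RHS]eq_bigr => p _ do rewrite exchange_big /=.
rewrite [RHS]exchange_big /=; apply: eq_bigr => p' _.
under [RHS]eq_bigr => p _ do
  under eq_bigr => q _ do rewrite mulr_sumr.
under [RHS]eq_bigr => p _ do rewrite exchange_big /=.
rewrite [RHS]exchange_big /=; apply: eq_bigr => q' _.
rewrite -((in_SpE A).1 sA p' q') mulr_suml; apply: eq_bigr => p _.
by rewrite mulr_suml; apply: eq_bigr => q _; ring.
Qed.

Definition Lie_inv N (t : N.-tuple I -> rat) := forall l m w,
  Eop l m t w = sg l * sg m * Eop (star m) (star l) t w.

Lemma Sp_inv_Lie N (t : N.-tuple I -> rat) : Sp_inv t -> Lie_inv t.
Proof. by move=> ti l m w; exact: Sp_inv_Eop. Qed.

Lemma Sp_inv_nil (t : 0.-tuple I -> rat) : Sp_inv t.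
Proof.
move=> A _ w; rewrite /actT (big_pred1 [tuple]) => [|v].
  by rewrite big_ord0 mul1r (tuple0 w).
by rewrite [v]tuple0; apply/esym/eqP.
Qed.

Definition one2 N : 'I_N.+2 := lift ord0 ord0.

Lemma cons_upd N (v : N.+2.-tuple I) p q :
  cons_tuple p (cons_tuple q (rest2 v)) = upd (upd v ord0 p) (one2 N) q.
Proof.
have [a [b [u ->]]] := cons2P v; rewrite rest2_cons.
apply: eq_from_tnth => j; rewrite !tnth_upd.
case: (unliftP ord0 j) => [j'|] ->; last by rewrite !tnth0.
rewrite !tnthS (inj_eq (@lift_inj _ ord0)).
by case: (unliftP ord0 j') => [j''|] ->; rewrite ?tnthS ?tnth0.
Qed.

(** Invariance trades the elementary matrix of (m, l) for that of ([star l], [star m]), which acts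
    only at places carrying the dual of the first letter. The place [ord0] yields [- t w], absorbing
    the unit in [Cas]; every other place [i] yields the contraction of 0 and [i], reinserted with
    [Jmx]. The transposition brings [i] to the second place. *)
Lemma Casimir N (t : N.+2.-tuple I -> rat) w : Lie_inv t ->
  Cas t w = \sum_(i | i != ord0)
    JT (ctr (t \o permT (tperm (one2 N) i))) (permT (tperm (one2 N) i) w).
Proof.
move=> ti; rewrite Cas_Eop; set l := tnth w ord0.
have Em m : Eop m l t (upd w ord0 m) = sg m * sg l *
    ((m == star l)%:R * t w + \sum_(i | i != ord0)
      (tnth w i == star l)%:R * t (upd (upd w ord0 m) i (star m))).
  rewrite (ti m l); congr (_ * _).
  rewrite /Eop big_mkcond (bigD1 ord0)//= tnth_upd eqxx; congr (_ + _).
    case: eqP => [->|_]; last by rewrite mul0r.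
    by rewrite mul1r starK upd_upd upd_id.
  apply: eq_bigr => i /negPf i0; rewrite tnth_upd i0.
  by case: eqP => _; rewrite ?mul1r ?mul0r.
under eq_bigr do rewrite Em mulrDr.
rewrite big_split /= addrA (bigD1 (star l))//= eqxx mul1r.
rewrite big1 ?addr0 => [|m /negPf ->]; last by rewrite mul0r mulr0.
rewrite sg_star mulNr sg2 mulN1r addrN add0r.
under eq_bigr do rewrite mulr_sumr.
rewrite exchange_big /=; apply: eq_bigr => i i0.
set s := tperm _ _.
have s0 : s ord0 = ord0 by rewrite tpermD// eq_sym.
rewrite /JT !tnth_permT s0 tpermL -/l JE.
have -> : ctr (t \o permT s) (rest2 (permT s w))
    = \sum_m sg m * t (upd (upd w ord0 m) i (star m)).
  apply: eq_bigr => m _; rewrite sum_J /=; congr (_ * t _).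
  rewrite cons_upd !permT_upd permTM /s tperm2 permT1 tpermV -/s s0.
  by rewrite tpermL.
rewrite mulr_sumr; apply: eq_bigr => m _.
by case: eqP => _; ring.
Qed.

End InvariantTensors.

Lemma tensorP (I : finType) N c (t t' : tensor I N) w :
  (c *: t + t') w = c * t w + t' w.
Proof. by rewrite !ffunE. Qed.

(** * Lifting invariants to the next genus *)

Section Lifting.
Variable g : nat.
Local Notation I := 'I_(g + g).
Local Notation I' := 'I_(g.+1 + g.+1).

Definition em (l : I) : I' :=
  match fintype.split l with
  | inl i => lshift g.+1 (lift ord_max i)
  | inr i => rshift g.+1 (lift ord_max i)
  end.

Lemma em_inj : injective em.
Proof.
move=> l m; rewrite /em -{2}(fintype.splitK l) -{2}(fintype.splitK m).
case: (fintype.split l) => i; case: (fintype.split m) => j /=.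
- by move/lshift_inj/lift_inj => ->.
- by move/eqP; rewrite eq_lrshift.
- by move/eqP; rewrite eq_rlshift.
- by move/rshift_inj/lift_inj => ->.
Qed.

Lemma sg_em l : sg (em l) = sg l.
Proof.
rewrite /sg /em; case: (fintype.split l) => i.
  by rewrite (fintype.unsplitK (inl _)).
by rewrite (fintype.unsplitK (inr _)).
Qed.

Lemma star_em l : star (em l) = em (star l).
Proof.
rewrite /star /em; case: (fintype.split l) => i.
  by rewrite (fintype.unsplitK (inl _)) (fintype.unsplitK (inr _)).
by rewrite (fintype.unsplitK (inr _)) (fintype.unsplitK (inl _)).
Qed.

Lemma J_em l m : Jmx g.+1 (em l) (em m) = Jmx g l m.
Proof. by rewrite !JE sg_em star_em (inj_eq em_inj). Qed.

Definition res N (t : N.-tuple I' -> rat) (w : N.-tuple I) : rat :=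
  t (map_tuple em w).

Lemma map_permT N (p : 'S_N) (w : N.-tuple I) :
  map_tuple em (permT p w) = permT p (map_tuple em w).
Proof.
by apply: eq_from_tnth => i; rewrite tnth_map !tnth_permT tnth_map.
Qed.

Definition liftable N (t : N.-tuple I -> rat) :=
  exists t', Sp_inv t' /\ forall w, res t' w = t w.

Lemma liftableP N c (t t' : N.-tuple I -> rat) : liftable t -> liftable t' ->
  liftable (fun v => c * t v + t' v).
Proof.
move=> [u [ui ut]] [u' [ui' ut']]; exists (fun v => c * u v + u' v); split.
  exact: Sp_invP.
by move=> w; rewrite -ut -ut'.
Qed.

Lemma liftable0 N : liftable (fun _ : N.-tuple I => 0).
Proof. by exists (fun=> 0); split=> //; exact: Sp_inv0. Qed.

Lemma eq_liftable N (t t' : N.-tuple I -> rat) :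
  t =1 t' -> liftable t -> liftable t'.
Proof. by move=> tt' [u [ui ut]]; exists u; split=> // w; rewrite ut tt'. Qed.

Lemma liftable_sum N (J : finType) (P : pred J) (F : J -> N.-tuple I -> rat) :
  (forall j, P j -> liftable (F j)) -> liftable (fun v => \sum_(j | P j) F j v).
Proof.
move=> Fl; apply: (@eq_liftable _ (\sum_(j | P j) F j)).
  by move=> w; rewrite fct_sumE.
apply: big_ind => //; first exact: liftable0.
move=> x y lx ly; apply: eq_liftable (liftableP 1 lx ly) => w.
by rewrite mul1r.
Qed.

Lemma liftable_permT N (p : 'S_N) (t : N.-tuple I -> rat) :
  liftable t -> liftable (t \o permT p).
Proof.
move=> [u [ui ut]]; exists (u \o permT p); split; first exact: Sp_inv_permT.
by move=> w; rewrite /res /= -map_permT -/(res _ _) ut.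
Qed.

Lemma liftable_JT N (t : N.-tuple I -> rat) : liftable t -> liftable (JT t).
Proof.
move=> [u [ui ut]]; exists (JT u); split; first exact: JT_inv.
move=> w; rewrite /res /JT !tnth_map J_em -ut /res; congr (_ * u _).
by apply: val_inj; rewrite /= -!behead_map.
Qed.

Definition CasF N (t : tensor I N.+1) : tensor I N.+1 := [ffun w => Cas t w].

Lemma CasF_is_linear N : linear (@CasF N).
Proof.
move=> c t t'; apply/ffunP => w; rewrite tensorP !ffunE /Cas tensorP.
under eq_bigr do rewrite tensorP.
by rewrite big_split /= -mulr_sumr; ring.
Qed.
HB.instance Definition _ N := GRing.isLinear.Build rat (tensor I N.+1)
  (tensor I N.+1) *:%R (@CasF N) (@CasF_is_linear N).

Theorem Sp_inv_liftable n (t : n.*2.-tuple I -> rat) : Sp_inv t -> liftable t.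
Proof.
elim: n t => [|n IHn] t ti.
  exists (fun=> t [tuple]); split; first exact: Sp_inv_nil.
  by move=> w; rewrite /res (tuple0 w).
move: t ti; rewrite doubleS => t ti.
apply: (@eq_liftable _ (fun w => [ffun v => t v : rat^o] w)) => [w|].
  by rewrite ffunE.
(* Liftable tensors form a subspace stable under permutations of places, hence under [Cas]; so it is
   enough that [Cas t] is liftable. *)
apply: (@pred_inj_back _ _ (fun x : tensor I n.*2.+2 => liftable x) (@CasF _)).
- by apply: eq_liftable (liftable0 _) => w; rewrite ffunE.
- move=> c x y lx ly; apply: eq_liftable (liftableP c lx ly) => w.
  by rewrite !ffunE.
- move=> x /ffunP x0; apply/ffunP => w; rewrite [RHS]ffunE.
  by apply: Cas_inj => v; have := x0 v; rewrite !ffunE.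
- move=> x lx.
  apply: (@eq_liftable _ (fun w => (g + g).+1%:R * x w
      + \sum_(i | i != ord0) (x \o permT (tperm ord0 i)) w)) => [w|].
    by rewrite ffunE.
  by apply: liftableP => //; apply: liftable_sum => i _; exact: liftable_permT.
- apply: (@eq_liftable _ (fun w => \sum_(i | i != ord0)
    (JT (ctr (t \o permT (tperm (one2 _) i))) \o permT (tperm (one2 _) i)) w)).
    move=> w; rewrite ffunE -Casimir; last exact: Sp_inv_Lie.
    rewrite /Cas ffunE; congr (_ + _).
    by apply: eq_bigr => i _; rewrite ffunE.
  apply: liftable_sum => i _; apply: liftable_permT; apply: liftable_JT.
  by apply: IHn; apply: ctr_inv; exact: Sp_inv_permT.
Qed.

End Lifting.

(** * Dynkin idempotents and the correction of lifts *)

Section DynkinIdempotent.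
Variable d : nat.
Local Notation I := 'I_d.

Lemma dyn_idem n (f : series I) w : size w = n.+1 ->
  dyn (@rt I) 1 n 0 (dyn (@rt I) 1 n 0 f) w = n.+1%:R * dyn (@rt I) 1 n 0 f w.
Proof.
move=> wn; rewrite -!emb_Dyn// (@eq_Dyn _ _ _ (emb (Dyn n.+1 f))) => [|v vn].
  by rewrite Dyn_emb ?embZ//; exact: Dyn_deg.
by rewrite emb_Dyn.
Qed.

Definition extT N (t : N.-tuple I -> rat) (s : seq I) : rat := oapp t 0 (insub s).

Lemma extTE N (t : N.-tuple I -> rat) : extT t \o val =1 t.
Proof. by move=> w; rewrite /extT /= valK. Qed.

Lemma dyn_extT N (t : N.-tuple I -> rat) s n r w :
  dyn (@rott I N) s n r t w = dyn (@rt I) s n r (extT t) (val w).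
Proof.
by rewrite -(dyn_val (rot := @rott I N)) //; apply: eq_dyn => v; rewrite extTE.
Qed.

Lemma dynN_idem n (t : n.+1.-tuple I -> rat) w :
  dyn (@rott I n.+1) 1 n 0 (dyn (@rott I n.+1) 1 n 0 t) w
  = n.+1%:R * dyn (@rott I n.+1) 1 n 0 t w.
Proof.
rewrite (@eq_dyn _ _ _ _ _ _ (dyn (@rt I) 1 n 0 (extT t) \o val)) => [|v].
  by rewrite (dyn_val (rot' := @rt I))// dyn_idem ?size_tuple// -dyn_extT.
by rewrite dyn_extT.
Qed.

Lemma dyn1_idem n (t : n.+2.-tuple I -> rat) w :
  dyn (@rott I n.+2) 1 n 1 (dyn (@rott I n.+2) 1 n 1 t) w
  = n.+1%:R * dyn (@rott I n.+2) 1 n 1 t w.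
Proof.
rewrite (@eq_dyn _ _ _ _ _ _ (dyn (@rt I) 1 n 1 (extT t) \o val)) => [|v].
  rewrite (dyn_val (rot' := @rt I))// dyn_extT; case/tupleP: w => x w /=.
  rewrite !dyn_shift -dyn_idem ?size_tuple//; congr (dyn _ _ _ _ _ _).
  by apply/funext => v; rewrite -dyn_shift.
by rewrite dyn_extT.
Qed.

End DynkinIdempotent.

Lemma dyn_closed (T : Type) (rot : nat -> T -> T) (M : nat) (s : rat)
    (C : (T -> rat) -> Prop) :
  (forall f f', f =1 f' -> C f -> C f') ->
  (forall c f f', C f -> C f' -> C (fun w => c * f w + f' w)) ->
  (forall r f, (r < M)%N -> C f -> C (f \o rot r)) ->
  forall n r f, (n + r <= M)%N -> C f -> C (dyn rot s n r f).
Proof.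
move=> Ceq CP Cr; elim=> [|n IHn] r f nr Cf.
  by apply: Ceq Cf.
have C1 : C (dyn rot s n r.+1 f) by apply: IHn => //; lia.
apply: Ceq (CP (- s ^+ n.+1) _ _ (Cr r _ _ C1) C1); last by lia.
by move=> w /=; ring.
Qed.

Section RotationPerm.
Variable N : nat.

(** The place [r] goes to the end and the others keep their order; in this form the parity is that
    of [lift_perm]. *)
Definition rho (r : 'I_N.+1) : 'S_N.+1 := lift_perm r ord_max 1%g.

Lemma odd_rho r : odd_perm (rho r) = odd (N - r).
Proof.
have rN : (r <= N)%N by rewrite -ltnS.
by rewrite (oddB rN) addbC odd_lift_perm odd_perm1 addbF.
Qed.

Lemma rhoE r (i : 'I_N.+1) :
  rho r i = (if (i < r)%N then i : nat else if i == r then N else i.-1) :> nat.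
Proof.
case: (unliftP r i) => [j|] ->; last by rewrite lift_perm_id ltnn eqxx.
rewrite lift_perm_lift perm1 eq_sym (negPf (neq_lift _ _)) /= /bump.
have -> : (N <= j)%N = false by apply/negbTE; rewrite -ltnNge.
by case: (leqP r j) => /= rj; [rewrite add1n|]; case: ltnP; lia.
Qed.

Lemma rott_permT (I : finType) (r : 'I_N.+1) (w : N.+1.-tuple I) :
  rott r w = permT (rho r) w.
Proof.
apply: eq_from_tnth => i; rewrite tnth_permT.
rewrite (tnth_nth (tnth w ord0)) [RHS](tnth_nth (tnth w ord0)) rhoE /= /rt.
set x0 := tnth w ord0.
have sw : size w = N.+1 by rewrite size_tuple.
have szt : size (take r w) = r by rewrite size_take sw ltn_ord.
rewrite nth_cat szt; case: ltnP => ir; first by rewrite nth_take.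
have sd : size (drop r w) = (N.+1 - r)%N by rewrite size_drop sw.
have [lr|r0] := leqP N.+1 r; first by have := ltn_ord r; lia.
have : drop r w != [::] by rewrite -size_eq0 sd; lia.
case/lastP E: (drop r w) => [|s x] // _; rewrite rotr1_rcons.
have sx : size s = (N - r)%N by move: sd; rewrite E size_rcons; lia.
have nE j : nth x0 w (r + j) = nth x0 (rcons s x) j by rewrite -nth_drop E.
case: eqP => [->|/eqP ne].
  rewrite subnn /=; have := nE (N - r)%N; rewrite nth_rcons sx ltnn eqxx => <-.
  by congr nth; have := ltn_ord r; lia.
have ri : (r < i)%N by rewrite ltn_neqAle ir andbT eq_sym.
have -> : (i - r)%N = (i - r).-1.+1 by lia.
have -> : i.-1 = (r + (i - r).-1)%N by lia.
by rewrite /= nE nth_rcons sx; case: ltnP => //; have := ltn_ord i; lia.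
Qed.

End RotationPerm.

Section Exactness.
Variables (g n : nat).
Hypothesis n_even : ~~ odd n.
Local Notation I := 'I_(g + g).
Local Notation I' := 'I_(g.+1 + g.+1).
Local Notation N := n.+2.

Lemma Sp_inv_dyn (h : nat) s m r (t : N.-tuple 'I_(h + h) -> rat) :
  (m + r <= N)%N -> Sp_inv t -> Sp_inv (dyn (@rott _ N) s m r t).
Proof.
move=> mr ti; apply: (@dyn_closed _ _ N s (fun f => Sp_inv f) _ _ _ m r t mr ti).
- exact: eq_Sp_inv.
- exact: Sp_invP.
- move=> q f qN fi; apply: (@eq_Sp_inv _ _ (f \o permT (rho (Ordinal qN)))).
    by move=> w /=; rewrite -rott_permT.
  exact: Sp_inv_permT.
Qed.

Lemma res_dyn s m r (t : N.-tuple I' -> rat) w :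
  res (dyn (@rott _ N) s m r t) w = dyn (@rott _ N) s m r (res t) w.
Proof.
rewrite /res -(dyn_val (rot := @rott I N) (v := map_tuple (@em g)))// => i v.
by apply: val_inj; rewrite /= /rt map_cat map_take map_rotr map_drop.
Qed.

Lemma dynNE s (t : N.-tuple I' -> rat) w :
  dyn (@rott _ N) s n.+1 0 t w = dyn (@rott _ N) s n 1 t w
    - s ^+ n.+1 * dyn (@rott _ N) s n 1 t (rott 0 w).
Proof. by []. Qed.

Lemma good_lift (t : tensor I N) : good t ->
  exists t' : tensor I' N, good t' /\ forall w, res t' w = t w.
Proof.
case=> -[tc tl] ti.
have [x [xi xt]] : liftable t.
  have : N = (N./2).*2 by rewrite -[LHS]odd_double_half /= negbK (negPf n_even).
  move: (t : N.-tuple I -> rat) ti => {tc tl}; move: (N./2) => m ti' ti E.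
  by move: ti' ti; rewrite E => ti' ti; exact: Sp_inv_liftable.
pose D := dyn (@rott I' N) 1 n 1; pose DN := dyn (@rott I' N) 1 n.+1 0.
have DP c f f' w : D (fun v => c * f v + f' v) w = c * D f w + D f' w := dynP _ _ _ _ _ _ _ _.
have DNP c f f' w : DN (fun v => c * f v + f' v) w = c * DN f w + DN f' w := dynP _ _ _ _ _ _ _ _.
have D0 w : D (fun=> 0) w = 0.
  transitivity (-1 * D (fun=> 0) w + D (fun=> 0) w); last by ring.
  by rewrite -DP; apply: eq_dyn => v; rewrite mulr0 addr0.
have DZ c f w : D (fun v => c * f v) w = c * D f w.
  by rewrite -[RHS]addr0 -(D0 w) -DP; apply: eq_dyn => v; rewrite addr0.
(* [x'] satisfies the Lie condition and still restricts to [t]. Its cyclic defect [y] lies in the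
   image of the Dynkin operator [DN] on all places, so [DN y] is [n.+2] times [y]; this says that
   [z] has the same cyclic defect as [x']. As [t] is cyclic, [y] and then [z] restrict to 0, so
   [x' - z] is the corrected lift. *)
pose x' w := n.+1%:R^-1 * D x w.
pose y w := x' w - x' (rott 0 w).
pose z w := n.+2%:R^-1 * D y w.
have nz m : m.+1%:R != 0 :> rat by rewrite pnatr_eq0.
have DNE f w : DN f w = D f w - D f (rott 0 w).
  by rewrite /DN dynNE expr1n mul1r.
have DNDN f w : DN (DN f) w = n.+2%:R * DN f w := dynN_idem _ _.
have DD f w : D (D f) w = n.+1%:R * D f w := dyn1_idem _ _.
have yE w : y w = n.+1%:R^-1 * DN x w by rewrite DNE mulrBr.
have DNy w : DN y w = n.+2%:R * y w.
  transitivity (DN (fun v => n.+1%:R^-1 * DN x v + 0) w).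
    by apply: eq_dyn => v; rewrite yE addr0.
  by rewrite DNP DNDN (DNE (fun=> 0)) !D0 yE; ring.
have resx' w : res x' w = t w.
  rewrite -[LHS]/(n.+1%:R^-1 * res (D x) w) /D res_dyn.
  by rewrite (eq_dyn _ _ _ _ _ xt) tl mulKf.
have resr f w : res (f \o @rott I' N 0) w = res f (rott 0 w).
  by rewrite /res /=; congr f; apply: val_inj;
    rewrite /= /rt map_cat map_take map_rotr map_drop.
have resy w : res y w = 0.
  by rewrite -[LHS]/(res x' w - res (x' \o @rott I' N 0) w) resr !resx' tc subrr.
have resz w : res z w = 0.
  rewrite -[LHS]/(n.+2%:R^-1 * res (D y) w) /D res_dyn.
  have -> : dyn (@rott I N) 1 n 1 (res y) w = dyn (@rott I N) 1 n 1 (fun=> 0) w.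
    exact: eq_dyn.
  suff -> : dyn (@rott I N) 1 n 1 (fun=> 0) w = 0 by rewrite mulr0.
  transitivity (-1 * dyn (@rott I N) 1 n 1 (fun=> 0) w
    + dyn (@rott I N) 1 n 1 (fun=> 0) w); last by ring.
  by rewrite -dynP; apply: eq_dyn => v; rewrite mulr0 addr0.
have DDx w : D x' w = n.+1%:R * x' w by rewrite DZ DD mulrCA.
have DDz w : D z w = n.+1%:R * z w by rewrite DZ DD mulrCA.
exists [ffun w => x' w - z w]; split; last first.
  by move=> w; rewrite /res ffunE -[LHS]/(res x' w - res z w) resx' resz subr0.
split; first split.
- move=> w; rewrite !ffunE; apply/eqP; rewrite eq_sym -subr_eq0; apply/eqP.
  transitivity (y w - n.+2%:R^-1 * (D y w - D y (rott 0 w))); first by rewrite /y /z; ring.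
  by rewrite -DNE DNy mulKf ?subrr.
- move=> w; rewrite ffunE (@eq_dyn _ _ _ _ _ _ (fun w => -1 * z w + x' w)).
    by rewrite -/(D _) DP DDx DDz; ring.
  by move=> v; rewrite ffunE; ring.
- have Dxi : Sp_inv (D x) by apply: Sp_inv_dyn => //; lia.
  have xi' : Sp_inv x'.
    by apply: eq_Sp_inv (Sp_invP n.+1%:R^-1 Dxi (@Sp_inv0 _ _)) => w; rewrite addr0.
  have yi : Sp_inv y.
    have DNi : Sp_inv (DN x) by apply: Sp_inv_dyn => //; lia.
    by apply: eq_Sp_inv (Sp_invP n.+1%:R^-1 DNi (@Sp_inv0 _ _)) => w; rewrite addr0 yE.
  have zi : Sp_inv z.
    have Dyi : Sp_inv (D y) by apply: Sp_inv_dyn => //; lia.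
    by apply: eq_Sp_inv (Sp_invP n.+2%:R^-1 Dyi (@Sp_inv0 _ _)) => w; rewrite addr0.
  by apply: eq_Sp_inv (Sp_invP (-1) zi xi') => w; rewrite ffunE; ring.
Qed.

End Exactness.

(** * Dimension counts and the exact sequence of one genus step *)

Section HasDim.
Variables (F : fieldType) (V : vectType F) (P : V -> Prop).

Lemma has_dim_vspace (U : {vspace V}) :
  (forall x, x \in U <-> P x) -> has_dim P (\dim U).
Proof.
move=> UP; exists (fun i => (vbasis U)`_i); split=> [c c0|x].
  have /freeP := basis_free (vbasisP U); apply.
  by rewrite -[RHS]c0; apply: eq_bigr.
split=> [/UP xU|[c ->]].
  by exists (fun i => coord (vbasis U) i x); exact: coord_vbasis.
apply/UP; apply: memv_suml => i _; apply: memvZ; apply: vbasis_mem.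
by apply: mem_nth; rewrite size_tuple.
Qed.

Lemma has_dim_exists : P 0 -> (forall c x y, P x -> P y -> P (c *: x + y)) ->
  exists n, has_dim P n.
Proof.
move=> P0 PP; have [U UP] := vspace_of_pred P0 PP.
by exists (\dim U); exact: has_dim_vspace.
Qed.

Lemma has_dim0 : (forall x, P x <-> x = 0) -> has_dim P 0.
Proof.
move=> P0; have <- : \dim (0%VS : {vspace V}) = 0%N by rewrite dimv0.
apply: has_dim_vspace => x.
by rewrite memv0; split=> [/eqP /P0//|/P0 ->].
Qed.

Lemma has_dim1 (f : V -> F) v : P v -> v != 0 ->
  (forall c x y, P x -> P y -> P (c *: x + y)) ->
  (forall c x y, f (c *: x + y) = c * f x + f y) ->
  (forall x, P x -> f x = 0 -> x = 0) -> has_dim P 1.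
Proof.
move=> Pv v0 PP fP f0; have <- : \dim <[v]> = 1%N by rewrite dim_vline v0.
have P0 : P 0 by have := PP (-1) v v Pv Pv; rewrite scaleN1r addNr.
have fv : f v != 0 by apply: contraNneq v0 => /(f0 _ Pv) ->.
apply: has_dim_vspace => x; split=> [/vlineP[c ->]|Px].
  by rewrite -[c *: v]addr0; exact: PP.
apply/vlineP; exists (f x / f v); apply/eqP.
rewrite -subr_eq0 addrC -scaleNr; apply/eqP/f0; first exact: PP.
by rewrite fP mulNr divfK// addNr.
Qed.

End HasDim.

Section ExactDim.
Variables (F : fieldType) (V W : vectType F) (P : V -> Prop) (Q : W -> Prop).

Lemma has_dim_exact (f : {linear V -> W}) a b :
  P 0 -> (forall c x y, P x -> P y -> P (c *: x + y)) ->
  (forall x, P x -> Q (f x)) -> (forall y, Q y -> exists2 x, P x & f x = y) ->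
  has_dim Q a -> has_dim (fun x => P x /\ f x = 0) b -> has_dim P (a + b).
Proof.
move=> P0 PP PQ QP Qa Kb; have [U UP] := vspace_of_pred P0 PP.
have <- : \dim (linfun f @: U) = a.
  apply: (has_dim_uniq _ Qa); apply: has_dim_vspace => y; split.
    by move=> /memv_imgP[x /UP Px ->]; rewrite lfunE; exact: PQ.
  move=> /QP[x /UP xU <-]; apply/memv_imgP; exists x => //.
  by rewrite lfunE.
have <- : \dim (U :&: lker (linfun f)) = b.
  apply: (has_dim_uniq _ Kb); apply: has_dim_vspace => x.
  rewrite memv_cap memv_ker lfunE; split; first by case/andP => /UP ? /eqP.
  by case=> /UP -> /eqP.
by rewrite addnC limg_ker_dim; exact: has_dim_vspace.
Qed.

End ExactDim.

Lemma cyclieP g n c (t t' : tensor 'I_(g + g) n.+2) :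
  cyclie (n := n) (@rott _ _) t -> cyclie (n := n) (@rott _ _) t' ->
  cyclie (n := n) (@rott _ _) (c *: t + t').
Proof.
move=> [tc tl] [tc' tl']; split=> w; first by rewrite !tensorP tc tc'.
rewrite (@eq_dyn _ _ _ _ _ _ (fun v => c * t v + t' v)) => [|v].
  by rewrite dynP tl tl' tensorP; ring.
by rewrite tensorP.
Qed.

Lemma goodP g n c (t t' : tensor 'I_(g + g) n.+2) :
  good t -> good t' -> good (c *: t + t').
Proof.
move=> [tc ti] [tc' ti']; split; first exact: cyclieP.
by apply: eq_Sp_inv (Sp_invP c ti ti') => w; rewrite tensorP.
Qed.

Lemma good0 g n : good (0 : tensor 'I_(g + g) n.+2).
Proof.
split; last by apply: eq_Sp_inv (@Sp_inv0 _ _) => w; rewrite ffunE.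
split=> w; first by rewrite !ffunE.
rewrite (@eq_dyn _ _ _ _ _ _ (fun v => -1 * (0 : tensor 'I_(g + g) n.+2) v
  + (0 : tensor 'I_(g + g) n.+2) v)) => [|v]; last by rewrite ffunE; ring.
by rewrite dynP ffunE; ring.
Qed.

Section GenusStep.
Variables (g n : nat).
Local Notation N := n.+2.

Definition resF (t : tensor 'I_(g.+1 + g.+1) N) : tensor 'I_(g + g) N :=
  [ffun w => res t w].

Fact resF_is_linear : linear resF.
Proof.
by move=> c t t'; apply/ffunP => w; rewrite tensorP !ffunE /res tensorP.
Qed.
HB.instance Definition _ := GRing.isLinear.Build rat
  (tensor 'I_(g.+1 + g.+1) N) (tensor 'I_(g + g) N) *:%R resF resF_is_linear.

(** The sum of [A] and the identity on the last symplectic pair. The embedded letters do not form an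
    interval, hence the search for preimages under [em]. *)
Definition em_mx (A : 'M[rat]_(g + g)) : 'M[rat]_(g.+1 + g.+1) :=
  \matrix_(i, j) (if [pick l | em l == i] is Some l then
      if [pick m | em m == j] is Some m then A l m else 0
    else (i == j)%:R).

Lemma pick_em (l : 'I_(g + g)) : [pick m | em m == em l] = Some l.
Proof.
case: pickP => [m /eqP/em_inj -> //|/(_ l)]; by rewrite eqxx.
Qed.

Lemma pick_notem i : i \notin codom (@em g) -> [pick m | em m == i] = None.
Proof.
by case: pickP => // m /eqP <- /negP[]; apply: codom_f.
Qed.

Lemma em_mxE A l m : em_mx A (em l) (em m) = A l m.
Proof. by rewrite mxE !pick_em. Qed.
Lemma em_mxEr A l j : j \notin codom (@em g) -> em_mx A (em l) j = 0.
Proof. by move=> j0; rewrite mxE pick_em pick_notem. Qed.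
Lemma em_mxEl A i j : i \notin codom (@em g) -> em_mx A i j = (i == j)%:R.
Proof. by move=> j0; rewrite mxE pick_notem. Qed.

Lemma sum_em (F : 'I_(g.+1 + g.+1) -> rat) :
  \sum_p F p = \sum_a F (em a) + \sum_(p | p \notin codom (@em g)) F p.
Proof.
rewrite (bigID (mem (codom (@em g)))) /=; congr (_ + _).
rewrite [RHS](partition_big (@em g) (mem (codom (@em g)))) => [|a _]; last exact: codom_f.
apply: eq_bigr => p /codomP[a ->].
rewrite (eq_bigl (pred1 a)) ?big_pred1_eq// => b /=.
by rewrite (inj_eq (@em_inj g)).
Qed.

Lemma star_codom i : (star i \in codom (@em g)) = (i \in codom (@em g)).
Proof.
apply/idP/idP => /codomP[a].
  by move/(congr1 (@star _)); rewrite starK star_em => ->; exact: codom_f.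
by move=> ->; rewrite star_em; exact: codom_f.
Qed.

Lemma in_Sp_em A : in_Sp A -> in_Sp (em_mx A).
Proof.
move=> sA; apply/in_SpE => l m.
under eq_bigr => p _.
  under eq_bigr => q _ do rewrite -mulrA.
  rewrite -mulr_sumr (sum_J p (em_mx A ^~ m)); over.
rewrite sum_em.
have [/codomP[l' ->]|lem] := boolP (l \in codom (@em g)).
  rewrite [X in _ + X]big1 ?addr0 => [|p pem]; last first.
    rewrite em_mxEl//; case: eqP => [pl|_]; last by rewrite mul0r.
    by rewrite pl codom_f in pem.
  under eq_bigr => a _ do rewrite em_mxE sg_em star_em.
  have [/codomP[m' ->]|mem] := boolP (m \in codom (@em g)).
    rewrite J_em -((in_SpE A).1 sA); apply: eq_bigr => a _.
    rewrite em_mxE -(sum_J a (A ^~ m')) mulr_sumr.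
    by apply: eq_bigr => b _; rewrite mulrA.
  rewrite big1 => [|a _]; last by rewrite em_mxEr// !mulr0.
  rewrite JE star_em; case: eqP => [me|_]; last by rewrite mulr0.
  by rewrite me codom_f in mem.
rewrite big1 ?add0r => [|a _]; last by rewrite em_mxEr// mul0r.
rewrite (bigD1 l)//= big1 ?addr0 => [|p /andP[pem /negPf pl]]; last first.
  by rewrite em_mxEl// pl mul0r.
by rewrite em_mxEl// eqxx mul1r em_mxEl ?star_codom// JE eq_sym.
Qed.

(** The rows of [em_mx A] at embedded letters vanish outside the embedded columns, so only embedded
    words contribute to the action. *)
Lemma Sp_inv_res M (t : M.-tuple 'I_(g.+1 + g.+1) -> rat) :
  Sp_inv t -> Sp_inv (res t).
Proof.
move=> ti A /in_Sp_em sA w; rewrite /res -[RHS](ti _ sA) /actT.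
have inj : injective (map_tuple (n := M) (@em g)).
  move=> v v' /(congr1 val) /= /inj_map e; apply: val_inj; apply: e.
  exact: em_inj.
rewrite [RHS](bigID (mem (codom (map_tuple (n := M) (@em g))))) /=.
rewrite [X in _ + X]big1 ?addr0 => [|v vem]; last first.
  have [i vi] : exists i, tnth v i \notin codom (@em g).
    apply/existsP; apply: contraNT vem; rewrite negb_exists => /forallP h.
    have {}h i : exists a, tnth v i = em a.
      by have := h i; rewrite negbK => /codomP.
    have [f fv] := choice h.
    apply/codomP; exists [tuple f i | i < M]; apply: eq_from_tnth => i.
    by rewrite tnth_map tnth_mktuple.
  by rewrite (bigD1 i)//= tnth_map em_mxEr// !mul0r.
rewrite [RHS](partition_big (fun v => v) (mem (codom (map_tuple (n := M) (@em g)))))//=.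
rewrite [LHS](partition_big (map_tuple (@em g)) (mem (codom (map_tuple (n := M) (@em g))))) /=.
  apply: eq_bigr => v /codomP[u ->].
  rewrite (big_pred1 u) => [|u' /=]; last by rewrite (inj_eq inj).
  rewrite (big_pred1 (map_tuple (@em g) u)) => [|u' /=]; last first.
    by apply/andP/eqP => [[_ /eqP]//|->]; rewrite codom_f eqxx.
  by congr (_ * _); apply: eq_bigr => i _; rewrite !tnth_map em_mxE.
by move=> v _; exact: codom_f.
Qed.

Lemma good_res t : good t -> good (resF t).
Proof.
case=> -[tc tl] ti; split; first split.
- move=> w; rewrite !ffunE /res -[RHS]tc; congr (t _); apply: val_inj.
  by rewrite /= /rt map_cat map_take map_rotr map_drop.
- move=> w; rewrite (@eq_dyn _ _ _ _ _ _ (res t)) => [|v]; last by rewrite ffunE.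
  by rewrite -res_dyn ffunE /res tl.
- by apply: eq_Sp_inv (Sp_inv_res ti) => w; rewrite ffunE.
Qed.

Lemma has_dim_step a b : ~~ odd n -> has_dim (@good g n) a ->
  has_dim (fun t : tensor 'I_(g.+1 + g.+1) N => good t /\ resF t = 0) b ->
  has_dim (@good g.+1 n) (a + b).
Proof.
move=> ne; apply: has_dim_exact.
- exact: good0.
- exact: goodP.
- exact: good_res.
- move=> y /(good_lift ne)[x [gx xy]]; exists x => //.
  by apply/ffunP => w; rewrite ffunE xy.
Qed.

End GenusStep.

(** * Symplectic pairs, and the kernel of the restriction *)

Section Indices.
Variable g : nat.
Local Notation I := 'I_(g + g).

Definition idx (l : I) : 'I_g :=
  match fintype.split l with inl i => i | inr i => i end.

Lemma idx_eq l m : idx l = idx m -> m = l \/ m = star l.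
Proof.
rewrite /idx /star -{2}(fintype.splitK l) -{2 3}(fintype.splitK m).
by case: (fintype.split l) => i; case: (fintype.split m) => j /= ->; auto.
Qed.

Definition idx_map (p : 'S_g) (l : I) : I :=
  match fintype.split l with
  | inl i => lshift g (p i)
  | inr i => rshift g (p i)
  end.

Lemma idx_idx_map p l : idx (idx_map p l) = p (idx l).
Proof.
rewrite /idx /idx_map; case: (fintype.split l) => i.
  by rewrite (fintype.unsplitK (inl _)).
by rewrite (fintype.unsplitK (inr _)).
Qed.

Lemma sg_idx_map p l : sg (idx_map p l) = sg l.
Proof.
rewrite /sg /idx_map; case: (fintype.split l) => i.
  by rewrite (fintype.unsplitK (inl _)).
by rewrite (fintype.unsplitK (inr _)).
Qed.

Lemma star_idx_map p l : star (idx_map p l) = idx_map p (star l).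
Proof.
rewrite /star /idx_map; case: (fintype.split l) => i.
  by rewrite (fintype.unsplitK (inl _)) (fintype.unsplitK (inr _)).
by rewrite (fintype.unsplitK (inr _)) (fintype.unsplitK (inl _)).
Qed.

Lemma idx_map_inj p : injective (idx_map p).
Proof.
move=> l m; rewrite /idx_map -{2}(fintype.splitK l) -{2}(fintype.splitK m).
case: (fintype.split l) => i; case: (fintype.split m) => j /=.
- by move/lshift_inj/perm_inj => ->.
- by move/eqP; rewrite eq_lrshift.
- by move/eqP; rewrite eq_rlshift.
- by move/rshift_inj/perm_inj => ->.
Qed.

Lemma Sp_inv_idx_map p N (t : N.-tuple I -> rat) w : Sp_inv t ->
  t (map_tuple (idx_map p) w) = t w.
Proof.
move=> ti; rewrite -(Sp_inv_mono (eps := fun=> 1) (@idx_map_inj p) _ ti).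
  by rewrite big1 ?mul1r.
move=> l m; rewrite !mul1r !JE sg_idx_map star_idx_map.
by rewrite (inj_eq (@idx_map_inj p)).
Qed.

End Indices.

Lemma codom_em g (l : 'I_(g.+1 + g.+1)) :
  (l \in codom (@em g)) = (idx l != ord_max).
Proof.
apply/idP/idP => [/codomP[a ->]|].
  rewrite /idx /em; case: (fintype.split a) => i.
    by rewrite (fintype.unsplitK (inl _)) eq_sym neq_lift.
  by rewrite (fintype.unsplitK (inr _)) eq_sym neq_lift.
rewrite /idx -{2}(fintype.splitK l); case: (fintype.split l) => i /=;
  rewrite eq_sym => /unlift_some[j -> _]; apply/codomP.
  by exists (lshift g j); rewrite /em (fintype.unsplitK (inl _)).
by exists (rshift g j); rewrite /em (fintype.unsplitK (inr _)).
Qed.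

Lemma codom_map_em g N (w : N.-tuple 'I_(g.+1 + g.+1)) :
  (forall i, tnth w i \in codom (@em g)) -> exists u, w = map_tuple (@em g) u.
Proof.
move=> h; have {}h i : exists a, tnth w i = em a by apply/codomP.
have [f fw] := choice h.
exists [tuple f i | i < N]; apply: eq_from_tnth => i.
by rewrite tnth_map tnth_mktuple.
Qed.

Section Kernel.
Variables (g N : nat).
Local Notation I := 'I_(g.+1 + g.+1).
Variable t : N.-tuple I -> rat.
Hypotheses (ti : Sp_inv t) (t0 : forall w, res t w = 0).

(** By weight [w] misses the dual letter as well; a permutation of the pairs makes the missing pair
    the last one, and then the word comes from genus [g]. *)
Lemma ker_support w l : l \notin w -> t w = 0.
Proof.
move=> lw; apply/eqP; apply: contraTT isT => tw.
have sw : star l \notin w.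
  rewrite -has_pred1 has_count -(Sp_inv_weight l ti tw) -has_count has_pred1.
  exact: lw.
pose p := tperm (idx l) ord_max.
have [u wu] : exists u, map_tuple (idx_map p) w = map_tuple (@em g) u.
  apply: codom_map_em => i; rewrite tnth_map codom_em idx_idx_map /p.
  have ilw : idx (tnth w i) != idx l.
    apply/eqP => /esym/idx_eq[e|e].
      by rewrite -e mem_tnth in lw.
    by rewrite -e mem_tnth in sw.
  by rewrite -{2}(tpermL (idx l) ord_max) (inj_eq perm_inj).
by move: tw; rewrite -(Sp_inv_idx_map p w ti) wu -/(res t u) t0 eqxx.
Qed.

(** For [m = star l] infinitesimal invariance equates the value with its negative. Otherwise it
    exchanges the operator for one whose terms insert [star l]: these words still miss [m], and
    [ker_support] applies. *)
Lemma ker_swap u l m : l != m -> m = star l \/ m \notin u -> Eop l m t u = 0.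
Proof.
move=> lm mu; rewrite Sp_inv_Eop//.
have [ml|ml] := eqVneq m (star l).
  have := Sp_inv_Eop l m u ti; rewrite ml starK sg_star mulrN sg2 mulN1r.
  by move/eqP; rewrite -addr_eq0 -mulr2n mulrn_eq0 /= => /eqP ->; rewrite oppr0.
case: mu => [e|mu]; first by rewrite e eqxx in ml.
rewrite /Eop big1 ?mulr0// => i _; apply: (@ker_support _ m).
apply/negP => /tnthP[j]; rewrite tnth_upd; case: (j == i) => mE.
  by rewrite mE eqxx in ml.
by rewrite mE mem_tnth in mu.
Qed.

Lemma ker_small : (N < g.+1 + g.+1)%N -> forall w, t w = 0.
Proof.
move=> Ng w; have [l lw|h] := pickP (fun l => l \notin w); first exact: ker_support lw.
have : (#|I| <= size w)%N.
  rewrite cardE; apply: uniq_leq_size; first exact: enum_uniq.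
  by move=> l _; have := h l; move/negbFE.
by rewrite card_ord size_tuple leqNgt Ng.
Qed.

Lemma ker_tperm a b w : N = (g.+1 + g.+1)%N -> a != b ->
  t (permT (tperm a b) w) = - t w.
Proof.
move=> NE ab; have [uw|nuw] := boolP (uniq w); last first.
  have [l lw] : exists l, l \notin w.
    apply/existsP; apply: contraNT nuw; rewrite negb_exists => /forallP h.
    rewrite (@uniq_size_uniq _ (enum I)) ?enum_uniq// => [|l].
      by rewrite -cardE card_ord size_tuple NE.
    by rewrite mem_enum; have := h l; rewrite negbK => ->.
  rewrite !(@ker_support _ l) ?oppr0//.
  by apply: contra lw => /tnthP[j ->]; rewrite tnth_permT mem_tnth.
pose l := tnth w a; pose m := tnth w b.
have wi i j : (tnth w i == tnth w j) = (i == j).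
  by rewrite !(tnth_nth l) nth_uniq ?size_tuple.
have lm : l != m by rewrite /l /m wi.
(* [u] has [l] at both places and misses [m]; the two terms of [Eop l m t u] are [t] at [w] and at
   the transposed word. *)
pose u := upd w b l.
have mu : m \notin u.
  apply/negP => /tnthP[j]; rewrite tnth_upd; case: (eqVneq j b) => [_ /eqP|jb /eqP].
    by rewrite eq_sym (negPf lm).
  by rewrite eq_sym wi (negPf jb).
have := ker_swap lm (or_intror mu).
rewrite /Eop (bigD1 b) ?tnth_upd ?eqxx//= (bigD1 a) ?tnth_upd ?(negPf ab) ?eqxx//=.
rewrite big1 ?addr0 => [|i /andP[/andP[+ /negPf ib] /negPf ia]]; last first.
  by rewrite tnth_upd ib /l wi ia.
rewrite /u upd_upd /m upd_id => /eqP; rewrite addrC addr_eq0 => /eqP <-.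
congr t; apply: eq_from_tnth => j; rewrite tnth_permT !tnth_upd.
by case: tpermP => [->|->|/eqP/negPf -> /eqP/negPf -> //]; rewrite ?eqxx// eq_sym (negPf ab).
Qed.

Lemma ker_permT p w : N = (g.+1 + g.+1)%N -> t (permT p w) = (-1) ^+ odd_perm p * t w.
Proof.
move=> NE; have [ts -> tsd] := prod_tpermP p.
elim: ts tsd w => [|[a b] ts IHts] /=.
  by move=> _ w; rewrite big_nil odd_perm1 permT1 mul1r.
move=> /andP[ab tsd] w; rewrite big_cons -permTM ker_tperm// IHts//.
by rewrite odd_permM odd_tperm ab; case: (odd_perm _); rewrite /=; ring.
Qed.

End Kernel.

(** * The marked volume form and the masses *)

Section MarkedVolume.
Variable M : nat.
Local Notation N := (2 + M)%N.
Local Notation word := (N.-tuple 'I_M).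
Implicit Types (w : word) (a b : 'I_N).

(* The first two columns mark the places a and b; the others list the letters,
   so that the determinant is the volume form on the unmarked places. *)
Definition Vmx a b w : 'M[rat]_N :=
  \matrix_(r, c) match fintype.split c with
    | inl x => (r == (if x == ord0 then a else b))%:R
    | inr l => (tnth w r == l)%:R
    end.

Definition V a b w : rat := \det (Vmx a b w).

Definition unmarked a b : {set 'I_N} := ~: [set a; b].

Lemma in_unmarked a b i : (i \in unmarked a b) = (i != a) && (i != b).
Proof. by rewrite !inE negb_or. Qed.

Lemma card_unmarked a b : a != b -> #|unmarked a b| = M.
Proof.
by move=> ab; rewrite cardsCs setCK cardsU1 cards1 inE ab card_ord addKn.
Qed.

Lemma V_permT p a b w : V a b (permT p w) = (-1) ^+ odd_perm p * V (p a) (p b) w.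
Proof.
rewrite /V -det_perm -det_mulmx -row_permE; congr (\det _).
apply/matrixP => r c; rewrite !mxE; case: (fintype.split c) => x.
  by case: ifP => _; rewrite (inj_eq perm_inj).
by rewrite tnth_permT.
Qed.

Lemma VmxC a b w : Vmx b a w = col_perm (tperm (lshift M ord0) (lshift M ord_max)) (Vmx a b w).
Proof.
apply/matrixP => r c; rewrite !mxE.
case: (fintype.split_ordP c) => x ->.
  have [->|x0] := eqVneq x ord0.
    by rewrite tpermL (fintype.unsplitK (inl _)).
  have -> : x = ord_max by apply: val_inj; case: x x0 => -[|[|]].
  by rewrite tpermR (fintype.unsplitK (inl _)).
by rewrite tpermD ?eq_lrshift// (fintype.unsplitK (inr x)).
Qed.

Lemma VC a b w : V b a w = - V a b w.
Proof.
rewrite /V VmxC col_permE det_mulmx det_perm odd_permV odd_tperm.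
by rewrite (inj_eq (@lshift_inj _ _)) /= expr1 mulrN1.
Qed.

Lemma V_neq0 a b w :
  V a b w != 0 <-> a != b /\ {in unmarked a b &, injective (tnth w)}.
Proof.
split=> [V0|[ab winj]].
  split; first by apply: contraNneq V0 => ->; apply/eqP; have := VC b b w; lra.
  move=> i j; rewrite !in_unmarked => /andP[/negPf ia /negPf ib] /andP[/negPf ja /negPf jb] wij.
apply: contraNeq V0 => ij; apply/eqP/(determinant_alternate ij) => c; rewrite !mxE.
  by case: (fintype.split c) => [x|l]; rewrite ?wij//; case: ifP; rewrite ?ia ?ja ?ib ?jb.
apply/negP => /det0P[v v0 vV]; case/eqP: v0; apply/rowP => r; rewrite [RHS]mxE.
have va : v 0 a = 0.
  have /rowP/(_ (lshift M ord0)) := vV; rewrite !mxE (bigD1 a)//= mxE.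
  rewrite (fintype.unsplitK (inl ord0)) /= eqxx mulr1 big1 ?addr0//.
  by move=> i /negPf ia; rewrite mxE (fintype.unsplitK (inl ord0)) /= ia mulr0.
have vb : v 0 b = 0.
  have /rowP/(_ (lshift M ord_max)) := vV; rewrite !mxE (bigD1 b)//= mxE.
  rewrite (fintype.unsplitK (inl ord_max)) /= eqxx mulr1 big1 ?addr0//.
  by move=> i /negPf ia; rewrite mxE (fintype.unsplitK (inl ord_max)) /= ia mulr0.
have [->//|ra] := eqVneq r a; have [->//|rb] := eqVneq r b.
have /rowP/(_ (rshift 2 (tnth w r))) := vV; rewrite !mxE (bigD1 r)//= mxE.
rewrite (fintype.unsplitK (inr _)) /= eqxx mulr1 big1 ?addr0// => i ir.
rewrite mxE (fintype.unsplitK (inr _)) /=.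
have [->|ia] := eqVneq i a; first by rewrite va mul0r.
have [->|ib] := eqVneq i b; first by rewrite vb mul0r.
case: eqP => wi; last by rewrite mulr0.
by case/eqP: ir; apply: winj; rewrite ?in_unmarked ?ia ?ib ?ra ?rb.
Qed.

Lemma V_surj a b w m : V a b w != 0 -> exists2 r, r \in unmarked a b & tnth w r = m.
Proof.
move=> /V_neq0[ab /card_in_imset wi].
have /setP/(_ m) : [set tnth w r | r in unmarked a b] = setT.
  by apply/eqP; rewrite eqEcard subsetT cardsT card_ord wi card_unmarked ?leqnn.
by rewrite inE => /imsetP[r rD ->]; exists r.
Qed.

Lemma V_surj_neq0 a b w : a != b ->
  (forall m, exists2 r, r \in unmarked a b & tnth w r = m) -> V a b w != 0.
Proof.
move=> ab ws; apply/V_neq0; split=> //; apply/imset_injP.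
rewrite card_unmarked// (_ : _ @: _ = setT) ?cardsT ?card_ord//.
by apply/setP => m; rewrite inE; have [r rD <-] := ws m; exact: imset_f.
Qed.

Lemma V_map_tperm l m a b w : l != m ->
  V a b (map_tuple (tperm l m) w) = - V a b w.
Proof.
move=> lm; rewrite /V.
have -> : Vmx a b (map_tuple (tperm l m) w)
    = col_perm (tperm (rshift 2 l) (rshift 2 m)) (Vmx a b w).
  apply/matrixP => r c; rewrite !mxE tnth_map.
  case: (fintype.split_ordP c) => x ->.
    by rewrite tpermD ?eq_rlshift// (fintype.unsplitK (inl x)).
  rewrite -(inj_tperm _ _ _ (@rshift_inj 2 M)) !(fintype.unsplitK (inr _)).
  by rewrite -(inj_eq (@perm_inj _ (tperm l m)) (tnth w r)) tpermK.
rewrite col_permE det_mulmx det_perm odd_permV odd_tperm.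
by rewrite (inj_eq (@rshift_inj _ _)) lm /= expr1 mulrN1.
Qed.

Lemma V_map (p : 'S_M) a b w :
  V a b (map_tuple p w) = (-1) ^+ odd_perm p * V a b w.
Proof.
have [ts -> tsd] := prod_tpermP p.
elim: ts tsd w => [|[l m] ts IHts] /=.
  move=> _ w; rewrite big_nil odd_perm1 mul1r; congr V.
  by apply: eq_from_tnth => i; rewrite tnth_map perm1.
move=> /andP[lm tsd] w; rewrite big_cons.
set q := (\prod_(_ <- _) _)%g in IHts *.
have -> : map_tuple (tperm l m * q)%g w = map_tuple q (map_tuple (tperm l m) w).
  by apply: eq_from_tnth => i; rewrite !tnth_map permM.
rewrite IHts// V_map_tperm// odd_permM odd_tperm lm.
by case: (odd_perm _); rewrite /=; ring.
Qed.

End MarkedVolume.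

(** The fixed letter [x] picks a representative [u] of each class of words that differ only at [r].
    With a suitable [x], sums that free different places get the same index set. *)
Lemma sum_upd (I : finType) N (P : pred (N.-tuple I)) (F : N.-tuple I -> rat)
    (r : 'I_N) (x : I) : (forall w m, P (upd w r m) = P w) ->
  \sum_(w | P w) F w = \sum_(u | P u && (tnth u r == x)) \sum_m F (upd u r m).
Proof.
move=> Pu; rewrite (partition_big (fun w => upd w r x)
  (fun u => P u && (tnth u r == x))) => [|w Pw]; last first.
  by rewrite Pu Pw tnth_upd !eqxx.
apply: eq_bigr => u /andP[Puu /eqP ur].
rewrite (partition_big (fun w => tnth w r) predT)//=; apply: eq_bigr => m _.
rewrite (big_pred1 (upd u r m)) => [//|w]; apply/andP/eqP => [[/andP[_ /eqP <-] /eqP <-]|->].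
  by rewrite upd_upd upd_id.
by split; [rewrite Pu Puu upd_upd -ur upd_id eqxx|rewrite tnth_upd !eqxx].
Qed.

(* C is a condition on the letters at the places in E. By ker_swap the masses
   below satisfy mass1 p - mass1 p' = (N - #|E|) * mass2 p p' (mass1B). *)
Section Cocycle.
Variable g : nat.
Local Notation M := (g.+1 + g.+1)%N.
Local Notation I := 'I_M.
Local Notation N := (2 + M)%N.
Local Notation word := (N.-tuple I).
Variable t : word -> rat.
Hypotheses (ti : Sp_inv t) (t0 : forall w, res t w = 0).
Variables (x : I) (s : 'I_N) (E : {set 'I_N}) (C : pred word).
Hypothesis sE : s \in E.
Hypothesis CE : forall w p m, p \notin E -> C (upd w p m) = C w.
Hypothesis Cs : forall w, C w -> tnth w s = star x.
Hypothesis Cx : forall w e, C w -> e \in E -> tnth w e != x.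

Definition mass1 p : rat := \sum_(w | C w && (tnth w p == x)) t w * V p s w.
Definition mass2 p q : rat :=
  \sum_(w | [&& C w, tnth w p == x & tnth w q == x]) t w * V p s w.

Let neqs p : p \notin E -> p != s.
Proof. by apply: contraNneq => ->. Qed.

(** The transposition of two places carrying the same letter fixes the word but moves the mark from
    one to the other. *)
Lemma mass2C p q : p \notin E -> q \notin E -> p != q -> mass2 q p = - mass2 p q.
Proof.
move=> pE qE pq; rewrite -sumrN; apply: eq_big => w; first by congr (_ && _); exact: andbC.
move=> /and3P[_ /eqP wq /eqP wp]; rewrite -mulrN; congr (_ * _).
have {2}-> : w = permT (tperm p q) w.
  apply: eq_from_tnth => j; rewrite tnth_permT.
  by case: tpermP => [->|->|//]; rewrite wp wq.
rewrite V_permT odd_tperm pq tpermL tpermD; last 2 first.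
- exact: neqs.
- exact: neqs.
by rewrite expr1 mulN1r opprK.
Qed.

(** Where [V p s w] is nonzero, the unmarked places show every letter exactly once. So [x] stands at
    exactly one further place [q], which [Cx] keeps outside [E]. *)
Lemma mass1_sum p : p \notin E ->
  mass1 p = \sum_(q | (q \notin E) && (q != p)) mass2 p q.
Proof.
move=> pE.
under [RHS]eq_bigr => q _ do rewrite /mass2 big_mkcond /=.
rewrite exchange_big /= [LHS]big_mkcond; apply: eq_bigr => w _.
case: ifP => [/andP[Cw wp]|Cwp]; last first.
  by rewrite big1// => q _; rewrite andbA Cwp.
rewrite Cw wp /=; have [V0|V0] := eqVneq (V p s w) 0.
  by rewrite V0 !mulr0 big1// => q _; rewrite if_same.
have [r rD wr] := V_surj x V0; have [_ winj] := (V_neq0 _ _ _).1 V0.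
have rE : r \notin E by apply/negP => /(Cx Cw); rewrite wr eqxx.
have rp : r != p by move: rD; rewrite in_unmarked => /andP[].
rewrite (bigD1 r) ?rE//= wr eqxx big1 ?addr0// => q /andP[/andP[qE qp] qr].
case: eqP => // wq; case/eqP: (qr); apply: winj; rewrite ?wr//.
by rewrite in_unmarked qp neqs.
Qed.

(** These are the terms of [Eop x m t u]. Nonvanishing of the volume form ensures that [x] occurs in
    [u] at these three places only, and that [m] can occur in [u] only if it is [star x]; so
    [ker_swap] applies. *)
Lemma cocycle_term p q r u m : p \notin E -> q \notin E -> r \notin E ->
  p != q -> q != r -> r != p -> C u ->
  tnth u p = x -> tnth u q = x -> tnth u r = x -> V p s (upd u r m) != 0 ->
  t (upd u r m) + t (upd u p m) + t (upd u q m) = 0.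
Proof.
move=> pE qE rE pq qr rp Cu up uq ur V0.
have [_ winj] := (V_neq0 _ _ _).1 V0.
have inD i : i != p -> i != s -> i \in unmarked p s.
  by rewrite in_unmarked => -> ->.
have rD := inD r rp (neqs rE).
have qD : q \in unmarked p s by apply: inD; rewrite ?neqs// eq_sym.
have um i : i != r -> tnth (upd u r m) i = tnth u i.
  by rewrite tnth_upd => /negPf ->.
have xm : x != m.
  apply/eqP => xm; case/eqP: (qr); apply: winj => //.
  by rewrite um// uq tnth_upd eqxx.
have ux i : i != p -> i != q -> i != r -> tnth u i != x.
  move=> ip iq ir; have [->|si] := eqVneq i s; first by rewrite (Cx Cu).
  apply/eqP => ui; case/eqP: (iq); apply: winj => //; first exact: inD.
  by rewrite um// um// uq.
have : Eop x m t u = 0.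
  apply: (ker_swap ti t0 xm); have [->|ms] := eqVneq m (star x); first by left.
  right; apply/negP => /tnthP[i ui].
  have [e|ir] := eqVneq i r; first by rewrite ui e ur eqxx in xm.
  have [e|ip] := eqVneq i p; first by rewrite ui e up eqxx in xm.
  have [e|si] := eqVneq i s; first by rewrite ui e Cs ?eqxx in ms.
  case/eqP: (ir); apply: winj => //; first exact: inD.
  by rewrite um// -ui tnth_upd eqxx.
rewrite /Eop (bigD1 r) ?ur//= (bigD1 p) ?up ?eqxx 1?eq_sym//=.
rewrite (bigD1 q) ?uq ?eqxx ?qr 1?eq_sym ?pq//= big1 ?addr0 ?addrA//.
move=> i /andP[/andP[/andP[/eqP ui ir] ip] iq].
by have := ux i ip iq ir; rewrite ui eqxx.
Qed.

Lemma mass2_cocycle p q r : p \notin E -> q \notin E -> r \notin E ->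
  p != q -> q != r -> r != p -> mass2 p q + mass2 q r + mass2 r p = 0.
Proof.
move=> pE qE rE pq qr rp.
have sN i : i \notin E -> (s == i) = false by move=> /neqs/negPf; rewrite eq_sym.
(* The letter at the third place is summed out with representative [x], so all three masses become
   sums over words with [x] at [p], [q] and [r]. *)
have red a b c : a \notin E -> b \notin E -> c \notin E -> a != c -> b != c ->
    mass2 a b = \sum_(u | [&& C u, tnth u a == x, tnth u b == x & tnth u c == x])
      \sum_m t (upd u c m) * V a s (upd u c m).
  move=> aE bE cE /negPf ac /negPf bc; rewrite /mass2 (@sum_upd _ _ _ _ c x).
    by apply: eq_bigl => u; rewrite -!andbA.
  by move=> w m; rewrite CE// !tnth_upd ac bc.
have pr : p != r by rewrite eq_sym.
have qp : q != p by rewrite eq_sym.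
have rq : r != q by rewrite eq_sym.
rewrite (red p q r)// (red q r p)// (red r p q)//.
rewrite [X in _ + X + _](eq_bigl (fun u =>
  [&& C u, tnth u p == x, tnth u q == x & tnth u r == x])) => [|u]; last first.
  by congr (_ && _); rewrite andbA andbC.
rewrite [X in _ + _ + X](eq_bigl (fun u =>
  [&& C u, tnth u p == x, tnth u q == x & tnth u r == x])) => [|u]; last first.
  by congr (_ && _); rewrite andbC -andbA.
rewrite -!big_split big1// => u /and4P[Cu /eqP up /eqP uq /eqP ur].
rewrite -!big_split big1// => m _ /=.
(* The two words differ by a 3-cycle of [p], [q], [r], which is even and carries one mark to the
   other. *)
have -> : V q s (upd u p m) = V p s (upd u r m).
  have -> : upd u p m = permT (tperm p r * tperm p q)%g (upd u r m).
    apply: eq_from_tnth => i; rewrite tnth_permT permM !tnth_upd.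
    have [->|ip] := eqVneq i p; first by rewrite tpermL tpermD// eqxx.
    have [->|ir] := eqVneq i r; first by rewrite tpermR tpermL (negPf qr) uq.
    have -> : tperm p r i = i by rewrite tpermD// eq_sym.
    have [->|iq] := eqVneq i q; first by rewrite tpermR (negPf pr) up.
    have -> : tperm p q i = i by rewrite tpermD// eq_sym.
    by rewrite (negPf ir).
  rewrite V_permT odd_permM !odd_tperm pr pq /= mul1r !permM.
  have -> : tperm p r q = q by rewrite tpermD// eq_sym.
  have -> : tperm p r s = s by rewrite tpermD ?neqs.
  by rewrite tpermR tpermD ?neqs.
have -> : V r s (upd u q m) = V p s (upd u r m).
  have -> : upd u q m = permT (tperm p q * tperm p r)%g (upd u r m).
    apply: eq_from_tnth => i; rewrite tnth_permT permM !tnth_upd.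
    have [->|iq] := eqVneq i q; first by rewrite tpermR tpermL eqxx.
    have [->|ip] := eqVneq i p; first by rewrite tpermL tpermD// (negPf qr) uq.
    have -> : tperm p q i = i by rewrite tpermD// eq_sym.
    have [->|ir] := eqVneq i r; first by rewrite tpermR (negPf pr) up.
    have -> : tperm p r i = i by rewrite tpermD// eq_sym.
    by rewrite (negPf ir).
  rewrite V_permT odd_permM !odd_tperm pr pq /= mul1r !permM.
  have -> : tperm p q r = r by rewrite tpermD// eq_sym.
  have -> : tperm p q s = s by rewrite tpermD ?neqs.
  by rewrite tpermR tpermD ?neqs.
rewrite -!mulrDl; have [->|V0] := eqVneq (V p s (upd u r m)) 0; first by rewrite mulr0.
by rewrite (cocycle_term pE qE rE)// mul0r.
Qed.

(** By [mass1_sum], each place other than [p] and [p'] contributes [mass2 p q - mass2 p' q], which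
    the cocycle relation makes [mass2 p p']; the remaining two terms give it once more each by
    antisymmetry. *)
Lemma mass1B p p' : p \notin E -> p' \notin E -> p != p' ->
  mass1 p - mass1 p' = (N - #|E|)%:R * mass2 p p'.
Proof.
move=> pE pE' pp'; rewrite !mass1_sum//.
rewrite (bigD1 p') ?pE' 1?eq_sym//= [X in _ - X](bigD1 p) ?pE ?pp'//=.
rewrite (mass2C pE pE' pp').
pose P q := [&& q \notin E, q != p & q != p'].
rewrite (eq_bigl P) => [|q]; last by rewrite /P andbA.
rewrite [X in _ - (_ + X)](eq_bigl P) => [|q]; last by rewrite /P andbAC andbA.
rewrite opprD opprK addrACA -sumrB.
rewrite (eq_bigr (fun=> mass2 p p')) => [|q /and3P[qE qp qp']]; last first.
  have := mass2_cocycle pE pE' qE pp' _ qp; rewrite eq_sym => /(_ qp').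
  by rewrite (mass2C pE qE) 1?eq_sym// => /eqP; rewrite subr_eq0 => /eqP <-; ring.
rewrite sumr_const -mulr2n -mulrnDr mulr_natl; congr (_ *+ _).
have -> : #|P| = #|~: (p |: (p' |: E))|.
  apply: eq_card => q; rewrite unfold_in /P !inE !negb_or.
  by case: (q \in E); rewrite /= ?andbF ?andbT.
rewrite cardsCs setCK !cardsU1 card_ord !inE negb_or pp' pE pE' /=.
have : (#|p |: (p' |: E)| <= N)%N by rewrite -[X in (_ <= X)%N](card_ord N) max_card.
by rewrite !cardsU1 !inE negb_or pp' pE pE' /=; lia.
Qed.

End Cocycle.

Lemma count_card (I : finType) N (w : N.-tuple I) l :
  count_mem l w = #|[pred i | tnth w i == l]|.
Proof. by rewrite -sum1_count big_tuple sum1_card. Qed.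

Lemma perm_upd (I : finType) N (w : N.-tuple I) i j : i != j ->
  permT (tperm i j) w = upd (upd w j (tnth w i)) i (tnth w j).
Proof.
move=> ij; apply: eq_from_tnth => k; rewrite tnth_permT !tnth_upd.
case: tpermP => [->|->|/eqP/negPf -> /eqP/negPf -> //]; rewrite ?eqxx//.
by rewrite eq_sym (negPf ij).
Qed.

(** * The function phi determines a tensor in the kernel *)

Section PhiInjective.
Variable g : nat.
Local Notation M := (g.+1 + g.+1)%N.
Local Notation I := 'I_M.
Local Notation N := (2 + M)%N.
Local Notation word := (N.-tuple I).

Definition phi (t : word -> rat) (l : I) (a b : 'I_N) : rat :=
  mass1 t l b (fun w => tnth w b == star l) a.

Variable t : word -> rat.
Hypotheses (ti : Sp_inv t) (t0 : forall w, res t w = 0).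

Lemma phi0_mass2 l : (forall a b, a != b -> phi t l a b = 0) ->
  forall a a' b, a != b -> a' != b -> a != a' ->
  mass2 t l b (fun w => tnth w b == star l) a a' = 0.
Proof.
move=> p0 a a' b ab a'b aa'.
have CE (w : word) p m : p \notin [set b] ->
    (tnth (upd w p m) b == star l) = (tnth w b == star l).
  by rewrite inE tnth_upd eq_sym => /negPf ->.
have Cx (w : word) e : tnth w b == star l -> e \in [set b] -> tnth w e != l.
  by move=> /eqP wb; rewrite inE => /eqP ->; rewrite wb star_neq.
have bE : b \in [set b] by rewrite inE.
have nE c : c != b -> c \notin [set b] by rewrite inE.
have := mass1B ti t0 bE CE (fun w => @eqP _ _ _) Cx (nE _ ab) (nE _ a'b) aa'.
rewrite -/(phi t l a b) -/(phi t l a' b) !p0// subrr cards1 => /esym/eqP.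
by rewrite mulf_eq0 pnatr_eq0 => /orP[/eqP|/eqP//]; lia.
Qed.

Section FourPlaces.
Variables (l : I) (a a' b b' : 'I_N).
Hypotheses (aa' : a != a') (bb' : b != b').
Definition four (w : word) :=
  [&& tnth w a == l, tnth w a' == l, tnth w b == star l & tnth w b' == star l].

Lemma four_unmarked w : four w ->
  (a' \in unmarked b a) && (b' \in unmarked b a).
Proof.
move=> /and4P[/eqP wa /eqP wa' /eqP wb /eqP wb']; have sl := star_neq l.
rewrite !in_unmarked [a' == a]eq_sym aa' [b' == b]eq_sym bb' andbT /=.
apply/andP; split; apply/eqP => e; move: sl.
  by rewrite -wb -e wa' eqxx.
by rewrite -wb' e wa eqxx.
Qed.

(** Both factors change sign. A letter standing off the four places occurs once in the whole word
    ([only]), so the vanishing of [Eop] at [u] leaves only two terms. *)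
Lemma four_tperm w i j : four w -> V b a w != 0 -> i != j ->
  i \notin [:: a; a'; b; b'] -> j \notin [:: a; a'; b; b'] ->
  t (permT (tperm i j) w) * V b a (permT (tperm i j) w) = t w * V b a w.
Proof.
move=> fw V0 ij; have [/eqP wa /eqP wa' /eqP wb /eqP wb'] := and4P fw.
rewrite !inE !negb_or => /and4P[ia ia' ib ib'] /and4P[ja ja' jb jb'].
have [ba winj] := (V_neq0 _ _ _).1 V0.
have inD k : k != a -> k != b -> k \in unmarked b a.
  by rewrite in_unmarked => -> ->.
have sl := star_neq l.
have /andP[a'D b'D] := four_unmarked fw.
have only k : k != a -> k != a' -> k != b -> k != b' ->
    forall r, tnth w r = tnth w k -> r = k.
  move=> ka ka' kb kb' r wr.
  have kD := inD _ ka kb.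
  have kl : tnth w k != l.
    by apply/eqP => e; case/eqP: ka'; apply: winj => //; rewrite e wa'.
  have kl' : tnth w k != star l.
    by apply/eqP => e; case/eqP: kb'; apply: winj => //; rewrite e wb'.
  apply: winj => //; apply: inD; apply/eqP => e.
    by move: kl; rewrite -wr e wa eqxx.
  by move: kl'; rewrite -wr e wb eqxx.
have wij : tnth w i != tnth w j.
  by apply/eqP => /only; move=> /(_ ja ja' jb jb')/eqP; rewrite (negPf ij).
pose u := upd w j (tnth w i).
have mu : tnth w j \notin u.
  apply/negP => /tnthP[k]; rewrite tnth_upd; case: (eqVneq k j) => [_ /eqP|kj /esym/only].
    by rewrite eq_sym (negPf wij).
  by move=> /(_ ja ja' jb jb')/eqP; rewrite (negPf kj).
have := ker_swap ti t0 wij (or_intror mu).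
rewrite /Eop (bigD1 j) ?tnth_upd ?eqxx//= (bigD1 i) ?tnth_upd ?(negPf ij) ?eqxx//=.
rewrite big1 ?addr0 => [|k /andP[/andP[+ /negPf kj] ki]]; last first.
  by rewrite tnth_upd kj => /eqP/only; move=> /(_ ia ia' ib ib')/eqP; rewrite (negPf ki).
rewrite /u upd_upd upd_id -perm_upd// => /eqP; rewrite addrC addr_eq0 => /eqP ->.
rewrite V_permT odd_tperm ij !tpermD //.
by rewrite expr1 mulN1r mulrNN.
Qed.

(** Transpositions off the four places carry [w] to [w'], each lowering the number of places where
    they disagree. *)
Lemma four_const w w' : four w -> four w' -> V b a w != 0 -> V b a w' != 0 ->
  t w * V b a w = t w' * V b a w'.
Proof.
move E: #|[pred i | tnth w i != tnth w' i]| => k.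
elim/ltn_ind: k w E => k IHk w E fw fw' V0 V0'.
have [k0|] := posnP k.
  suff -> : w = w' by [].
  apply: eq_from_tnth => i; apply/eqP.
  by move: E; rewrite k0 => /card0_eq/(_ i); rewrite !inE => /negbFE.
rewrite -E => /card_gt0P[i]; rewrite inE => wi.
have [_ winj] := (V_neq0 _ _ _).1 V0; have [ba winj'] := (V_neq0 _ _ _).1 V0'.
have [r rD wr] := V_surj (tnth w' i) V0.
have [/eqP wa /eqP wa' /eqP wb /eqP wb'] := and4P fw.
have [/eqP wa1 /eqP wa1' /eqP wb1 /eqP wb1'] := and4P fw'.
have i4 : i \notin [:: a; a'; b; b'].
  by rewrite !inE; apply/negP => /or4P[] /eqP e; move: wi;
    rewrite e ?wa ?wa' ?wb ?wb' ?wa1 ?wa1' ?wb1 ?wb1' eqxx.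
have ri : r != i by apply: contraNneq wi => e; rewrite -wr e.
have iD : i \in unmarked b a.
  by move: i4; rewrite in_unmarked !inE !negb_or => /and4P[-> _ ->].
have r4 : r \notin [:: a; a'; b; b'].
  have /andP[a'D b'D] := four_unmarked fw'.
  move: rD i4; rewrite in_unmarked !inE !negb_or => /andP[-> ->] /and4P[_ ia' _ ib'] /=.
  apply/andP; split; apply/eqP => e.
    by case/eqP: ia'; apply: winj' => //; rewrite -wr e wa' wa1'.
  by case/eqP: ib'; apply: winj' => //; rewrite -wr e wb' wb1'.
pose v := permT (tperm i r) w.
have neq c : c \in [:: a; a'; b; b'] -> tperm i r c = c.
  move=> c4; rewrite tpermD//; apply/eqP => e; first by rewrite e c4 in i4.
  by rewrite e c4 in r4.
have fv : four v.
  by rewrite /four /v !tnth_permT !neq ?inE ?eqxx ?orbT// wa wa' wb wb' !eqxx.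
have Vv : V b a v != 0.
  by rewrite V_permT mulf_neq0 ?signr_eq0// !neq ?inE ?eqxx ?orbT.
have ir : i != r by rewrite eq_sym.
rewrite -(four_tperm fw V0 ir i4 r4) -/v.
apply: (IHk #|[pred j | tnth v j != tnth w' j]|) => //.
rewrite -E; apply: proper_card; apply/properP; split; last first.
  by exists i; rewrite !inE// tnth_permT tpermL wr eqxx.
apply/subsetP => j; rewrite !inE tnth_permT.
case: tpermP => [->|->|//]; first by rewrite wr eqxx.
move=> _; rewrite wr; apply/eqP => e; case/eqP: ri; apply: winj' => //.
Qed.

(** The mass argument is used a second time with [l] and [star l] exchanged: [l] is frozen at [a]
    and [a'], and the place of [star l] varies. *)
Lemma four_zero : (forall a b, a != b -> phi t l a b = 0) ->
  forall w, four w -> V b a w != 0 -> t w = 0.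
Proof.
move=> p0 w fw V0.
have [/eqP wa /eqP wa' /eqP wb /eqP wb'] := and4P fw.
have /andP[] := four_unmarked fw; rewrite !in_unmarked => /andP[a'b a'a] /andP[b'b b'a].
have [ba _] := (V_neq0 _ _ _).1 V0.
have ab : a != b by rewrite eq_sym.
have b'a' : b' != a'.
  by apply/eqP => e; have := star_neq l; rewrite -wb' e wa' eqxx.
pose C (v : word) := (tnth v a == l) && (tnth v a' == l).
pose E := [set a; a'].
have nE c : c != a -> c != a' -> c \notin E by rewrite !inE negb_or => -> ->.
have bE : b \notin E by apply: nE; rewrite // eq_sym.
have bE' : b' \notin E by exact: nE.
have aE : a \in E by rewrite !inE eqxx.
have CE (v : word) p m : p \notin E -> C (upd v p m) = C v.
  rewrite /C !inE negb_or !tnth_upd ![_ == p]eq_sym => /andP[/negPf -> /negPf ->] //.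
have Cs (v : word) : C v -> tnth v a = star (star l).
  by rewrite starK => /andP[/eqP].
have Cx (v : word) e : C v -> e \in E -> tnth v e != star l.
  by move=> /andP[/eqP va /eqP va']; rewrite !inE => /orP[] /eqP ->;
    rewrite ?va ?va' eq_sym star_neq.
(* Up to the sign of [VC], this mass is the [mass2] of the first round, which vanishes by
   [phi0_mass2]. *)
have m10 c : c != a -> c != a' -> mass1 t (star l) a C c = 0.
  move=> ca ca'; have ac : a != c by rewrite eq_sym.
  have a'c : a' != c by rewrite eq_sym.
  have := phi0_mass2 p0 ac a'c aa'.
  move=> /(congr1 -%R); rewrite oppr0 => <-.
  rewrite -sumrN; apply: eq_big => v; first by rewrite andbC.
  by move=> _; rewrite VC mulrN.
have := mass1B ti t0 aE CE Cs Cx bE bE' bb'.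
have ba' : b != a' by rewrite eq_sym.
rewrite !m10// subrr => /esym/eqP.
rewrite mulf_eq0 pnatr_eq0 cards2 aa' => /orP[/eqP|]; first by rewrite addKn.
rewrite /mass2 (bigID (fun v => V b a v != 0)) /= [X in _ + X]big1; last first.
  by move=> v /andP[_]; rewrite negbK => /eqP ->; rewrite mulr0.
(* All the words left contribute equally, so the sum is a positive multiple of [t w * V b a w]. *)
rewrite (eq_bigr (fun=> t w * V b a w)) => [|v /andP[fv Vv]]; last first.
  apply: four_const => //; move: fv; rewrite /four /C => /and3P[/andP[-> ->] -> ->] //.
rewrite addr0 sumr_const mulrn_eq0 mulf_eq0 (negPf V0) orbF => /orP[|/eqP//].
move=> /eqP/card0_eq/(_ w); rewrite unfold_in /C wa wa' wb wb' !eqxx V0.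
by [].
Qed.

End FourPlaces.

(** A word with [t w] nonzero contains every letter and has two more places than there are letters;
    so some [l] occurs twice, by weight [star l] does too, and [four_zero] applies. *)
Lemma phi_inj : (forall l a b, a != b -> phi t l a b = 0) -> forall w, t w = 0.
Proof.
move=> p0 w; apply/eqP; apply: contraTT isT => tw.
have all_w m : exists r, tnth w r = m.
  by have [/tnthP[r ->]|/(ker_support ti t0)/eqP] := boolP (m \in w);
    [exists r|rewrite (negPf tw)].
have [a [a' [aa' waa']]] : exists a a', a != a' /\ tnth w a = tnth w a'.
  apply: contrapT => h; have /leq_card : injective (tnth w).
    move=> i j wij; apply: contrapT => /eqP ij; apply: h; exists i, j.
    by split.
  by rewrite !card_ord; lia.
pose l := tnth w a.
have [b [b' [bb' wb wb']]] : exists b b', [/\ b != b', tnth w b = star l & tnth w b' = star l].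
  have : (1 < count_mem (star l) w)%N.
    rewrite -(Sp_inv_weight l ti tw) count_card; apply/card_gt1P.
    by exists a, a'; rewrite !inE /l -waa' eqxx.
  rewrite count_card => /card_gt1P[b [b' []]]; rewrite !inE => /eqP ? /eqP ? ?.
  by exists b, b'.
have fw : four l a a' b b' w by rewrite /four wb wb' /l -waa' !eqxx.
have wl m : m = l -> m = star l -> False.
  by move=> -> e; have := star_neq l; rewrite -e eqxx.
have ba : b != a by apply/eqP => e; apply: (wl (tnth w a)); rewrite // -wb e.
have /andP[a'D b'D] := four_unmarked aa' bb' fw.
move: tw; rewrite (four_zero aa' bb' (p0 l) fw) ?eqxx//.
apply: V_surj_neq0 => // m.
have [->|ml] := eqVneq m l; first by exists a'; rewrite // /l waa'.
have [->|ml'] := eqVneq m (star l); first by exists b'.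
have [r wr] := all_w m; exists r => //; rewrite in_unmarked.
by apply/andP; split; apply/eqP => e; move: wr ml ml'; rewrite e ?wb => <-; rewrite eqxx.
Qed.

End PhiInjective.

(** * The Dynkin operator for odd letters with a single y *)

Section OddLetterDynkin.
Variable L : nat.

(* A word with a single letter y among letters x is encoded by the place b <= L
   of y. *)
Definition rn (r b : nat) : nat :=
  if (b < r)%N then b else if (b < L)%N then b.+1 else r.

(** The coefficient of x^j y x^(n-j) in (ad x)^n y for odd x and y, where [x, z] = x z - (-1)^n z x
    for z with n letters. *)
Fixpoint zcoef (n j : nat) : rat :=
  if n is n'.+1 then
    (if j is j'.+1 then zcoef n' j' else 0)
    - (-1) ^+ n * (if (j < n)%N then zcoef n' j else 0)
  else 1.

(** The rotated places all carry x, and [x, [x, x]] = 0 for an odd x. The bound on [n] excludes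
    [x, x] = 2 x^2, which survives. *)
Lemma dyn_rn_fixed n r (h : nat -> rat) b : (b < r)%N -> (2 <= n)%N ->
  dyn rn (-1) n r h b = 0.
Proof.
case: n => [|[|n]]//; elim: n r => [|n IHn] r br _.
  by rewrite /= /rn br ltnS (ltnW br); ring.
have -> : dyn rn (-1) n.+3 r h b = dyn rn (-1) n.+2 r.+1 h b
    - (-1) ^+ n.+3 * dyn rn (-1) n.+2 r.+1 h (rn r b) by [].
by rewrite /rn br !IHn ?mulr0 ?subr0// ltnS ltnW.
Qed.

(** Lie elements with one y form the line of (ad x)^n y: in the inductive step the words beginning
    with y bracket it with an iterated bracket of x, which is 0. *)
Lemma dyn_rn n r (h : nat -> rat) : (2 <= n)%N -> (n + r)%N = L ->
  exists c, forall b, (r <= b <= L)%N -> dyn rn (-1) n r h b = c * zcoef n (b - r).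
Proof.
case: n => [|[|n]]//; elim: n r => [|n IHn] r _ nr.
  have e1 : rn r.+1 r = r by rewrite /rn; case: ltnP => ?; [|case: ltnP => ?]; lia.
  have e2 : rn r.+1 r.+1 = r.+2 by rewrite /rn; case: ltnP => ?; [|case: ltnP => ?]; lia.
  have e3 : rn r.+1 r.+2 = r.+1 by rewrite /rn; case: ltnP => ?; [|case: ltnP => ?]; lia.
  have e4 : rn r r = r.+1 by rewrite /rn; case: ltnP => ?; [|case: ltnP => ?]; lia.
  have e5 : rn r r.+1 = r.+2 by rewrite /rn; case: ltnP => ?; [|case: ltnP => ?]; lia.
  have e6 : rn r r.+2 = r by rewrite /rn; case: ltnP => ?; [|case: ltnP => ?]; lia.
  (* The words x y x and x x y both have Dynkin bracket [x, [x, y]], and y x x has [y, [x, x]] = -2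
     [x, [x, y]]. *)
  exists (h r.+1 + h r.+2 - 2 * h r) => b rb.
  have [->|[->|->]] : b = r \/ b = r.+1 \/ b = r.+2 by lia.
  - by rewrite subnn /= !(e1, e2, e3, e4, e5, e6); ring.
  - by rewrite subSnn /= !(e1, e2, e3, e4, e5, e6); ring.
  have -> : (r.+2 - r = 2)%N by lia.
  by rewrite /= !(e1, e2, e3, e4, e5, e6); ring.
have [c cE] := IHn r.+1 isT ltac:(lia); exists c => b rb.
have -> : dyn rn (-1) n.+3 r h b = dyn rn (-1) n.+2 r.+1 h b
    - (-1) ^+ n.+3 * dyn rn (-1) n.+2 r.+1 h (rn r b) by [].
have zE j : zcoef n.+3 j = (if j is j'.+1 then zcoef n.+2 j' else 0)
    - (-1) ^+ n.+3 * (if (j < n.+3)%N then zcoef n.+2 j else 0) by [].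
rewrite zE [RHS]mulrBr [X in _ = _ - X]mulrCA; congr (_ - _ * _).
  have [->|br] := eqVneq b r; first by rewrite subnn dyn_rn_fixed ?mulr0.
  by rewrite cE; [have -> : (b - r = (b - r.+1).+1)%N by lia|lia].
have -> : rn r b = if (b < L)%N then b.+1 else r by rewrite /rn ltnNge; case/andP: rb => ->.
case: ltnP => bL.
  have -> : (b - r < n.+3)%N by lia.
  by rewrite cE; [rewrite subSS|lia].
have -> : (b - r < n.+3)%N = false by lia.
by rewrite dyn_rn_fixed ?mulr0.
Qed.

End OddLetterDynkin.

Lemma zcoef_last n : zcoef n n = 1.
Proof. by elim: n => [//|n IHn]; rewrite /= IHn ltnn mulr0 subr0. Qed.

Lemma zcoef_first n : zcoef n.*2 0 = (-1) ^+ n.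
Proof.
have e1 n' : (-1) ^+ n'.*2.+1 = -1 :> rat by rewrite -signr_odd /= odd_double.
have e2 n' : (-1) ^+ n'.*2.+2 = 1 :> rat by rewrite -signr_odd /= odd_double.
by elim: n => [//|n IHn]; rewrite doubleS /= IHn e1 e2 exprS; ring.
Qed.

(** * Symmetries of phi and the bound on the critical kernel *)

Section PhiEquivariance.
Variable g : nat.
Local Notation M := (g.+1 + g.+1)%N.
Local Notation I := 'I_M.
Local Notation N := (2 + M)%N.
Local Notation word := (N.-tuple I).
Implicit Types (t : word -> rat) (l : I).

Lemma phiP c t t' l a b :
  phi (fun v => c * t v + t' v) l a b = c * phi t l a b + phi t' l a b.
Proof.
by rewrite /phi /mass1 mulr_sumr -big_split; apply: eq_bigr => w _ /=; ring.
Qed.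

Lemma eq_phi t t' l a b : t =1 t' -> phi t l a b = phi t' l a b.
Proof. by move=> tt'; apply: eq_bigr => w _; rewrite tt'. Qed.

Lemma phi_permT (p : 'S_N) t l a b :
  phi (t \o permT p) l a b = (-1) ^+ odd_perm p * phi t l (p^-1%g a) (p^-1%g b).
Proof.
rewrite /phi /mass1 (reindex_inj (can_inj (@permTK I N p^-1%g))) /= mulr_sumr.
apply: eq_big => w; first by rewrite !tnth_permT.
by rewrite permTVK V_permT odd_permV mulrCA.
Qed.

Lemma phi_star t l a b : phi t (star l) a b = - phi t l b a.
Proof.
rewrite /phi /mass1 -sumrN; apply: eq_big => w; first by rewrite starK andbC.
by rewrite VC mulrN.
Qed.

Lemma phi_idx_map (p : 'S_g.+1) t l a b : Sp_inv t ->
  (phi t l a b == 0) = (phi t (idx_map p l) a b == 0).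
Proof.
move=> ti; pose q := perm (@idx_map_inj _ p).
have qE l' : q l' = idx_map p l' by rewrite permE.
have mE (w : word) : map_tuple q w = map_tuple (idx_map p) w.
  by apply: eq_from_tnth => i; rewrite !tnth_map qE.
have mK : cancel (@map_tuple N _ _ q) (map_tuple q^-1%g).
  by move=> w; apply: eq_from_tnth => i; rewrite !tnth_map permK.
have mK' : cancel (@map_tuple N _ _ q^-1%g) (map_tuple q).
  by move=> w; apply: eq_from_tnth => i; rewrite !tnth_map permKV.
have -> : phi t (idx_map p l) a b = (-1) ^+ odd_perm q * phi t l a b.
  rewrite /phi /mass1 (reindex_inj (can_inj mK)) /= mulr_sumr.
  apply: eq_big => w.
    by rewrite !tnth_map star_idx_map -!qE !(inj_eq (@perm_inj _ q)).
  by rewrite V_map mE Sp_inv_idx_map// mulrCA.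
by rewrite mulf_eq0 signr_eq0.
Qed.

(** The exchange of [l] and [star l] with a sign on one of them is symplectic. It reverses [V] as a
    permutation of letters, which cancels against [VC]; and [star l] occurs exactly twice, once
    marked and once unmarked, so the signs [eps] cancel. *)
Lemma phi_sym t l a b : Sp_inv t -> a != b -> phi t l a b = phi t l b a.
Proof.
move=> ti ab; pose q := tperm l (star l).
pose eps m : rat := if m == star l then -1 else 1.
have ls : l != star l by rewrite eq_sym star_neq.
have qJ m m' : eps m * eps m' * Jmx _ (q m) (q m') = Jmx _ m m'.
  have qs x : q (star x) = star (q x).
    rewrite /q; have [->|xl] := eqVneq x l; first by rewrite tpermL tpermR starK.
    have [->|xl'] := eqVneq x (star l); first by rewrite starK tpermL tpermR.
    have -> : tperm l (star l) x = x by rewrite tpermD// eq_sym.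
    apply: tpermD; apply/eqP => e; first by rewrite e starK eqxx in xl'.
    by rewrite (star_inj e) eqxx in xl.
  rewrite !JE -qs (inj_eq (@perm_inj _ q)); case: eqP => [->|_]; last by rewrite !mulr0.
  rewrite /eps (inj_eq (@star_inj _)) /q.
  have [->|xl] := eqVneq m l; first by rewrite tpermL (negPf ls) sg_star; ring.
  have [->|xl'] := eqVneq m (star l); first by rewrite tpermR sg_star; ring.
  by rewrite tpermD 1?eq_sym//; ring.
have qK : cancel (@map_tuple N _ _ q) (map_tuple q).
  by move=> w; apply: eq_from_tnth => i; rewrite !tnth_map tpermK.
rewrite {1}/phi /mass1 (reindex_inj (can_inj qK)) /=.
apply: eq_big => w.
  rewrite !tnth_map; have E x y : (q x == y) = (x == q y).
    by rewrite -(inj_eq (@perm_inj _ q) x) tpermK.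
  by rewrite !E /q tpermL tpermR andbC.
rewrite !tnth_map => /andP[/eqP wb' /eqP wa'].
have wb : tnth w b = l by apply: (@perm_inj _ q); rewrite wb' tpermL.
have wa : tnth w a = star l by apply: (@perm_inj _ q); rewrite wa' tpermR.
rewrite V_map_tperm// [V a b w]VC opprK.
have [->|V0] := eqVneq (V b a w) 0; first by rewrite !mulr0.
congr (_ * _).
rewrite -(Sp_inv_mono (@perm_inj _ q) qJ ti).
have [r rD wr] := V_surj (star l) V0.
have [_ winj] := (V_neq0 _ _ _).1 V0.
move: (rD); rewrite in_unmarked => /andP[rb ra].
rewrite (bigD1 r)//= (bigD1 a) 1?eq_sym//= /eps wr wa !eqxx big1 => [|i /andP[ir ia]].
  by ring.
have [->|ib] := eqVneq i b; first by rewrite wb (negPf ls).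
case: eqP => // wi; case/eqP: ir; apply: winj; rewrite ?wr//.
by rewrite in_unmarked ib ia.
Qed.

End PhiEquivariance.

Section KernelOfCriticalStep.
Variable g : nat.
Local Notation M := (g.+1 + g.+1)%N.
Local Notation I := 'I_M.
Local Notation N := (2 + M)%N.
Local Notation word := (N.-tuple I).
Implicit Types (t : word -> rat) (l : I).

Lemma rn_le L r b : (r <= L)%N -> (b <= L)%N -> (rn L r b <= L)%N.
Proof. by rewrite /rn => rL bL; case: ltnP => // _; case: ltnP. Qed.

Lemma rho_rn L (r b : 'I_L.+1) : (rho r)^-1%g b = inord (rn L r b).
Proof.
apply: (@perm_inj _ (rho r)); rewrite permKV; apply: val_inj.
have rL : (r <= L)%N by rewrite -ltnS.
have bL : (b <= L)%N by rewrite -ltnS.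
rewrite /= rhoE -(inj_eq val_inj) /= inordK ?ltnS ?rn_le// /rn.
have [br|rb] := ltnP b r; first by rewrite br.
have [bl|lb] := ltnP b L; last by rewrite ltnn eqxx; lia.
have -> : (b.+1 < r)%N = false by lia.
by have -> : (b.+1 == r) = false by lia.
Qed.

Lemma phi_rott r t l (b : 'I_N) : (0 < r <= M.+1)%N ->
  phi (t \o @rott I N r) l ord0 b
  = (-1) ^+ (M.+1 - r) * phi t l ord0 (inord (rn M.+1 r b)).
Proof.
move=> /andP[r0 rM]; have rN : (r < M.+2)%N by rewrite ltnS.
pose r' : 'I_M.+2 := Ordinal rN.
rewrite (@eq_phi _ _ (t \o permT (rho r'))) => [|w]; last by rewrite /= -rott_permT.
rewrite phi_permT odd_rho signr_odd; congr (_ * _); rewrite !rho_rn; congr (phi _ _ _ _).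
by apply: val_inj; rewrite /rn r0 /= inordK.
Qed.

(** The parity of the rotation from the place [r] on is that of [M.+1 - r], which is precisely the
    exponent of [s] in [dyn]; this replaces [s = 1] by [s = -1]. *)
Lemma phi_dyn n r t l (b : 'I_N) : (n + r)%N = M.+1 -> (0 < r)%N ->
  phi (dyn (@rott I N) 1 n r t) l ord0 b
  = dyn (rn M.+1) (-1) n r (fun c => phi t l ord0 (inord c)) b.
Proof.
elim: n r b => [|n IHn] r b nr r0; first by rewrite /= inord_val.
have -> : dyn (rn M.+1) (-1) n.+1 r (fun c => phi t l ord0 (inord c)) b
    = dyn (rn M.+1) (-1) n r.+1 (fun c => phi t l ord0 (inord c)) b
      - (-1) ^+ n.+1 *
        dyn (rn M.+1) (-1) n r.+1 (fun c => phi t l ord0 (inord c)) (rn M.+1 r b) by [].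
pose D := dyn (@rott I N) 1 n r.+1 t.
rewrite (@eq_phi _ _ (fun w => -1 * (D \o @rott I N r) w + D w)) => [|w]; last first.
  by rewrite [LHS]/= -/D expr1n mul1r mulN1r addrC.
rewrite phiP phi_rott ?r0/=; last by lia.
have bL : (rn M.+1 r b < M.+2)%N.
  by rewrite ltnS rn_le//; [lia|rewrite -ltnS].
rewrite !IHn//; [|lia..].
rewrite inordK// mulN1r addrC; congr (_ - _ * _); congr (_ ^+ _); lia.
Qed.

Section Cyclic.
Variable t : word -> rat.
Hypotheses (ti : Sp_inv t) (tc : cyclie (g := g.+1) (n := M) (@rott I N) t).

Lemma phi_first l : exists c, forall b : 'I_N, (0 < b)%N ->
  phi t l ord0 b = c * zcoef M b.-1.
Proof.
have [c cE] := @dyn_rn M.+1 M 1 (fun c => phi t l ord0 (inord c)) ltac:(lia) ltac:(lia).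
exists (M.+1%:R^-1 * c) => b b0; case: tc => _ tl.
rewrite -mulrA -subn1 -cE; last by rewrite b0 -ltnS; exact: ltn_ord.
rewrite -phi_dyn; [|lia|by []].
rewrite [in RHS](@eq_phi _ _ (fun w => M.+1%:R * t w + 0)) => [|w]; last by rewrite addr0; exact: tl.
rewrite (phiP _ _ (fun=> 0)) mulrDr mulKf ?pnatr_eq0//.
by rewrite [phi (fun=> 0) _ _ _]big1 ?mulr0 ?addr0// => w _; rewrite mul0r.
Qed.

Lemma phi_rot l a b : phi t l (rho ord0 a) (rho ord0 b) = - phi t l a b.
Proof.
rewrite (@eq_phi _ _ (t \o permT (rho ord0))) => [|w].
  have oM : odd M.+1 by rewrite oddS addnn odd_double.
  by rewrite phi_permT !permK odd_rho subn0 oM expr1 mulN1r.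
by rewrite /= -rott_permT; case: tc => ->.
Qed.

(** The coefficient of x^M y is 1, so the value at [ord_max] is the scalar of [phi_first]; rotation
    carries the row of the place 0 to all others. *)
Lemma phi_zero l : phi t l ord0 ord_max = 0 -> forall a b, a != b -> phi t l a b = 0.
Proof.
move=> p0; have {}p0 b : b != ord0 -> phi t l ord0 b = 0.
  move=> b0; have [c cE] := phi_first l; have := p0; rewrite cE// zcoef_last mulr1 => c0.
  by rewrite cE ?c0 ?mul0r// lt0n.
move=> a; move E: (val a) => n; elim: n a E => [|n IHn] a an b ab.
  have -> : a = ord0 by exact: val_inj.
  by apply: p0; apply: contra ab => /eqP ->; apply/eqP/val_inj.
apply/eqP; rewrite -oppr_eq0 -phi_rot; apply/eqP; apply: IHn.
  by rewrite /= rhoE -(inj_eq val_inj) /= an.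
by rewrite (inj_eq perm_inj).
Qed.

Lemma phi_even l : odd g -> phi t l ord0 ord_max = 0.
Proof.
move=> og; have [c cE] := phi_first l.
have one : (ord0 : 'I_N) != inord 1 by rewrite -(inj_eq val_inj) /= inordK.
(* This rotation takes the places (0, 1) to (last, 0), so with [phi_sym] it compares the two extreme
   coefficients of [zcoef]. *)
have := phi_rot l ord0 (inord 1).
have -> : rho (ord0 : 'I_M.+2) ord0 = ord_max by apply: val_inj; rewrite /= rhoE eqxx.
have -> : rho (ord0 : 'I_M.+2) (inord 1) = ord0.
  by apply: val_inj; rewrite /= rhoE -(inj_eq val_inj) /= inordK.
have mx : (ord_max : 'I_N) != ord0 by apply/eqP => /(congr1 val).
rewrite (phi_sym l ti mx).
rewrite !cE ?inordK// zcoef_last addnn zcoef_first mulr1 /=.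
by rewrite -signr_odd /= og /= expr0 mulr1; lra.
Qed.

Hypothesis t0 : forall w, res t w = 0.

Lemma phi_determines : phi t (lshift _ ord0) ord0 ord_max = 0 -> forall w, t w = 0.
Proof.
move=> p0; apply: phi_inj => // l a b ab.
have h l0 : (forall c d, c != d -> phi t l0 c d = 0) -> phi t l a b = 0 \/ idx l != idx l0.
  move=> pl0; have [/esym/idx_eq[->|->]|] := eqVneq (idx l) (idx l0); last by right.
    by left; exact: pl0.
  by left; rewrite phi_star pl0 ?oppr0// eq_sym.
pose l0 : I := lshift _ ord0; pose p := tperm (idx l0) (idx l).
case: (h (idx_map p l0)) => // [c d cd|].
  by apply/eqP; rewrite -phi_idx_map//; apply/eqP; exact: phi_zero.
by rewrite idx_idx_map tpermL eqxx.
Qed.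

End Cyclic.
End KernelOfCriticalStep.

(** * From infinitesimal to global invariance, and the volume form *)

Section LieInvariants.
Variable g : nat.
Local Notation I := 'I_(g + g).

Lemma ctr_sg N (t : N.+2.-tuple I -> rat) u :
  ctr t u = \sum_p sg p * t (cons_tuple p (cons_tuple (star p) u)).
Proof. by apply: eq_bigr => p _; rewrite sum_J. Qed.

Lemma upd_cons0 N p (v : N.-tuple I) m :
  upd (cons_tuple p v) ord0 m = cons_tuple m v.
Proof.
apply: eq_from_tnth => j; rewrite tnth_upd.
by case: (unliftP ord0 j) => [j'|] ->; rewrite ?tnthS ?tnth0.
Qed.

Lemma upd_consS N p (v : N.-tuple I) i m :
  upd (cons_tuple p v) (lift ord0 i) m = cons_tuple p (upd v i m).
Proof.
apply: eq_from_tnth => j; rewrite tnth_upd.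
case: (unliftP ord0 j) => [j'|] ->; rewrite ?tnthS ?tnth0//.
by rewrite (inj_eq (@lift_inj _ ord0)) tnth_upd.
Qed.

Lemma Eop_cons N l m (t : N.+1.-tuple I -> rat) p v :
  Eop l m t (cons_tuple p v) = (p == l)%:R * t (cons_tuple m v)
    + Eop l m (fun v' => t (cons_tuple p v')) v.
Proof.
rewrite /Eop big_mkcond big_ord_recl tnth0 upd_cons0; congr (_ + _).
  by case: eqP => _; rewrite ?mul1r ?mul0r.
rewrite [RHS]big_mkcond; apply: eq_bigr => i _.
by rewrite tnthS upd_consS.
Qed.

(** The derivation of the whole tensor, with its action on the two contracted places taken out. *)
Lemma Eop_ctr N l m (t : N.+2.-tuple I -> rat) u :
  Eop l m (ctr t) u =
    \sum_p sg p * Eop l m t (cons_tuple p (cons_tuple (star p) u))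
    - sg l * t (cons_tuple m (cons_tuple (star l) u))
    + sg l * t (cons_tuple (star l) (cons_tuple m u)).
Proof.
under [in RHS]eq_bigr do rewrite !Eop_cons !mulrDr.
rewrite !big_split /= (bigD1 l)//= big1 ?addr0 => [|p /negPf ->]; last by rewrite mul0r mulr0.
rewrite (bigD1 (star l))//= big1 ?addr0 => [|p pl]; last first.
  by rewrite -(inj_eq (@star_inj _)) starK (negPf pl) mul0r mulr0.
rewrite starK !eqxx !mul1r sg_star.
have -> : Eop l m (ctr t) u
    = \sum_p sg p * Eop l m (fun v => t (cons_tuple p (cons_tuple (star p) v))) u.
  rewrite /Eop; under eq_bigr do rewrite ctr_sg.
  by rewrite exchange_big; apply: eq_bigr => p _; rewrite mulr_sumr.
ring.
Qed.

Lemma ctr_Lie N (t : N.+2.-tuple I -> rat) : Lie_inv t -> Lie_inv (ctr t).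
Proof.
move=> ti l m u; rewrite !Eop_ctr.
under eq_bigr do rewrite ti.
rewrite starK sg_star mulrDr mulrBr mulr_sumr.
under [in RHS]eq_bigr do rewrite mulrCA.
rewrite -!mulrA !mulNr !mulrN !(mulrA (sg m)) sg2 !mul1r; ring.
Qed.

Lemma Lie_inv_permT N (p : 'S_N) (t : N.-tuple I -> rat) :
  Lie_inv t -> Lie_inv (t \o permT p).
Proof. by move=> ti l m w; rewrite !Eop_permT ti. Qed.

(** [Casimir] assumes only infinitesimal invariance, so the induction that lifts invariants works
    with [Sp_inv] as the subspace. This replaces an argument by generators of Sp. *)
Lemma Lie_inv_Sp n (t : n.*2.-tuple I -> rat) : Lie_inv t -> Sp_inv t.
Proof.
elim: n t => [|n IHn] t ti; first exact: Sp_inv_nil.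
move: t ti; rewrite doubleS => t ti.
apply: (@eq_Sp_inv _ _ (fun w => [ffun v => t v : rat^o] w)) => [w|].
  by rewrite ffunE.
apply: (@pred_inj_back _ _ (fun x : tensor I n.*2.+2 => Sp_inv x) (@CasF g _)).
- by apply: eq_Sp_inv (@Sp_inv0 _ _) => w; rewrite ffunE.
- move=> c x y lx ly; apply: eq_Sp_inv (Sp_invP c lx ly) => w.
  by rewrite tensorP.
- move=> x /ffunP x0; apply/ffunP => w; rewrite [RHS]ffunE.
  by apply: Cas_inj => v; have := x0 v; rewrite !ffunE.
- move=> x lx.
  apply: (@eq_Sp_inv _ _ (fun w => (g + g).+1%:R * x w
      + \sum_(i | i != ord0) (x \o permT (tperm ord0 i)) w)) => [w|].
    by rewrite ffunE.
  by apply: Sp_invP => //; apply: Sp_inv_sum => i _; exact: Sp_inv_permT.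
- apply: (@eq_Sp_inv _ _ (fun w => \sum_(i | i != ord0)
    (JT (ctr (t \o permT (tperm (one2 _) i))) \o permT (tperm (one2 _) i)) w)).
    move=> w; rewrite ffunE -Casimir// /Cas ffunE; congr (_ + _).
    by apply: eq_bigr => i _; rewrite ffunE.
  apply: Sp_inv_sum => i _; apply: Sp_inv_permT; apply: JT_inv.
  by apply: IHn; apply: ctr_Lie; exact: Lie_inv_permT.
Qed.

Local Notation M := (g + g)%N.

Definition volmx (u : M.-tuple I) : 'M[rat]_M := \matrix_(r, c) (tnth u r == c)%:R.
Definition vol (u : M.-tuple I) : rat := \det (volmx u).

Lemma vol_permT p u : vol (permT p u) = (-1) ^+ odd_perm p * vol u.
Proof.
rewrite /vol -det_perm -det_mulmx -row_permE; congr (\det _).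
by apply/matrixP => r c; rewrite !mxE tnth_permT.
Qed.

Lemma vol_inj u : vol u != 0 -> injective (tnth u).
Proof.
move=> v0 i j uij; apply: contraNeq v0 => ij; apply/eqP.
by apply: (determinant_alternate ij) => c; rewrite !mxE uij.
Qed.

Lemma vol_surj u l : vol u != 0 -> exists i, tnth u i = l.
Proof. by move=> /vol_inj/injF_bij[f _ fK]; exists (f l). Qed.

(** A nonzero term forces [u] to have [l] at exactly two places; the two resulting words differ by a
    transposition, so their volumes cancel. *)
Lemma Eop_vol l m u : l != m -> Eop l m vol u = 0.
Proof.
move=> lm.
have [i /andP[/eqP ui v0]|h] := pickP (fun i => (tnth u i == l) && (vol (upd u i m) != 0));
    last first.
  by apply: big1 => i ui; have := h i; rewrite ui /= => /negbFE/eqP.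
have [k vk] := vol_surj l v0; have inj := vol_inj v0.
have ki : k != i.
  by apply: contraNneq lm => e; rewrite -vk e tnth_upd eqxx.
have uk : tnth u k = l by move: vk; rewrite tnth_upd (negPf ki).
have ik : i != k by rewrite eq_sym.
rewrite /Eop (bigD1 i) ?ui//= (bigD1 k) ?uk ?eqxx//= big1 ?addr0; last first.
  move=> j /andP[/andP[/eqP uj ji] jk]; case/eqP: jk; apply: inj.
  by rewrite vk tnth_upd (negPf ji).
have -> : upd u k m = permT (tperm i k) (upd u i m).
  apply: eq_from_tnth => j; rewrite tnth_permT !tnth_upd.
  case: tpermP => [->|->|/eqP/negPf -> /eqP/negPf ->//].
    by rewrite (negPf ik) (negPf ki) ui uk.
  by rewrite !eqxx.
by rewrite vol_permT odd_tperm ik expr1 mulN1r subrr.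
Qed.

Lemma vol_Lie : Lie_inv vol.
Proof.
move=> l m u; have [<-|lm] := eqVneq l m; last first.
  rewrite !Eop_vol ?mulr0// (inj_eq (@star_inj _)) eq_sym; exact: lm.
rewrite sg2 mul1r !Eop_diag; have [->|v0] := eqVneq (vol u) 0; first by rewrite !mulr0.
have cnt l' : count_mem l' u = 1%N.
  have [i ui] := vol_surj l' v0.
  rewrite count_card (eq_card1 (x := i))// => j; rewrite !inE -ui.
  by apply/eqP/eqP => [/(vol_inj v0)//|->].
by rewrite !cnt.
Qed.

End LieInvariants.

(* The free Lie superalgebra on two odd generators x (false) and y (true), inside
   series over bool. Theta is its Dynkin map, Z m = (ad x^2)^m y,
   and Theta (sM m j) = [Z m, Z j], which is symmetric in m and j: hence the
   relation Theta_sF. *)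
Section OddLetters.
Implicit Types (f h G : series bool) (w u v : seq bool).

Definition ind v : series bool := fun w => (w == v)%:R.
Definition px (c : bool) f : series bool :=
  fun w => if w is c' :: u then (c' == c)%:R * f u else 0.
Local Notation X := (ind [:: false]).
Local Notation Y := (ind [:: true]).

Lemma conv_letterl c f : conv (ind [:: c]) f = px c f.
Proof.
apply/funext => -[|c' u] /=; first by rewrite mul0r addr0.
rewrite mul0r add0r conv_const => [|x v]; last by rewrite /shift /ind eqseq_cons andbF.
by rewrite /shift /ind eqseq_cons andbT.
Qed.

Lemma conv_letterr c f u c' :
  conv f (ind [:: c]) (rcons u c') = f u * (c' == c)%:R.
Proof.
elim: u f => [|x u IHu] f /=; first by rewrite /ind eqseq_cons andbT /= mulr0 addr0.
rewrite IHu /ind (_ : (_ == _) = false) ?mulr0 ?add0r//.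
by apply/negP => /eqP/(congr1 size); rewrite /= size_rcons.
Qed.

Lemma ind_px c v : ind (c :: v) = px c (ind v).
Proof.
apply/funext => -[|c' u] //=; rewrite /ind eqseq_cons.
by case: (c' == c); rewrite ?mul1r ?mul0r.
Qed.

Definition Theta n f : series bool := dyn (@rt bool) (-1) n 0 f.

Lemma ThetaP n c f h w : Theta n (c *: f + h) w = c * Theta n f w + Theta n h w.
Proof. exact: dynP. Qed.

(** Prefixing a letter becomes the superbracket with it; the sign is that of an odd letter moving
    past [n.+1] odd letters. *)
Lemma Theta_px n c f G w : (forall u, size u = n.+1 -> Theta n f u = G u) ->
  size w = n.+2 ->
  Theta n.+1 (px c f) w
  = conv (ind [:: c]) G w - (-1) ^+ n.+1 * conv G (ind [:: c]) w.
Proof.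
move=> fG wn.
have D c' u : size u = n.+1 ->
    dyn (@rt bool) (-1) n 1 (px c f) (c' :: u) = (c' == c)%:R * G u.
  move=> un; rewrite dyn_shift -fG//.
  have -> : shift c' (px c f) = (c' == c)%:R *: f + 0.
    by apply/funext => v; rewrite addr0.
  rewrite -/(Theta n _ u) ThetaP; suff -> : Theta n 0 u = 0 by rewrite addr0.
  have := ThetaP n (-1) 0 0 u; rewrite scaler0 addr0 => ->; ring.
have -> : Theta n.+1 (px c f) w = dyn (@rt bool) (-1) n 1 (px c f) w
  - (-1) ^+ n.+1 * dyn (@rt bool) (-1) n 1 (px c f) (rt 0 w) by [].
congr (_ - _ * _).
  by case: w wn => [//|c' u] [un]; rewrite D// conv_letterl.
case/lastP: w wn => [//|u c']; rewrite size_rcons => -[un].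
by rewrite /rt take0 drop0 rotr1_rcons /= D// conv_letterr mulrC.
Qed.

(** ad(x^2), which is (ad x)^2 for an odd x. Since x^2 is even, it is an ordinary commutator and a
    derivation without signs. *)
Definition Delta f : series bool := conv (conv X X) f - conv f (conv X X).

Lemma Theta_xx n f G w : (forall u, size u = n.+1 -> Theta n f u = G u) ->
  size w = n.+3 -> Theta n.+2 (px false (px false f)) w = Delta G w.
Proof.
move=> fG wn.
pose G1 : series bool := - (-1) ^+ n.+1 *: (conv G X : series bool) + conv X G.
rewrite (@Theta_px _ _ _ G1) => [|u un|//]; last first.
  by rewrite (Theta_px _ fG un) addrC -mulNr.
rewrite convPl convPr -!convA -[Delta G w]/(conv (conv X X) G w - conv G (conv X X) w).
rewrite -!convA [(-1) ^+ n.+2]exprS; set e := (-1) ^+ n.+1.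
have e2 : e * e = 1 by rewrite -expr2 sqrr_sign.
transitivity (conv X (conv X G) w - e * e * conv G (conv X X) w); first by ring.
by rewrite e2 mul1r.
Qed.

Lemma Delta_conv f h : Delta (conv f h) = conv (Delta f) h + conv f (Delta h).
Proof.
apply/funext => w.
rewrite -[LHS]/(conv (conv X X) (conv f h) w - conv (conv f h) (conv X X) w).
rewrite -[RHS]/(conv (Delta f) h w + conv f (Delta h) w) convBl convBr.
by rewrite !convA; ring.
Qed.

Lemma DeltaB f h : Delta (f - h) = Delta f - Delta h.
Proof.
apply/funext => w.
rewrite -[LHS]/(conv (conv X X) (f - h) w - conv (f - h) (conv X X) w).
rewrite convBl convBr.
rewrite -[RHS]/(conv (conv X X) f w - conv f (conv X X) w
  - (conv (conv X X) h w - conv h (conv X X) w)); ring.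
Qed.

Lemma DeltaD f h : Delta (f + h) = Delta f + Delta h.
Proof.
have D0 : Delta 0 = 0 by have := DeltaB 0 0; rewrite subr0 subrr.
have -> : f + h = f - (0 - h) by rewrite sub0r opprK.
by rewrite !DeltaB D0 sub0r opprK.
Qed.

Definition Z j : series bool := iter j Delta Y.

Definition xsy j := nseq j.*2 false ++ [:: true].

Lemma xsyS j : xsy j.+1 = [:: false, false & xsy j].
Proof. by rewrite /xsy doubleS. Qed.

Lemma Theta_xsy j w : size w = j.*2.+1 -> Theta j.*2 (ind (xsy j)) w = Z j w.
Proof.
elim: j w => [|j IHj] w wj //.
by rewrite xsyS doubleS !ind_px (Theta_xx IHj).
Qed.

(** A preimage of [Z m, Z j] under [Theta], built by the Leibniz rule [Z (m+1), Z j] = Delta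
    [Z m, Z j] - [Z m, Z (j+1)]. *)
Fixpoint sM m j : series bool :=
  if m is m'.+1 then px false (px false (sM m' j)) - sM m' j.+1
  else px true (ind (xsy j)).

Lemma Theta_sM m j w : size w = (m + j).*2.+2 ->
  Theta (m + j).*2.+1 (sM m j) w = (conv (Z m) (Z j) + conv (Z j) (Z m) : series bool) w.
Proof.
elim: m j w => [|m IHm] j w wn.
  rewrite /= (Theta_px _ (@Theta_xsy j))//.
  by rewrite -signr_odd /= odd_double /= expr1 mulN1r opprK.
have -> : sM m.+1 j = -1 *: sM m j.+1 + px false (px false (sM m j)).
  by rewrite scaleN1r addrC.
rewrite ThetaP; move: wn; rewrite addSn doubleS => wn.
rewrite [X in _ + X](Theta_xx (IHm j))//.
have E : (m + j.+1)%N = (m + j).+1 by rewrite addnS.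
have -> : Theta (m + j).*2.+3 (sM m j.+1) w
    = (conv (Z m) (Z j.+1) + conv (Z j.+1) (Z m) : series bool) w.
  by have := IHm j.+1 w; rewrite E doubleS => ->.
rewrite DeltaD !Delta_conv.
rewrite -[LHS]/(-1 * (conv (Z m) (Delta (Z j)) w + conv (Delta (Z j)) (Z m) w) +
 (conv (Delta (Z m)) (Z j) w + conv (Z m) (Delta (Z j)) w +
  (conv (Delta (Z j)) (Z m) w + conv (Z j) (Delta (Z m)) w))).
rewrite -[RHS]/(conv (Delta (Z m)) (Z j) w + conv (Z j) (Delta (Z m)) w); ring.
Qed.

Definition sF k : series bool := sM k 0 - px true (ind (xsy k)).

Lemma Theta_sF k w : size w = k.*2.+2 -> Theta k.*2.+1 (sF k) w = 0.
Proof.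
move=> wk; have -> : sF k = -1 *: sM 0 k + sM k 0 by rewrite scaleN1r addrC.
rewrite ThetaP; have := @Theta_sM k 0 w; rewrite addn0 => ->//.
rewrite (@Theta_sM 0 k w)//.
rewrite -[LHS]/(-1 * (conv (Z 0) (Z k) w + conv (Z k) (Z 0) w)
  + (conv (Z k) (Z 0) w + conv (Z 0) (Z k) w)); ring.
Qed.

Lemma sM_y m j u : sM m j (true :: u) = (-1) ^+ m * ind (xsy (m + j)) u.
Proof.
elim: m j => [|m IHm] j /=; first by rewrite ?expr0 !mul1r.
rewrite -[LHS]/(0 * px false (sM m j) u - sM m j.+1 (true :: u)) IHm.
by rewrite addnS addSn exprS; ring.
Qed.

Lemma shift_sF k : shift true (sF k) = ((-1) ^+ k - 1) *: ind (xsy k).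
Proof.
apply/funext => u; rewrite -[LHS]/(sM k 0 (true :: u) - 1%:R * ind (xsy k) u) sM_y addn0.
rewrite -[RHS]/(((-1) ^+ k - 1) * ind (xsy k) u); ring.
Qed.

(** The Dynkin operator on all places but the first gives a sum of letters tensored with Lie
    superelements. Bracketing the two factors gives [Theta] of [sF k], which is 0: this is the odd
    analogue of an element of h_(g,1). *)
Definition PF k : series bool := dyn (@rt bool) (-1) k.*2 1 (sF k).

Lemma PF_y k u : size u = k.*2.+1 -> PF k (true :: u) = ((-1) ^+ k - 1) * Z k u.
Proof.
move=> uk; rewrite /PF dyn_shift shift_sF -/(Theta _ _ _).
have := ThetaP k.*2 ((-1) ^+ k - 1) (ind (xsy k)) 0 u.
rewrite addr0 => ->; rewrite Theta_xsy//; suff -> : Theta k.*2 0 u = 0 by rewrite addr0.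
have := ThetaP k.*2 (-1) 0 0 u; rewrite scaler0 addr0 => ->; ring.
Qed.

Lemma PF_rot k w : size w = k.*2.+2 -> PF k w = - PF k (rt 0 w).
Proof.
move=> wk; have := Theta_sF wk.
have -> : Theta k.*2.+1 (sF k) w = PF k w - (-1) ^+ k.*2.+1 * PF k (rt 0 w) by [].
rewrite -signr_odd /= odd_double /= expr1 mulN1r opprK => /eqP.
by rewrite addr_eq0 => /eqP.
Qed.

Lemma DeltaE f w w1 c1 c2 u1 a b : w = [:: c1, c2 & w1] -> w = rcons (rcons u1 a) b ->
  Delta f w = (c1 == false)%:R * ((c2 == false)%:R * f w1)
    - f u1 * (a == false)%:R * (b == false)%:R.
Proof.
move=> e1 e2; rewrite -[LHS]/(conv (conv X X) f w - conv f (conv X X) w).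
congr (_ - _); first by rewrite -convA !conv_letterl e1.
by rewrite convA e2 !conv_letterr.
Qed.

Lemma nseq_rcons n : rcons (nseq n false) false = nseq n.+1 false.
Proof. by elim: n => //= n ->. Qed.

Lemma nseq_rcons2 n : nseq n.+2 false = rcons (rcons (nseq n false) false) false.
Proof. by rewrite !nseq_rcons. Qed.

Lemma Z_yx k : Z k (true :: nseq k.*2 false) = (-1) ^+ k.
Proof.
elim: k => [//|k IHk]; rewrite -[Z k.+1]/(Delta (Z k)).
rewrite (@DeltaE _ _ (nseq k.*2.+1 false) true false (true :: nseq k.*2 false) false false)//.
  by rewrite IHk exprS /=; ring.
by rewrite !rcons_cons !nseq_rcons.
Qed.

Lemma Z_xyx k : Z k.+1 [:: false, true & nseq k.*2.+1 false] = 0.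
Proof.
elim: k => [|k IHk].
  by rewrite -[Z 1]/(Delta (Z 0)) (@DeltaE _ _ [:: false] false true [:: false] true false)//.
rewrite -[Z k.+2]/(Delta (Z k.+1)).
rewrite (@DeltaE _ _ (nseq k.+1.*2.+1 false) false true
  [:: false, true & nseq k.*2.+1 false] false false)//.
  by rewrite IHk /=; ring.
exact: (congr1 (fun s => [:: false, true & s]) (nseq_rcons2 k.*2.+1)).
Qed.

(** For odd [k], [PF k] at a word beginning with y is -2 times a coefficient of [Z k]. The last two
    words are reached from the first two by two rotations and one rotation, each changing the
    sign. *)
Lemma PF_values k : odd k ->
  [/\ PF k [:: true, true & nseq k.*2 false] = 2,
      PF k [:: true, false, true & nseq k.*2.-1 false] = 0,
      PF k [:: false, false, true, true & nseq k.*2.-2 false] = 2 &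
      PF k [:: false, true, false, true & nseq k.*2.-2 false] = 0].
Proof.
case: k => [//|k] ok; rewrite doubleS /=.
have sE : (-1) ^+ k.+1 = -1 :> rat by rewrite -signr_odd ok.
have sz n : size (nseq n false) = n by rewrite size_nseq.
have v1 : PF k.+1 [:: true, true & nseq k.*2.+2 false] = 2.
  by rewrite PF_y -?doubleS ?Z_yx ?sE /= ?size_nseq//; ring.
have v2 : PF k.+1 [:: true, false, true & nseq k.*2.+1 false] = 0.
  by rewrite PF_y ?Z_xyx ?mulr0 //= size_nseq.
have rE c1 c2 n u : rt 0 [:: c1, c2 & u ++ nseq n.+1 false] = [:: false, c1, c2 & u ++ nseq n false].
  by rewrite /rt take0 drop0 -nseq_rcons -rcons_cat -!rcons_cons rotr1_rcons.
have E1 : rt 0 [:: true, true & nseq k.*2.+2 false]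
  = [:: false, true, true & nseq k.*2.+1 false] := rE true true k.*2.+1 [::].
have E2 : rt 0 [:: false, true, true & nseq k.*2.+1 false]
  = [:: false, false, true, true & nseq k.*2 false] := rE false true k.*2 [:: true].
have E3 : rt 0 [:: true, false, true & nseq k.*2.+1 false]
  = [:: false, true, false, true & nseq k.*2 false] := rE true false k.*2 [:: true].
split=> //.
- have e1 := @PF_rot k.+1 [:: true, true & nseq k.*2.+2 false].
  have e2 := @PF_rot k.+1 [:: false, true, true & nseq k.*2.+1 false].
  rewrite v1 E1 in e1; rewrite E2 in e2.
  by rewrite e1 ?e2 ?opprK //= size_nseq.
- have e1 := @PF_rot k.+1 [:: true, false, true & nseq k.*2.+1 false].
  rewrite v2 E3 in e1; apply/eqP; rewrite -oppr_eq0; apply/eqP.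
  by rewrite -e1 //= size_nseq.
Qed.

End OddLetters.

Lemma Lie_inv_Sp_even g N (t : N.-tuple 'I_(g + g) -> rat) :
  ~~ odd N -> Lie_inv t -> Sp_inv t.
Proof.
move=> Ne; have NE : N = (N./2).*2 by rewrite -[LHS]odd_double_half (negPf Ne).
by move: t; rewrite NE => t; exact: Lie_inv_Sp.
Qed.

(** * A nonzero kernel element in the critical case *)

Section CriticalInvariant.
Variable g : nat.
Local Notation M := (g.+1 + g.+1)%N.
Local Notation I := 'I_M.
Local Notation N := (2 + M)%N.
Local Notation word := (N.-tuple I).
Implicit Types (w : word) (P Q : N.-tuple bool -> rat).

(* The letter y (true) of a boolean word marks the two places contracted with Jmx,
   the letter x (false) those of the volume form: these are odd letters (Psi_dyn). *)
Definition bw (a b : 'I_N) : N.-tuple bool := [tuple (i == a) || (i == b) | i < N].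

Definition Psi P w : rat :=
  \sum_a \sum_b P (bw a b) * (Jmx g.+1 (tnth w a) (tnth w b) * V a b w).

Lemma PsiP c P Q w : Psi (fun v => c * P v + Q v) w = c * Psi P w + Psi Q w.
Proof.
rewrite /Psi mulr_sumr -big_split; apply: eq_bigr => a _ /=.
by rewrite mulr_sumr -big_split; apply: eq_bigr => b _ /=; ring.
Qed.

Lemma eq_Psi P Q w : (forall a b, P (bw a b) = Q (bw a b)) -> Psi P w = Psi Q w.
Proof. by move=> PQ; apply: eq_bigr => a _; apply: eq_bigr => b _; rewrite PQ. Qed.

Lemma V01 w : V ord0 (one2 M) w = vol (rest2 w).
Proof.
rewrite /V /vol; set A := Vmx _ _ _.
have -> : A = block_mx (1%:M : 'M_2) (ursubmx A) 0 (volmx (rest2 w)).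
  apply/matrixP => r c.
  case: (fintype.split_ordP r) => x ->; case: (fintype.split_ordP c) => y ->.
  - rewrite block_mxEul !mxE (fintype.unsplitK (inl y)) -!(inj_eq val_inj) /=.
    by case: x => -[|[|]]//; case: y => -[|[|]].
  - by rewrite block_mxEur !mxE.
  - rewrite block_mxEdl !mxE (fintype.unsplitK (inl y)) -!(inj_eq val_inj) /=.
    by case: ifP.
  - rewrite block_mxEdr !mxE (fintype.unsplitK (inr y)); congr (nat_of_bool (_ == y))%:R.
    have [p [q [u ->]]] := cons2P w; rewrite rest2_cons.
    rewrite (_ : rshift 2 x = lift ord0 (lift ord0 x)) ?tnthS//.
    exact: val_inj.
by rewrite det_ublock det1 mul1r.
Qed.

(** A matrix multiplies the volume form by its determinant, so this amounts to symplectic matrices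
    having determinant 1. *)
Lemma vol_Sp : Sp_inv (@vol g.+1).
Proof.
by apply: Lie_inv_Sp_even; [rewrite addnn odd_double|exact: vol_Lie].
Qed.

Lemma JV_inv a b : Sp_inv (fun w => Jmx g.+1 (tnth w a) (tnth w b) * V a b w).
Proof.
have [->|ab] := eqVneq a b.
  apply: eq_Sp_inv (@Sp_inv0 _ _) => w.
  have [->|V0] := eqVneq (V b b w) 0; first by rewrite mulr0.
  by have [] := (V_neq0 _ _ _).1 V0; rewrite eqxx.
(* A permutation taking the first two places to [a] and [b]; the second factor starts from wherever
   the first has sent the place 1. *)
pose p := (tperm ord0 a * tperm (tperm ord0 a (one2 M)) b)%g.
have o10 : ord0 != one2 M by [].
have pa : p ord0 = a.
  rewrite permM tpermL tpermD//; last by rewrite eq_sym.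
  by rewrite -{2}(tpermL ord0 a) (inj_eq perm_inj) eq_sym.
have pb : p (one2 M) = b by rewrite permM tpermL.
apply: (@eq_Sp_inv _ _ (fun w => (-1) ^+ odd_perm p * (JT (@vol g.+1) \o permT p) w + 0)).
  move=> w; rewrite addr0 /JT /= !tnth_permT pa pb -V01.
  rewrite V_permT pa pb.
  have : (-1) ^+ odd_perm p * (-1) ^+ odd_perm p = 1 :> rat by rewrite -signr_addb addbb.
  move: ((-1) ^+ odd_perm p) => e ee.
  by rewrite mulrCA [e * (e * _)]mulrA ee mul1r.
apply: Sp_invP; last exact: Sp_inv0.
by apply: Sp_inv_permT; apply: JT_inv; exact: vol_Sp.
Qed.

Lemma Psi_inv P : Sp_inv (Psi P).
Proof.
apply: Sp_inv_sum => a _; apply: Sp_inv_sum => b _.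
apply: eq_Sp_inv (Sp_invP (P (bw a b)) (JV_inv a b) (@Sp_inv0 _ _)) => w.
by rewrite addr0.
Qed.

Lemma Psi_permT (p : 'S_N) P w :
  Psi P (permT p w) = (-1) ^+ odd_perm p * Psi (P \o permT p) w.
Proof.
rewrite /Psi [in RHS](reindex_inj (@perm_inj _ p)) mulr_sumr; apply: eq_bigr => a _.
rewrite [in RHS](reindex_inj (@perm_inj _ p)) mulr_sumr; apply: eq_bigr => b _ /=.
have -> : permT p (bw (p a) (p b)) = bw a b.
  by apply: eq_from_tnth => i; rewrite tnth_permT !tnth_mktuple !(inj_eq perm_inj).
rewrite V_permT !tnth_permT; set e := (-1) ^+ _.
by rewrite [_ * (e * V _ _ _)]mulrCA [LHS]mulrCA.
Qed.

Lemma Psi_dyn n r P w : (n + r)%N = M.+1 ->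
  dyn (@rott I N) 1 n r (Psi P) w = Psi (dyn (@rott bool N) (-1) n r P) w.
Proof.
elim: n r w => [//|n IHn] r w nr.
have -> : dyn (@rott I N) 1 n.+1 r (Psi P) w = dyn (@rott I N) 1 n r.+1 (Psi P) w
    - 1 ^+ n.+1 * dyn (@rott I N) 1 n r.+1 (Psi P) (rott r w) by [].
have nr' : (n + r.+1)%N = M.+1 by rewrite addnS.
rewrite !(IHn _ _ nr') expr1n mul1r.
pose Q := dyn (@rott bool N) (-1) n r.+1 P; rewrite -/Q.
have rN : (r < M.+2)%N by rewrite ltnS -nr leq_addl.
have -> : rott r w = permT (rho (Ordinal rN)) w by rewrite -rott_permT.
rewrite Psi_permT odd_rho signr_odd (_ : (M.+1 - Ordinal rN = n.+1)%N); last first.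
  by rewrite /= -nr addnK.
rewrite (@eq_Psi (dyn _ _ n.+1 r P) (fun v => - (-1) ^+ n.+1 * (Q \o @rott bool N r) v + Q v)).
  rewrite PsiP mulNr [RHS]addrC; congr (_ - _ * _).
  by apply: eq_Psi => a b; rewrite /= -rott_permT.
move=> a b; have -> : dyn (@rott bool N) (-1) n.+1 r P (bw a b)
  = Q (bw a b) - (-1) ^+ n.+1 * Q (rott r (bw a b)) by [].
by rewrite /= mulNr [RHS]addrC.
Qed.

(** A word from the smaller genus misses the last pair, so its unmarked places cannot list all
    letters and every [V] vanishes. *)
Lemma Psi_res P v : res (Psi P) v = 0.
Proof.
rewrite /res /Psi big1// => a _; rewrite big1// => b _.
have [->|V0] := eqVneq (V a b (map_tuple (@em g) v)) 0; first by rewrite !mulr0.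
have [r _] := V_surj (lshift g.+1 ord_max) V0.
rewrite tnth_map => e; have : em (tnth v r) \in codom (@em g) by exact: codom_f.
by rewrite e codom_em /idx (fintype.unsplitK (inl _)) eqxx.
Qed.

Hypothesis g_even : ~~ odd g.
Let k := g.+1.
Let kM : k.*2 = M. Proof. by rewrite addnn. Qed.

(** In this form the Lie condition is [dyn1_idem], and the rotation condition is [Theta_sF] carried
    through [Psi_dyn]. *)
Definition tcrit : tensor I N :=
  [ffun w => dyn (@rott I N) 1 M 1 (Psi (sF k \o val)) w].

Lemma tcritE w : tcrit w = Psi (PF k \o val) w.
Proof.
rewrite ffunE Psi_dyn ?addn1//; apply: eq_Psi => a b.
by rewrite (dyn_val (rot' := @rt bool))// /PF kM.
Qed.

Lemma tcrit_good : good (n := M) tcrit.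
Proof.
split; last first.
  apply: eq_Sp_inv (Psi_inv (PF k \o val)) => w; by rewrite tcritE.
split=> w; last first.
  rewrite (@eq_dyn _ _ _ _ _ _ (dyn (@rott I N) 1 M 1 (Psi (sF k \o val)))) => [|v].
    by rewrite dyn1_idem ffunE.
  by rewrite ffunE.
rewrite !ffunE; apply/eqP; rewrite eq_sym -subr_eq0; apply/eqP.
transitivity (dyn (@rott I N) 1 M.+1 0 (Psi (sF k \o val)) w).
  have -> : dyn (@rott I N) 1 M.+1 0 (Psi (sF k \o val)) w
    = dyn (@rott I N) 1 M 1 (Psi (sF k \o val)) w
      - 1 ^+ M.+1 * dyn (@rott I N) 1 M 1 (Psi (sF k \o val)) (rott 0 w) by [].
  by rewrite expr1n mul1r.
rewrite Psi_dyn ?addn0// /Psi big1// => a _; rewrite big1// => b _.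
rewrite (dyn_val (rot' := @rt bool))//.
have H v : size v = N -> dyn (@rt bool) (-1) M.+1 0 (sF k) v = 0.
  by move=> sv; have := @Theta_sF k v; rewrite /Theta kM => ->.
by rewrite H ?mul0r// size_tuple.
Qed.

Let l0 : I := lshift g.+1 ord0.
Let l1 : I := star l0.
Let oneP : (1 < M)%N. Proof. by rewrite addSn addnS. Qed.
Let one : I := Ordinal oneP.
Let letters : 'S_M := tperm one l1.
(** The word l1 l0 l0 l1 followed by each remaining letter once; [letters] serves to bring [l1] to
    the place 3. *)
Let wcrit : word := cons_tuple l1 (cons_tuple l0 [tuple letters i | i < M]).
Let p0 : 'I_N := ord0.
Let p1 : 'I_N := one2 M.
Let p2 : 'I_N := rshift 2 l0.
Let p3 : 'I_N := rshift 2 one.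

Let val_p3 : val p3 = 3. Proof. by []. Qed.

Let wcritE x : tnth wcrit (rshift 2 x) = letters x.
Proof.
rewrite (_ : rshift 2 x = lift ord0 (lift ord0 x)); last exact: val_inj.
by rewrite !tnthS tnth_mktuple.
Qed.

Let w0 : tnth wcrit p0 = l1. Proof. by rewrite tnth0. Qed.
Let w1 : tnth wcrit p1 = l0. Proof. by rewrite tnthS tnth0. Qed.
Let w2 : tnth wcrit p2 = l0.
Proof.
by rewrite wcritE tpermD ?star_neq.
Qed.
Let w3 : tnth wcrit p3 = l1. Proof. by rewrite wcritE tpermL. Qed.

Let V01_neq0 : V p0 p1 wcrit != 0.
Proof.
apply: V_surj_neq0 => // m; exists (rshift 2 (letters^-1%g m)).
  by rewrite in_unmarked.
by rewrite wcritE permKV.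
Qed.

Let V32 : V p3 p2 wcrit = V p0 p1 wcrit.
Proof.
have ne i j : val i != val j -> (i == j :> 'I_N) = false by move=> /negPf; rewrite -(inj_eq val_inj).
have e : wcrit = permT (tperm p0 p3 * tperm p1 p2)%g wcrit.
  apply: eq_from_tnth => i; rewrite tnth_permT permM.
  case: (tpermP p0 p3 i) => [->|->|_ _].
  - by rewrite tpermD ?w0 ?w3 // eq_sym ne ?val_p3.
  - by rewrite tpermD ?w0 ?w3.
  by case: (tpermP p1 p2 i) => [->|->|//]; rewrite w1 w2.
rewrite [in RHS]e V_permT odd_permM !odd_tperm !permM tpermL.
rewrite !ne ?val_p3//= mul1r (tpermD (x := p0)) ?ne ?val_p3// tpermL.
by rewrite tpermD ?ne ?val_p3.
Qed.

Let bwC a b : bw a b = bw b a.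
Proof. by apply: eq_from_tnth => i; rewrite !tnth_mktuple orbC. Qed.

Let bw_list a b s : size s = N ->
  (forall i : 'I_N, nth false s i = (i == a) || (i == b)) -> val (bw a b) = s.
Proof.
move=> sN h; apply: (@eq_from_nth _ false); first by rewrite size_tuple sN.
move=> i; rewrite size_tuple => iN; rewrite (h (Ordinal iN)).
by rewrite -[i]/(val (Ordinal iN)) -tnth_nth tnth_mktuple.
Qed.

Let Q : N.-tuple bool -> rat := PF k \o val.

Let Q_values : [/\ Q (bw p0 p1) = 2, Q (bw p0 p2) = 0, Q (bw p3 p2) = 2 & Q (bw p3 p1) = 0].
Proof.
have ok : odd k by rewrite /k /= g_even.
have [v1 v2 v3 v4] := PF_values ok.
have kE : k.*2 = M := kM.
have nf n i : nth false (nseq n false) i = false by rewrite nth_nseq if_same.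
split; rewrite /Q /=.
- rewrite -v1; congr (PF k _); apply: bw_list => [|[i iN]].
    by rewrite -[LHS]/(size (nseq k.*2 false)).+2 size_nseq kE.
  by rewrite -!(inj_eq val_inj); case: i iN => [|[|i]] iN //; exact: nf.
- rewrite -v2; congr (PF k _); apply: bw_list => [|[i iN]].
    by rewrite -[LHS]/(size (nseq k.*2.-1 false)).+3 size_nseq kE.
  by rewrite -!(inj_eq val_inj); case: i iN => [|[|[|i]]] iN //; exact: nf.
- rewrite -v3; congr (PF k _); apply: bw_list => [|[i iN]].
    by rewrite -[LHS]/(size (nseq k.*2.-2 false)).+4 size_nseq kE addSn addnS.
  by rewrite -!(inj_eq val_inj); case: i iN => [|[|[|[|i]]]] iN //; exact: nf.
- rewrite -v4; congr (PF k _); apply: bw_list => [|[i iN]].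
    by rewrite -[LHS]/(size (nseq k.*2.-2 false)).+4 size_nseq kE addSn addnS.
  by rewrite -!(inj_eq val_inj); case: i iN => [|[|[|[|i]]]] iN //; exact: nf.
Qed.

(** A marking with nonzero [V] uses one of the places 0, 3 and one of the places 1, 2. Of these four
    pairs two are killed by [Q_values]; the other two contribute equally, as [V32] exchanges equal
    letters by an even permutation. So nothing cancels. *)
Lemma tcrit_neq0 : tcrit != 0.
Proof.
have [Q01 Q02 Q32 Q31] := Q_values.
suff : tcrit wcrit != 0 by apply: contraNneq => ->; rewrite ffunE.
rewrite tcritE -/Q.
pose T (ab : 'I_N * 'I_N) := Q (bw ab.1 ab.2) *
  (Jmx g.+1 (tnth wcrit ab.1) (tnth wcrit ab.2) * V ab.1 ab.2 wcrit).
have TC a b : T (b, a) = T (a, b).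
  by rewrite /T /= bwC J_sym VC mulrNN.
have T0 a b x y : x != y -> tnth wcrit x = tnth wcrit y ->
    T (a, b) != 0 -> (x \in [:: a; b]) || (y \in [:: a; b]).
  move=> xy wxy; apply: contraNT; rewrite negb_or => /andP[xab yab].
  rewrite /T /=; have [->|/V_neq0[_ inj]] := eqVneq (V a b wcrit) 0; first by rewrite !mulr0.
  case/eqP: xy; move: xab yab; rewrite !inE !negb_or => xab yab.
  by apply: inj; rewrite ?in_unmarked.
have ne i j : val i != val j -> (i == j :> 'I_N) = false by move=> /negPf; rewrite -(inj_eq val_inj).
have T03 a b : T (a, b) != 0 -> (p0 \in [:: a; b]) || (p3 \in [:: a; b]).
  by apply: T0; rewrite ?w0 ?w3// ne.
have T12 a b : T (a, b) != 0 -> (p1 \in [:: a; b]) || (p2 \in [:: a; b]).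
  by apply: T0; rewrite ?w1 ?w2// ne.
have T02 : T (p0, p2) = 0 by rewrite /T /= Q02 mul0r.
have T31 : T (p3, p1) = 0 by rewrite /T /= Q31 mul0r.
have T32 : T (p3, p2) = T (p0, p1).
  by rewrite /T /= Q01 Q32 w0 w1 w2 w3 V32.
have -> : Psi Q wcrit = \sum_ab T ab by rewrite /Psi pair_big.
rewrite (bigD1 (p0, p1))//= (bigD1 (p1, p0))//= (bigD1 (p3, p2))//= (bigD1 (p2, p3))//=.
rewrite big1 ?addr0 => [|[a b] h]; last first.
  apply/eqP; apply: contraTT h => Tab.
  have := T03 _ _ Tab; have := T12 _ _ Tab; rewrite !inE.
  move=> /orP[/orP[]|/orP[]] /eqP e1 /orP[/orP[]|/orP[]] /eqP e2;
    first [by move: e1; rewrite -e2 => /(congr1 val)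
      | by rewrite -e1 -e2 !eqxx ?andbF
      | by move: Tab; rewrite -e1 -e2 ?(TC p0 p2) ?(TC p3 p1) ?T02 ?T31 eqxx].
rewrite (TC p0 p1) (TC p3 p2) T32.
have : T (p0, p1) != 0.
  rewrite /T /= Q01 w0 w1 !mulf_eq0 negb_or (negPf V01_neq0) orbF JE starK eqxx mulr1.
  by rewrite (negPf (sg_neq0 _)).
by apply: contraNneq; lra.
Qed.

End CriticalInvariant.

(** * Kernel dimensions and the stable range *)

Lemma has_dim_kernel_large g n : (n <= g + g)%N ->
  has_dim (fun t : tensor 'I_(g.+1 + g.+1) n.+2 => good t /\ resF t = 0) 0.
Proof.
move=> ng; apply: has_dim0 => t; split=> [[[[tc _] ti] /ffunP t0]|->]; last first.
  by split; [exact: good0|apply/ffunP => w; rewrite !ffunE /res ffunE].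
have {}t0 w : res t w = 0 by have := t0 w; rewrite !ffunE.
apply/ffunP => w; rewrite [RHS]ffunE.
have [Nlt|] := ltnP n.+2 (g.+1 + g.+1)%N; first exact: (ker_small ti t0).
move=> gn.
have NE : n.+2 = (g.+1 + g.+1)%N by move: ng gn; clear; lia.
have nE : odd n.+1 by move: NE; clear; lia.
have := tc w; rewrite -[rott 0 w]/(rott (@ord0 n.+1) w) rott_permT.
rewrite (ker_permT ti t0 _ _ NE) odd_rho subn0 nE expr1; lra.
Qed.

Lemma has_dim_kernel_even g : odd g ->
  has_dim (fun t : tensor 'I_(g.+1 + g.+1) (g.+1 + g.+1).+2 => good t /\ resF t = 0) 0.
Proof.
move=> og; apply: has_dim0 => t; split=> [[[tc ti] /ffunP t0]|->]; last first.
  by split; [exact: good0|apply/ffunP => w; rewrite !ffunE /res ffunE].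
apply/ffunP => w; rewrite [RHS]ffunE.
apply: (phi_determines ti tc) => [v|]; first by have := t0 v; rewrite !ffunE.
exact: phi_even.
Qed.

Lemma has_dim_kernel_odd g : ~~ odd g ->
  has_dim (fun t : tensor 'I_(g.+1 + g.+1) (g.+1 + g.+1).+2 => good t /\ resF t = 0) 1.
Proof.
move=> og.
pose f (t : tensor 'I_(g.+1 + g.+1) (g.+1 + g.+1).+2) := phi t (lshift _ ord0) ord0 ord_max.
apply: (@has_dim1 _ _ _ f (tcrit g : tensor 'I_(g.+1 + g.+1) (g.+1 + g.+1).+2)).
- split; first exact: tcrit_good.
  apply/ffunP => w; rewrite !ffunE -[RHS](Psi_res (PF g.+1 \o val) w).
  by rewrite /res tcritE.
- exact: tcrit_neq0.
- move=> c x y [gx x0] [gy y0]; split; first exact: goodP.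
  by rewrite linearP /= x0 y0 scaler0 addr0.
- move=> c x y; rewrite -phiP; apply: eq_phi => w; exact: tensorP.
- move=> x [[tc ti] /ffunP x0] px; apply/ffunP => w; rewrite [RHS]ffunE.
  by apply: (phi_determines ti tc) => // v; have := x0 v; rewrite !ffunE.
Qed.

Lemma has_dim_good_exists g n : exists d, has_dim (@good g n) d.
Proof. by apply: has_dim_exists; [exact: good0|exact: goodP]. Qed.

Lemma has_dim_good_stable n g0 d : ~~ odd n -> (n <= g0 + g0)%N ->
  has_dim (@good g0 n) d -> forall g, (g0 <= g)%N -> has_dim (@good g n) d.
Proof.
move=> ne ng dg g; elim: g => [|g IHg]; first by rewrite leqn0 => /eqP <-.
rewrite leq_eqVlt => /orP[/eqP <-//|]; rewrite ltnS => g0g.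
rewrite -[d]addn0; apply: has_dim_step => //; first exact: IHg.
by apply: has_dim_kernel_large; lia.
Qed.

Theorem theorem1p2 (k : nat) (hk : (1 <= k)%N) :
  (odd k ->
     exists d : nat, forall g : nat, (k <= g)%N ->
       has_dim (@hg1_Sp g (2 * k)) d) /\
  (~~ odd k ->
     exists d : nat, forall g : nat, (k - 1 <= g)%N ->
       has_dim (@hg1_Sp g (2 * k)) d) /\
  (odd k -> (3 <= k)%N ->
     exists d : nat,
       has_dim (@hg1_Sp (k - 1) (2 * k)) d /\
       has_dim (@hg1_Sp k (2 * k)) (d + 1)).
Proof.
have -> : (2 * k = k + k)%N by rewrite mul2n addnn.
have ne : ~~ odd (k + k) by rewrite addnn odd_double.
split=> [ok|]; last split=> [ek|ok k3].
- have [d dk] := has_dim_good_exists k (k + k).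
  by exists d => g kg; apply: has_dim_good; exact: has_dim_good_stable dk _ kg.
- case: k ek {hk} ne => [|g] ek ne; first by have [d d0] := has_dim_good_exists 0 0;
    exists d => g _; apply: has_dim_good; exact: has_dim_good_stable d0 _ _.
  have og : odd g by rewrite -[odd g]negbK.
  have [d dg] := has_dim_good_exists g (g.+1 + g.+1).
  (* The step from genus [k - 1] to [k] is the critical one; from genus [k] on [has_dim_good_stable]
     applies. *)
  have dg1 : has_dim (@good g.+1 (g.+1 + g.+1)) d.
    by rewrite -[d]addn0; apply: has_dim_step => //; exact: has_dim_kernel_even.
  exists d => g'; rewrite subn1 leq_eqVlt => /orP[/eqP <-|gg']; apply: has_dim_good => //.
  exact: has_dim_good_stable dg1 _ gg'.
- case: k ok {hk k3} ne => [//|g] ok ne.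
  have [d dg] := has_dim_good_exists g (g.+1 + g.+1).
  exists d; rewrite subn1; split; apply: has_dim_good => //.
  by apply: has_dim_step => //; exact: has_dim_kernel_odd.
Qed.
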